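(* Let $X\neq\{0\}$ be a complex Banach space with open unit ball $B$, let $0\le\alpha<1$, and let $f:B\to X$ be a normalized almost starlike mapping of order $\alpha$ on $B$. Then for every $x\in B\setminus\{0\}$ and every $T_x\in T(x)$, $$\left|2T_x\left(\frac{D^3f(0)(x^3)}{3!}\right)\|x\|-2T_x\left(\frac{D^2f(0)}{2!}\left(x,\frac{D^2f(0)(x^2)}{2!}\right)\right)\|x\|+\frac{\left[T_x\left(\frac{D^2f(0)(x^2)}{2!}\right)\right]^2}{1-\alpha}\right|\le 2(1-\alpha)\|x\|^4 .$$ This inequality is sharp: for each such $X$ and $\alpha$, the constant $2(1-\alpha)$ on the right-hand side cannot be replaced by a smaller one valid for all such $f$, all $x\in B\setminus\{0\}$ and all $T_x\in T(x)$.
   Context: $X$ is a complex Banach space with norm $\|\cdot\|$ and $B=\{x\in X:\|x\|<1\}$. For $x\in X\setminus\{0\}$, $T(x)=\{T_x\in X^*:\|T_x\|=1,\ T_x(x)=\|x\|\}$. For holomorphic $f:B\to X$, $D^mf(x)$ denotes the $m$-th Fréchet derivative at $x$ (a bounded symmetric $m$-linear map $X^m\to X$), $D^mf(x)(y^m)=D^mf(x)(y,\dots,y)$, and $\frac{D^2f(0)}{2!}(x,y)=\frac12D^2f(0)(x,y)$. A holomorphic $f$ is normalized if $f(0)=0$ and $Df(0)=I$, and locally biholomorphic if $Df(x)$ has a bounded inverse for each $x\in B$. For $\alpha\in[0,1)$, a normalized locally biholomorphic mapping $f:B\to X$ is almost starlike of order $\alpha$ on $B$ if $\mathrm{Re}\{T_x[(Df(x))^{-1}f(x)]\}\ge\alpha\|x\|$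 for all $x\in B\setminus\{0\}$ and all $T_x\in T(x)$. *)

(* Defs.v *)
From HB Require Import structures.
From mathcomp Require Import all_boot all_order all_algebra.
From mathcomp Require Import all_classical all_reals all_analysis.
From mathcomp Require Import complex.

Set Implicit Arguments.
Unset Strict Implicit.
Unset Printing Implicit Defensive.

Import Order.TTheory GRing.Theory Num.Theory.
Import numFieldNormedType.Exports.

Local Open Scope classical_set_scope.
Local Open Scope ring_scope.
Local Open Scope complex_scope.

(* Norms of complex normed modules are R[i]-valued; in R[i], a <= b holds iff
   a and b have the same imaginary part and Re a <= Re b. *)

Section FrechetDerivatives.
Context {K : numFieldType} {V W : normedModType K}.

Definition set_slot m (s : m.-tuple V) (i : 'I_m) (u : V) : m.-tuple V :=
  [tuple dfwith (tnth s) i u j | j < m].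

Definition multilinear m (A : m.-tuple V -> W) : Prop :=
  forall (i : 'I_m) (s : m.-tuple V) (a : K) (u v : V),
    A (set_slot s i (a *: u + v)) =
    a *: A (set_slot s i u) + A (set_slot s i v).

Definition bounded_multilinear m (A : m.-tuple V -> W) : Prop :=
  multilinear A /\
  exists M : K, forall s, `|A s| <= M * \prod_(i < m) `|tnth s i|.

(* For F : V -> L^m(V; W), A : V^(m+1) -> W is the Frechet derivative of F at
   x under L(V, L^m(V; W)) = L^(m+1)(V; W), where L^m(V; W) carries the
   operator norm: the estimate below, uniform in s, says that the operator
   norm of F (x + h) - F x - A h is at most eps * |h|. *)
Definition is_frechet_derivative m (F : V -> m.-tuple V -> W) (x : V)
    (A : m.+1.-tuple V -> W) : Prop :=
  bounded_multilinear A /\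
  forall eps : K, 0 < eps ->
    \forall h \near nbhs (0 : V), forall s : m.-tuple V,
      `|F (x + h) s - F x s - A (cons_tuple h s)|
        <= eps * `|h| * \prod_(i < m) `|tnth s i|.

(* D^m f(x), with value 0 where the derivative of D^(m-1) f does not exist *)
Fixpoint Dn (m : nat) (f : V -> W) : V -> m.-tuple V -> W :=
  if m is k.+1 then
    fun x => xget (fun=> 0) [set A | is_frechet_derivative (Dn (m:=k) f) x A]
  else fun x _ => f x.

End FrechetDerivatives.
Arguments Dn {K V W} m f x s.

Section AlmostStarlike.
Context {R : realType} {X : completeNormedModType R[i]}.

Definition unit_ball : set X := [set x | `|x| < 1].

(* The supremum is 0 for an unbounded functional, see [sup]. *)
Definition dual_norm (T : {linear X -> R[i]^o}) : R :=
  sup [set complex.Re `|T y| | y in [set y : X | `|y| <= 1]].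

Definition support_functionals (x : X) : set {linear X -> R[i]^o} :=
  [set T : {linear X -> R[i]^o} |
    [/\ continuous (T : X -> R[i]^o), dual_norm T = 1 & T x = `|x|]].

Definition holomorphic_on_ball (f : X -> X) : Prop :=
  forall x, unit_ball x -> differentiable f x.

Definition normalized (f : X -> X) : Prop :=
  f 0 = 0 /\ forall v, 'd f 0 v = v.

Definition has_bounded_inverse (A : X -> X) : Prop :=
  exists B : {linear X -> X}, [/\ continuous B, cancel A B & cancel B A].

Definition locally_biholomorphic (f : X -> X) : Prop :=
  forall x, unit_ball x -> has_bounded_inverse ('d f x).

(* A^-1 y, meaningful for bijective A *)
Definition inv_at (A : X -> X) (y : X) : X := xget 0 [set v | A v = y].

Definition almost_starlike (alpha : R) (f : X -> X) : Prop :=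
  [/\ holomorphic_on_ball f, normalized f, locally_biholomorphic f &
    forall x, unit_ball x -> x != 0 ->
    forall T, support_functionals x T ->
      alpha%:C * `|x| <= (complex.Re (T (inv_at ('d f x) (f x))))%:C].

Definition taylor2 (f : X -> X) (x y : X) : X :=
  (2`!%:R)^-1 *: Dn 2 f 0 [tuple x; y].

Definition taylor3 (f : X -> X) (x y z : X) : X :=
  (3`!%:R)^-1 *: Dn 3 f 0 [tuple x; y; z].

Definition fekete_szego (alpha : R) (f : X -> X) (x : X)
    (T : {linear X -> R[i]^o}) : R[i] :=
  2 * T (taylor3 f x x x) * `|x|
  - 2 * T (taylor2 f x (taylor2 f x x)) * `|x|
  + T (taylor2 f x x) ^+ 2 / (1 - alpha)%:C.

End AlmostStarlike.

(* Main.v *)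
(* Along the complex line through x, put v = (Df)^-1 f and
   p(z) = (T(v(z x)) / (z |x|) - alpha) / (1 - alpha).  The hypothesis says that
   Re p >= 0 on the disc of radius 1 / |x|, and comparing the Taylor expansions
   of both sides of Df(z x) v(z x) = f(z x) up to order 3 gives p = 1 + p1 z +
   p2 z^2 + ... with fekete_szego = (1 - alpha) |x|^2 (p1^2 - p2).  Here
   p1^2 - p2 is the second coefficient of 1 / p, whose real part is also
   nonnegative, so it is at most 2 |x|^2 in modulus.

   Higher derivatives of a Frechet differentiable map exist by Cauchy estimates,
   which all follow from the mean value property on circles.  The latter is
   Goursat's theorem for F(exp(zeta)) on a rectangle of height 2 pi; no integral
   is needed, since trapezoidal sums over dyadic subdivisions already satisfy the
   exact additivity used in Goursat's bisection.

   Equality is attained by f(x) = phi(T x) x with T a Hahn-Banach support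
   functional and t phi' / phi = 2 (1 - alpha) t^2 / (1 - (1 - 2 alpha) t^2). *)

(* No regularity of [v] as a map on the ball is established. Local biholomorphy gives a lower bound
   [c * |u| <= |Df(y) u|] that is uniform for [y] near a given point, so an error in the equation
   [Df(y) v(y) = f(y)] controls the error in [v] itself. Both the derivative of [v] along a line and
   its third-order expansion are therefore guessed from the formal identity and confirmed by
   estimating the residual.

   Passing to 1 / p meets the obstacle that only [Re p >= 0] is known, so [p] might come close to 0.
   Adding a small positive constant to [p] keeps the reciprocal bounded; the constant is removed in
   the limit.

   The extremal map is designed so that the function p attached to it is [(1 - s) / (1 + s)] with
   [s] the square of [T] at the point. Then p1 = 0 and p2 is extremal, and the second-order Taylor
   term of the map vanishes, so the sharp constant comes from the cubic term alone. *)
Require Import Defs.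
From HB Require Import structures.
From mathcomp Require Import all_boot all_order all_algebra.
From mathcomp Require Import all_classical all_reals all_analysis.
From mathcomp Require Import complex.
From mathcomp Require Import ring lra.

Set Implicit Arguments.
Unset Strict Implicit.
Unset Printing Implicit Defensive.

Import Order.TTheory GRing.Theory Num.Theory.
Import numFieldNormedType.Exports.

Local Open Scope classical_set_scope.
Local Open Scope ring_scope.
Local Open Scope complex_scope.

(** * Linear identities *)

(* K + V with V of square zero: a commutative ring containing the K-module V,
   in which linear identities of V become ring identities. *)
Section TrivialExtension.
Context {K : comNzRingType} {V : lmodType K}.

Definition triv_ext : Type := (K * V)%type.
HB.instance Definition _ := GRing.Zmodule.on triv_ext.

Definition te_mul (x y : triv_ext) : triv_ext :=
  (x.1 * y.1, x.1 *: y.2 + y.1 *: x.2).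
Definition te_one : triv_ext := (1, 0).

Fact te_mulA : associative te_mul.
Proof.
move=> [a x] [b y] [c z]; rewrite /te_mul /=; congr (_, _); first exact: mulrA.
rewrite !scalerDr !scalerA [c * a]mulrC [c * b]mulrC -addrA.
by congr (_ + _); rewrite addrC.
Qed.

Fact te_mulC : commutative te_mul.
Proof. by move=> [a x] [b y]; rewrite /te_mul /= mulrC addrC. Qed.

Fact te_mul1 : left_id te_one te_mul.
Proof. by move=> [a x]; rewrite /te_mul /= mul1r scale1r scaler0 addr0. Qed.

Fact te_mulDl : left_distributive te_mul +%R.
Proof.
move=> [a x] [b y] [c z]; rewrite /te_mul /=; congr (_, _); first exact: mulrDl.
by rewrite /= scalerDl scalerDr addrACA.
Qed.

Fact te_one_neq0 : te_one != 0.
Proof. by apply/eqP => -[/eqP]; rewrite oner_eq0. Qed.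

HB.instance Definition _ := GRing.Zmodule_isComNzRing.Build triv_ext
  te_mulA te_mulC te_mul1 te_mulDl te_one_neq0.

Definition te_scal (a : K) : triv_ext := (a, 0).
Definition te_vect (x : V) : triv_ext := (0, x).

Fact te_scal_zmod : zmod_morphism te_scal.
Proof. by move=> a b; congr (_, _); rewrite /= subr0. Qed.
Fact te_scal_mul : monoid_morphism te_scal.
Proof.
by split=> // a b; congr (_, _); rewrite /= !scaler0 addr0.
Qed.
HB.instance Definition _ := GRing.isZmodMorphism.Build K triv_ext te_scal te_scal_zmod.
HB.instance Definition _ := GRing.isMonoidMorphism.Build K triv_ext te_scal te_scal_mul.

Lemma te_vectD x y : te_vect (x + y) = te_vect x + te_vect y.
Proof. by congr (_, _); rewrite /= addr0. Qed.
Lemma te_vectN x : te_vect (- x) = - te_vect x.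
Proof. by congr (_, _); rewrite /= oppr0. Qed.
Lemma te_vectZ a x : te_vect (a *: x) = te_scal a * te_vect x.
Proof. by congr (_, _); rewrite /= ?mulr0 // scale0r addr0. Qed.
Lemma te_vect0 : te_vect 0 = 0. Proof. by []. Qed.

Lemma te_vectI : injective te_vect. Proof. by move=> x y []. Qed.
End TrivialExtension.

Definition te_vectE {K : comNzRingType} {V : lmodType K} :=
  (@te_vectD K V, @te_vectN K V, @te_vectZ K V, @te_vect0 K V).

Section TrivialExtensionScalars.
Context {K : comNzRingType} {V : lmodType K}.
Local Notation ts := (@te_scal K V).

Lemma te_scalD a b : ts (a + b) = ts a + ts b. Proof. exact: rmorphD. Qed.
Lemma te_scalN a : ts (- a) = - ts a. Proof. exact: rmorphN. Qed.
Lemma te_scalM a b : ts (a * b) = ts a * ts b. Proof. exact: rmorphM. Qed.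
Lemma te_scalX a n : ts (a ^+ n) = ts a ^+ n. Proof. exact: rmorphXn. Qed.
Lemma te_scal1 : ts 1 = 1. Proof. exact: rmorph1. Qed.
Lemma te_scal0 : ts 0 = 0. Proof. by []. Qed.
Lemma te_scalMn a n : ts (a *+ n) = ts a *+ n. Proof. exact: rmorphMn. Qed.

End TrivialExtensionScalars.

Definition te_scalE {K : comNzRingType} {V : lmodType K} :=
  (@te_scalD K V, @te_scalN K V, @te_scalM K V, @te_scalX K V,
   @te_scal1 K V, @te_scal0 K V, @te_scalMn K V).

(* The atoms are generalized because [ring] does not identify the different
   instance paths to the ring structure of [R[i]]. *)
Ltac module :=
  apply: te_vectI; rewrite ?te_vectE ?te_scalE;
  repeat match goal with
  | |- context [te_vect ?x] => move: (te_vect x) => ?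
  | |- context [te_scal ?x] => move: (te_scal x) => ?
  end; clear; ring.

(** * Real-valued norms *)

Section RealNorm.
Context {R : realType}.
Local Notation C := R[i].

(* [`|x|] is a nonnegative real in [R[i]], where the order is only partial;
   [rn x] is the same number in the ordered field [R]. *)
Definition rn {V : normedZmodType C} (x : V) : R := complex.Re `|x|.

Section NormedZmod.
Context {V : normedZmodType C}.
Implicit Types x y : V.

Lemma rnE x : `|x| = (rn x)%:C.
Proof. by rewrite /rn RRe_real // normr_real. Qed.

Lemma rn_ge0 x : 0 <= rn x.
Proof. by rewrite -lecR -rnE normr_ge0. Qed.

Lemma ler_rnD x y : rn (x + y) <= rn x + rn y.
Proof. by rewrite -lecR rmorphD /= -!rnE ler_normD. Qed.

Lemma rnN x : rn (- x) = rn x. Proof. by rewrite /rn normrN. Qed.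
Lemma rn0 : rn (0 : V) = 0. Proof. by rewrite /rn normr0. Qed.
Lemma rn_eq0 x : (rn x == 0) = (x == 0).
Proof. by rewrite -(inj_eq (@complexI R)) -rnE normr_eq0. Qed.
Lemma rn_gt0 x : (0 < rn x) = (x != 0).
Proof. by rewrite lt_def rn_ge0 andbT rn_eq0. Qed.
Lemma rn_distC x y : rn (x - y) = rn (y - x).
Proof. by rewrite -rnN opprB. Qed.
Lemma ler_rnB x y : rn (x - y) <= rn x + rn y.
Proof. by rewrite -(rnN y) ler_rnD. Qed.
Lemma ler_rn_dist x y : rn x - rn y <= rn (x - y).
Proof. by have := ler_rnD (x - y) y; rewrite subrK; lra. Qed.
End NormedZmod.

Lemma rnM (a b : C) : rn (a * b) = rn a * rn b.
Proof. by apply: (@complexI R); rewrite rmorphM /= -!rnE normrM. Qed.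
Lemma rnV (a : C) : rn a^-1 = (rn a)^-1.
Proof. by apply: (@complexI R); rewrite fmorphV /= -!rnE normfV. Qed.
Lemma rnX (a : C) n : rn (a ^+ n) = rn a ^+ n.
Proof. by apply: (@complexI R); rewrite rmorphXn /= -!rnE normrX. Qed.
Lemma rn1 : rn (1 : C) = 1. Proof. by rewrite /rn normr1. Qed.
Lemma rn_real (x : R) : rn x%:C = `|x|.
Proof. by rewrite /rn normc_def /= expr0n addr0 sqrtr_sqr. Qed.
Lemma rn_nat n : rn (n%:R : C) = n%:R.
Proof. by rewrite /rn normr_nat -(rmorph_nat (real_complex R)). Qed.
Lemma rn_conj (a : C) : rn a^* = rn a.
Proof. by rewrite /rn normcJ. Qed.
Lemma rn_i : rn ('i : C) = 1.
Proof. by rewrite /rn normc_def /= expr0n add0r expr1n sqrtr1. Qed.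

Lemma normr_Re_le (a : C) : `|complex.Re a| <= rn a.
Proof. by rewrite -lecR -rnE normc_ge_Re. Qed.
Lemma Re_le_rn (a : C) : complex.Re a <= rn a.
Proof. exact: le_trans (ler_norm _) (normr_Re_le a). Qed.
Lemma rn_le_ReIm (a : C) : rn a <= `|complex.Re a| + `|complex.Im a|.
Proof.
rewrite {1}[a]complexE (le_trans (ler_rnD _ _)) // rnM rn_i mul1r.
by rewrite !rn_real.
Qed.

Lemma rnZ {V : normedModType C} (a : C) (x : V) : rn (a *: x) = rn a * rn x.
Proof. by apply: (@complexI R); rewrite rmorphM /= -!rnE normrZ. Qed.
End RealNorm.

Section RealDerivative.
Context {R : realType}.

(** Removes the difference quotient, so that the real derivatives of exp, cos and sin can enter the
    remainder estimate for [cexp]. *)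
Lemma is_derive_bound (f : R -> R) (x d : R) : is_derive x 1 f d ->
  forall e : R, 0 < e -> exists2 r : R, 0 < r &
    forall h, `|h| < r -> `|f (x + h) - f x - h * d| <= e * `|h|.
Proof.
case=> df fd e e0.
move: df; rewrite /derivable; move: fd; rewrite /derive => -> /cvgrPdist_le /(_ e e0).
case=> r /= r0 H; exists r => // h hr.
have [->|h0] := eqVneq h 0; first by rewrite addr0 subrr mul0r subrr !normr0 mulr0.
have := H h; rewrite /ball_ /= sub0r normrN => /(_ hr h0) Hh.
rewrite -ler_pdivrMr ?normr_gt0 // -normfV -normrM.
move: Hh; rewrite /= /GRing.scale /= mulr1 [h + x]addrC distrC => Hh.
by congr (`| _ | <= _): Hh; field.
Qed.

End RealDerivative.

(** * Landau symbols and complex derivatives *)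

Section LittleO.
Context {R : realType}.
Local Notation C := R[i].

(** The point [h = 0] is not excluded, so [small_o n E] forces [E 0 = 0], and [small_o 0] of an
    increment is continuity. *)
Definition small_o {V W : normedZmodType C} (n : nat) (E : V -> W) :=
  forall e : R, 0 < e -> exists2 r : R, 0 < r &
    forall h, rn h < r -> rn (E h) <= e * rn h ^+ n.

Definition big_o {V W : normedZmodType C} (n : nat) (E : V -> W) :=
  exists2 K : R, 0 < K & exists2 r : R, 0 < r &
    forall h, rn h < r -> rn (E h) <= K * rn h ^+ n.

Section Zmod.
Context {V W : normedZmodType C}.
Implicit Types E F : V -> W.

Lemma small_o_big_o n E : small_o n E -> big_o n E.
Proof. by move=> /(_ 1 ltr01); exists 1. Qed.

Lemma big_o_small_o n E : big_o n.+1 E -> small_o n E.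
Proof.
move=> [K K0 [r r0 H]] e e0; exists (Num.min r (e / K)).
  by rewrite lt_min r0 divr_gt0.
move=> h; rewrite lt_min => /andP[hr he]; apply: le_trans (H h hr) _.
rewrite exprS mulrA ler_wpM2r ?exprn_ge0 ?rn_ge0 //.
by rewrite mulrC -ler_pdivlMr // ltW.
Qed.

Lemma small_o_near n E F (r : R) : 0 < r -> (forall h, rn h < r -> E h = F h) ->
  small_o n E -> small_o n F.
Proof.
move=> r0 EF oE e /oE[s s0 H]; exists (Num.min r s); first by rewrite lt_min r0.
by move=> h; rewrite lt_min => /andP[hr hs]; rewrite -EF // H.
Qed.

Lemma small_o_ext n E F : E =1 F -> small_o n E -> small_o n F.
Proof. by move=> EF; apply: (@small_o_near _ _ _ 1). Qed.

Lemma small_oD n E F : small_o n E -> small_o n F ->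
  small_o n (fun h => E h + F h).
Proof.
move=> oE oF e e0; have e20 : 0 < e / 2 by rewrite divr_gt0.
have [r r0 HE] := oE _ e20; have [s s0 HF] := oF _ e20.
exists (Num.min r s); first by rewrite lt_min r0.
move=> h; rewrite lt_min => /andP[hr hs].
rewrite [in leRHS](splitr e) mulrDl (le_trans (ler_rnD _ _)) //.
by rewrite lerD ?HE ?HF.
Qed.

Lemma small_oN n E : small_o n E -> small_o n (fun h => - E h).
Proof.
by move=> oE e /oE[r r0 H]; exists r => // h /H; rewrite rnN.
Qed.

Lemma small_oB n E F : small_o n E -> small_o n F ->
  small_o n (fun h => E h - F h).
Proof. by move=> oE /small_oN; apply: small_oD. Qed.

Lemma small_o0 n : small_o n (fun _ : V => 0 : W).
Proof.
move=> e e0; exists 1 => // h _.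
by rewrite rn0 mulr_ge0 ?exprn_ge0 ?rn_ge0 // ltW.
Qed.

Lemma small_oW n E : small_o n.+1 E -> small_o n E.
Proof. by move=> /small_o_big_o/big_o_small_o. Qed.

Lemma big_oD n E F : big_o n E -> big_o n F ->
  big_o n (fun h => E h + F h).
Proof.
move=> [K K0 [r r0 HE]] [L L0 [s s0 HF]].
exists (K + L); first exact: addr_gt0.
exists (Num.min r s); first by rewrite lt_min r0.
move=> h; rewrite lt_min => /andP[hr hs].
by rewrite (le_trans (ler_rnD _ _)) // mulrDl lerD ?HE ?HF.
Qed.

Lemma big_o_cst (c : W) : big_o 0 (fun _ : V => c).
Proof.
exists (rn c + 1); first by rewrite ltr_pwDr ?rn_ge0.
by exists 1 => // h _; rewrite expr0 mulr1 lerDl.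
Qed.

Lemma big_o_near n E F (r : R) : 0 < r -> (forall h, rn h < r -> E h = F h) ->
  big_o n E -> big_o n F.
Proof.
move=> r0 EF [K K0 [s s0 H]]; exists K => //.
exists (Num.min r s); first by rewrite lt_min r0.
by move=> h; rewrite lt_min => /andP[hr hs]; rewrite -EF // H.
Qed.

Lemma big_o_ext n E F : E =1 F -> big_o n E -> big_o n F.
Proof. by move=> EF; apply: (@big_o_near _ _ _ 1). Qed.

Lemma small_o_at0 n E : small_o n E -> E 0 = 0.
Proof.
move=> oE; apply/eqP; rewrite -rn_eq0 eq_le rn_ge0 andbT.
apply/ler_addgt0Pr => e e0; have [r r0 H] := small_o_big_o oE.
have [s s0 /(_ 0)] := oE _ e0; rewrite rn0 => /(_ s0) H'.
apply: le_trans H' _; rewrite add0r -[leRHS]mulr1 ler_wpM2l ?(ltW e0) //.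
by rewrite expr0n; case: (n == 0)%N.
Qed.
End Zmod.

Section Lmod.
Context {V : normedZmodType C} {W : normedModType C}.
Implicit Types (a : V -> C) (E : V -> W).

Lemma big_oZ m n a E : big_o m a -> big_o n E ->
  big_o (m + n) (fun h => a h *: E h).
Proof.
move=> [K K0 [r r0 Ha]] [L L0 [s s0 HE]].
exists (K * L); first exact: mulr_gt0.
exists (Num.min r s); first by rewrite lt_min r0.
move=> h; rewrite lt_min => /andP[hr hs].
by rewrite rnZ exprD mulrACA ler_pM ?rn_ge0 ?Ha ?HE.
Qed.

Lemma big_o_small_oZ m n a E : big_o m a -> small_o n E ->
  small_o (m + n) (fun h => a h *: E h).
Proof.
move=> [K K0 [r r0 Ha]] oE e e0.
have [s s0 HE] := oE (e / K) (divr_gt0 e0 K0).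
exists (Num.min r s); first by rewrite lt_min r0.
move=> h; rewrite lt_min => /andP[hr hs]; rewrite rnZ exprD.
rewrite (_ : e * _ = (K * rn h ^+ m) * (e / K * rn h ^+ n)).
  by rewrite ler_pM ?rn_ge0 ?Ha ?HE.
by field; rewrite gt_eqF.
Qed.

Lemma small_o_big_oZ m n a E : small_o m a -> big_o n E ->
  small_o (m + n) (fun h => a h *: E h).
Proof.
move=> oa [K K0 [r r0 HE]] e e0.
have [s s0 Ha] := oa (e / K) (divr_gt0 e0 K0).
exists (Num.min r s); first by rewrite lt_min r0.
move=> h; rewrite lt_min => /andP[hr hs]; rewrite rnZ exprD.
rewrite (_ : e * _ = (e / K * rn h ^+ m) * (K * rn h ^+ n)).
  by rewrite ler_pM ?rn_ge0 ?Ha ?HE.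
by field; rewrite gt_eqF.
Qed.
End Lmod.

Lemma big_o_id {V : normedZmodType C} : big_o 1 (id : V -> V).
Proof. by exists 1 => //; exists 1 => // h _; rewrite mul1r expr1. Qed.

Lemma big_oX n : big_o n (fun h : C => h ^+ n).
Proof. by exists 1 => //; exists 1 => // h _; rewrite mul1r rnX. Qed.

Lemma small_oX n : small_o n (fun h : C => h ^+ n.+1).
Proof. exact/big_o_small_o/big_oX. Qed.

Lemma small_o_comp {U V W : normedZmodType C} n (a : U -> V) (E : V -> W) :
  big_o 1 a -> small_o n E -> small_o n (fun h => E (a h)).
Proof.
move=> [K K0 [r r0 Ha]] oE e e0.
have K0n : 0 < K ^+ n by rewrite exprn_gt0.
have [s s0 HE] := oE (e / K ^+ n) (divr_gt0 e0 K0n).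
exists (Num.min r (s / K)); first by rewrite lt_min r0 divr_gt0.
move=> h; rewrite lt_min => /andP[hr hs].
have hK : rn (a h) <= K * rn h by rewrite -[X in K * X]expr1 Ha.
have /HE H : rn (a h) < s.
  by apply: le_lt_trans hK _; rewrite mulrC -ltr_pdivlMr.
apply: le_trans H _; rewrite -mulrA ler_wpM2l ?(ltW e0) //.
rewrite mulrC ler_pdivrMr // mulrC -exprMn.
by rewrite lerXn2r ?nnegrE ?rn_ge0 // mulr_ge0 ?rn_ge0 // ltW.
Qed.

End LittleO.

Section ComplexDerivative.
Context {R : realType}.
Local Notation C := R[i].

Definition has_cderiv {W : normedModType C} (F : C -> W) (z : C) (d : W) :=
  small_o 1 (fun h => F (z + h) - F z - h *: d).

Section Vector.
Context {W : normedModType C}.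
Implicit Types (F G : C -> W) (z : C) (d : W).

Lemma has_cderiv_big_o F z d : has_cderiv F z d ->
  big_o 1 (fun h => F (z + h) - F z).
Proof.
move=> /small_o_big_o H.
have := big_oD H (big_oZ big_o_id (big_o_cst d)).
by apply: big_o_ext => h; rewrite subrK.
Qed.

Lemma has_cderiv_cont F z d : has_cderiv F z d ->
  small_o 0 (fun h => F (z + h) - F z).
Proof. by move=> /has_cderiv_big_o/big_o_small_o. Qed.

Lemma has_cderiv_near F G z d (r : R) : 0 < r ->
  (forall h, rn h < r -> F (z + h) = G (z + h)) ->
  has_cderiv F z d -> has_cderiv G z d.
Proof.
move=> r0 FG; have Fz : F z = G z by have := FG 0; rewrite rn0 addr0 => ->.
by apply: small_o_near r0 _ => h hr; rewrite FG // Fz.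
Qed.

Lemma has_cderiv_ext F G z d : F =1 G -> has_cderiv F z d -> has_cderiv G z d.
Proof. by move=> FG; apply: (@has_cderiv_near _ _ _ _ 1). Qed.

Lemma has_cderiv_cst (c : W) z : has_cderiv (fun=> c) z 0.
Proof.
by apply: small_o_ext (small_o0 1) => h; rewrite subrr scaler0 subrr.
Qed.

Lemma has_cderivD F G z d d' : has_cderiv F z d -> has_cderiv G z d' ->
  has_cderiv (fun w => F w + G w) z (d + d').
Proof.
move=> HF HG; apply: small_o_ext (small_oD HF HG) => h; module.
Qed.

Lemma has_cderivN F z d : has_cderiv F z d -> has_cderiv (fun w => - F w) z (- d).
Proof.
by move=> HF; apply: small_o_ext (small_oN HF) => h; module.
Qed.

Lemma has_cderivB F G z d d' : has_cderiv F z d -> has_cderiv G z d' ->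
  has_cderiv (fun w => F w - G w) z (d - d').
Proof. by move=> HF /has_cderivN; apply: has_cderivD. Qed.

End Vector.

Section VectorScalar.
Context {W : normedModType C}.
Implicit Types (F : C -> W) (z : C) (d : W).

Lemma has_cderivZ (a : C -> C^o) F z da d : has_cderiv a z da -> has_cderiv F z d ->
  has_cderiv (fun w => a w *: F w) z (a z *: d + da *: F z).
Proof.
move=> Ha HF.
have H1 := big_o_small_oZ (big_o_cst (a z)) HF.
have H2 := small_o_big_oZ Ha (big_o_cst (F z)).
have := has_cderiv_cont HF => /(big_o_small_oZ (has_cderiv_big_o Ha)) H3.
apply: small_o_ext (small_oD (small_oD H1 H2) H3) => h /=.
rewrite /GRing.scale /= -/(GRing.scale _ _); module.
Qed.

Lemma has_cderiv_comp (a : C -> C^o) F z da d :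
  has_cderiv a z da -> has_cderiv F (a z) d ->
  has_cderiv (fun w => F (a w)) z (da *: d).
Proof.
move=> Ha HF.
have H1 := small_o_comp (has_cderiv_big_o Ha) HF.
have H2 := small_o_big_oZ Ha (big_o_cst d).
apply: small_o_ext (small_oD H1 H2) => h /=.
rewrite [a z + _]addrC subrK.
rewrite /GRing.scale /= -/(GRing.scale _ _); module.
Qed.

Lemma has_cderiv_unique F z d d' : has_cderiv F z d -> has_cderiv F z d' -> d = d'.
Proof.
move=> H H'; have oB := small_oB H' H.
apply/eqP; rewrite -subr_eq0 -rn_eq0 eq_le rn_ge0 andbT.
apply/ler_addgt0Pr => e e0; rewrite add0r.
have [r r0 /(_ (r / 2)%:C)] := oB e e0.
rewrite rn_real ger0_norm ?divr_ge0 ?(ltW r0) //.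
have -> : r / 2 < r by rewrite ltr_pdivrMr // ltr_pMr // ltr1n.
move=> /(_ isT).
set t := (r / 2)%:C; set A := rn _.
have -> : A = rn (t *: (d - d')) by rewrite /A; congr (rn _); module.
rewrite rnZ rn_real ger0_norm ?divr_ge0 ?(ltW r0) // expr1 mulrC.
by rewrite ler_pM2r // divr_gt0.
Qed.
End VectorScalar.

Lemma has_cderiv_id z : has_cderiv (id : C -> C^o) z 1.
Proof.
apply: small_o_ext (small_o0 1) => h /=.
by rewrite /GRing.scale /= mulr1 [z + h]addrC addrK subrr.
Qed.

Lemma has_cderivM (a b : C -> C^o) z da db : has_cderiv a z da -> has_cderiv b z db ->
  has_cderiv (fun w => a w * b w : C^o) z (a z * db + da * b z).
Proof. exact: has_cderivZ. Qed.

Lemma has_cderivV (a : C -> C^o) z da : has_cderiv a z da -> a z != 0 ->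
  has_cderiv (fun w => (a w)^-1 : C^o) z (- da / a z ^+ 2).
Proof.
move=> Ha az0; pose t := rn (a z) / 2.
have t0 : 0 < t by rewrite divr_gt0 // rn_gt0.
have [r r0 Hr] := has_cderiv_cont Ha t0.
have nz h : rn h < r -> t <= rn (a (z + h)).
  move=> /Hr; rewrite expr0 mulr1 rn_distC => H.
  by have := ler_rn_dist (a z) (a (z + h)); rewrite /t in H *; lra.
have bV : big_o 0 (fun h => (a (z + h))^-1).
  exists t^-1; rewrite ?invr_gt0 //; exists r => // h /nz H.
  rewrite expr0 mulr1 rnV lef_pV2 // posrE //; exact: lt_le_trans H.
(* With [t = a (z + h) - a z] the increment of the inverse is [t ^ 2 / (a z ^ 2 * a (z + h)) - t / a
   z ^ 2]. The first term is quadratic in [h], and the second differs from its linear part by a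
   multiple of the remainder of [a]. *)
have H1 := big_oZ bV (has_cderiv_big_o Ha).
have H2 := big_oZ (has_cderiv_big_o Ha) H1.
have H3 := big_o_small_oZ (big_o_cst (a z ^- 2)) (big_o_small_o H2).
have H4 := big_o_small_oZ (big_o_cst (- a z ^- 2)) Ha.
apply: (small_o_near r0) (small_oD H3 H4) => h /nz H /=.
rewrite /GRing.scale /=; field; rewrite az0 /=.
by rewrite -rn_gt0 (lt_le_trans t0).
Qed.

End ComplexDerivative.

(** * The complex exponential *)

Section ComplexExponential.
Context {R : realType}.
Local Notation C := R[i].

Definition cexp (z : C) : C :=
  (expR (complex.Re z))%:C * (cos (complex.Im z) +i* sin (complex.Im z)).

Lemma cexpD z w : cexp (z + w) = cexp z * cexp w.
Proof.
case: z w => [a b] [c d]; rewrite /cexp /= expRD sinD cosD.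
by apply/eqP; rewrite eq_complex /=; apply/andP; split; apply/eqP; ring.
Qed.

Lemma cexp_real (x : R) : cexp x%:C = (expR x)%:C.
Proof. by rewrite /cexp /= sin0 cos0 mulr1. Qed.

Lemma cexp0 : cexp 0 = 1.
Proof. by rewrite (_ : 0 = 0%:C) // cexp_real expR0. Qed.

Lemma rn_cexp z : rn (cexp z) = expR (complex.Re z).
Proof.
rewrite rnM rn_real ger0_norm ?expR_ge0 //.
by rewrite /rn normc_def /= cos2Dsin2 sqrtr1 mulr1.
Qed.

Lemma cexp_neq0 z : cexp z != 0.
Proof. by rewrite -rn_gt0 rn_cexp expR_gt0. Qed.

Lemma cexpDpi z : cexp (z + pi%:C * 'i) = - cexp z.
Proof.
rewrite cexpD [cexp (_ * 'i)]/cexp /= !(mul0r, mulr0, mulr1, subrr, addr0).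
rewrite cospi sinpi expR0; case: (cexp z) => a b.
by apply/eqP; rewrite eq_complex /=; apply/andP; split; apply/eqP; ring.
Qed.

Lemma cexpDpihalf z : cexp (z + (pi / 2)%:C * 'i) = 'i * cexp z.
Proof.
rewrite cexpD [cexp (_ * 'i)]/cexp /= !(mul0r, mulr0, mulr1, subrr, addr0).
rewrite cos_pihalf sin_pihalf expR0; case: (cexp z) => a b.
by apply/eqP; rewrite eq_complex /=; apply/andP; split; apply/eqP; ring.
Qed.

Lemma cexpD2pi z : cexp (z + (pi *+ 2)%:C * 'i) = cexp z.
Proof. by rewrite mulr2n rmorphD /= mulrDl addrA !cexpDpi opprK. Qed.

Lemma has_cderiv_cexp0 : has_cderiv (cexp : C -> C^o) 0 1.
Proof.
have He := @is_derive_bound R _ 0 _ (is_derive_expR 0).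
have Hc := @is_derive_bound R _ 0 _ (is_derive_cos 0).
have Hs := @is_derive_bound R _ 0 _ (is_derive_sin 0).
(* The real and imaginary parts of the remainder are bounded by [3 * e' * n] and [4 * e' * n], hence
   the 8. The bound [1 / 2] keeps the factor [1 + x + a], which is [expR x], below 2. *)
move=> e e0; pose e' := Num.min (e / 8) (1 / 2).
have e'0 : 0 < e' by rewrite lt_min !divr_gt0.
have e'1 : e' <= 1 / 2 by rewrite ge_min lexx orbT.
have e'e : e' <= e / 8 by rewrite ge_min lexx.
move: e' e'0 e'1 e'e => e' e'0 e'1 e'e.
have [r r0 {}He] := He _ e'0; have [s s0 {}Hc] := Hc _ e'0.
have [t t0 {}Hs] := Hs _ e'0.
exists (Num.min (Num.min r s) (Num.min t e')).
  by rewrite !lt_min r0 s0 t0.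
case=> x y; rewrite !lt_min => /andP[/andP[hr hs] /andP[ht he]].
have hx : `|x| <= rn (x +i* y) := normr_Re_le (x +i* y).
have hy : `|y| <= rn (x +i* y).
  by have := normr_Re_le ('i * (x +i* y)); rewrite rnM rn_i mul1r /= mul0r mul1r sub0r normrN.
move: (rn (x +i* y)) hr hs ht he hx hy => n hr hs ht he hx hy.
have {He} := He x (le_lt_trans hx hr); rewrite add0r expR0 mulr1 => He.
have {Hc} := Hc y (le_lt_trans hy hs); rewrite add0r cos0 sin0 oppr0 mulr0 subr0 => Hc.
have {Hs} := Hs y (le_lt_trans hy ht); rewrite add0r cos0 sin0 mulr1 subr0 => Hs.
apply: le_trans (rn_le_ReIm _) _.
rewrite cexp0 add0r expr1 /cexp /GRing.scale /=.
set Ex := expR x in He *; set cy := cos y in Hc *; set sy := sin y in Hs *.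
pose a := Ex - 1 - x; pose b := cy - 1; pose d := sy - y.
have -> : Ex * cy - 0 * sy - 1 - (x * 1 - y * 0) = a + (1 + x + a) * b.
  by rewrite /a /b; ring.
have -> : Ex * sy + 0 * cy - 0 - (x * 0 + y * 1) = (1 + x + a) * d + (x + a) * y.
  by rewrite /a /b /d; ring.
have ha : `|a| <= e' * n by apply: le_trans He _; rewrite ler_pM2l.
have hb : `|b| <= e' * n by apply: le_trans Hc _; rewrite ler_pM2l.
have hd : `|d| <= e' * n by apply: le_trans Hs _; rewrite ler_pM2l.
have n0 : 0 <= n by apply: le_trans hx.
have h1 : `|x + a| <= 2 * e'.
  have := ler_normD x a; have : e' * n <= e' * 1 by rewrite ler_pM2l; lra.
  by lra.
have h2 : `|1 + x + a| <= 2.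
  by have := ler_normD 1 (x + a); rewrite normr1 addrA; lra.
have h3 : `|a + (1 + x + a) * b| <= 3 * (e' * n).
  apply: le_trans (ler_normD _ _) _; rewrite normrM.
  have : `|1 + x + a| * `|b| <= 2 * (e' * n) by rewrite ler_pM.
  by lra.
have h4 : `|(1 + x + a) * d + (x + a) * y| <= 4 * (e' * n).
  apply: le_trans (ler_normD _ _) _; rewrite !normrM.
  have : `|1 + x + a| * `|d| <= 2 * (e' * n) by rewrite ler_pM.
  have : `|x + a| * `|y| <= 2 * e' * n by rewrite ler_pM.
  by lra.
have : e' * n <= e / 8 * n by rewrite ler_wpM2r.
have : 0 <= e * n by rewrite mulr_ge0 // ltW.
by lra.
Qed.

Lemma has_cderiv_cexp z : has_cderiv (cexp : C -> C^o) z (cexp z).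
Proof.
have := big_o_small_oZ (big_o_cst (cexp z)) has_cderiv_cexp0.
apply: small_o_ext => h /=.
by rewrite /GRing.scale /= add0r cexp0 cexpD; ring.
Qed.

End ComplexExponential.

(** * Goursat's theorem and the mean value property *)

Section Bisection.
Context {R : realType}.

Local Notation "'h_ k" := ((2^-1 : R) ^+ k) (at level 10, k at level 9).

Let hE k : 'h_k = 'h_k.+1 + 'h_k.+1.
Proof. by rewrite exprS; lra. Qed.

Let h_gt0 k : 0 < 'h_k. Proof. by rewrite exprn_gt0 // invr_gt0. Qed.

Lemma halving_small (e : R) : 0 < e -> exists K, forall n, (K <= n)%N -> 'h_n < e.
Proof.
move=> e0; have /cvgrPdist_lt /(_ _ e0) [K _ HK] : (fun k => 'h_k) @ \oo --> (0 : R).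
  by apply: cvg_expr; rewrite ger0_norm ?invr_ge0 // invf_lt1 // ltr1n.
by exists K => n /HK; rewrite sub0r normrN ger0_norm // ltW.
Qed.

Lemma nested_halving (u : nat -> R) :
  (forall k, u k <= u k.+1 <= u k + 'h_k.+1) ->
  exists x, forall k, u k <= x <= u k + 'h_k.
Proof.
move=> uP.
have u_le k m : u k <= u (k + m)%N <= u k + 'h_k - 'h_(k + m).
  elim: m => [|m /andP[IH1 IH2]]; first by rewrite addn0 lexx /=; lra.
  have /andP[H1 H2] := uP (k + m)%N; rewrite addnS.
  by have := hE (k + m)%N; rewrite (le_trans IH1) //=; lra.
have ub k : ubound (range u) (u k + 'h_k).
  move=> _ [m _ <-]; have [km|/ltnW mk] := leqP k m.
    by have := u_le k (m - k)%N; rewrite subnKC //; have := h_gt0 m; lra.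
  have := u_le m (k - m)%N; rewrite subnKC //; have := h_gt0 k; lra.
exists (sup (range u)) => k; apply/andP; split.
  by apply: sup_upper_bound; [split; [exists (u 0), 0 | exists (u 0 + 'h_0)] | exists k].
by apply: ge_sup => //; exists (u 0), 0.
Qed.

(** Goursat's bisection as an induction principle. If the unit square fails, some quarter fails at
    each stage; the nested failing squares shrink to a point, and the local hypothesis at that point
    is contradicted. *)
Lemma dyadic_square_induction (P : R -> R -> nat -> Prop) :
  (forall s t k, P s t k.+1 -> P (s + 'h_k.+1) t k.+1 ->
     P s (t + 'h_k.+1) k.+1 -> P (s + 'h_k.+1) (t + 'h_k.+1) k.+1 -> P s t k) ->
  (forall x y, 0 <= x <= 1 -> 0 <= y <= 1 -> exists K, forall s t k, (K <= k)%N ->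
     s <= x <= s + 'h_k -> t <= y <= t + 'h_k -> P s t k) ->
  P 0 0 0.
Proof.
move=> Pstep Ploc; apply: contrapT => nP0.
pose good (p : R * R * nat) (q : R * R) := ~ P p.1.1 p.1.2 p.2 ->
  [/\ ~ P q.1 q.2 p.2.+1, p.1.1 <= q.1 <= p.1.1 + 'h_p.2.+1 &
      p.1.2 <= q.2 <= p.1.2 + 'h_p.2.+1].
have /choice[f fP] : forall p, exists q, good p q.
  move=> [[s t] k]; apply: contrapT => /forallNP H.
  have nP : ~ P s t k by move=> Pst; apply: (H (s, t)) => /=.
  have h1 := h_gt0 k.+1.
  apply: nP; apply: Pstep; apply: contrapT => nP;
    [apply: (H (s, t)) | apply: (H (s + 'h_k.+1, t)) |
     apply: (H (s, t + 'h_k.+1)) | apply: (H (s + 'h_k.+1, t + 'h_k.+1))];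
    move=> _; split=> //=; lra.
pose u := fix u k := if k is m.+1 then f (u m, m) else (0, 0) : R * R.
have uP k : ~ P (u k).1 (u k).2 k by elim: k => //= k /(fP (u k, k))[].
have [x Hx] : exists x, forall k, (u k).1 <= x <= (u k).1 + 'h_k.
  by apply: nested_halving => k; have [] := fP (u k, k) (uP k).
have [y Hy] : exists y, forall k, (u k).2 <= y <= (u k).2 + 'h_k.
  by apply: nested_halving => k; have [] := fP (u k, k) (uP k).
have x01 : 0 <= x <= 1 by have := Hx 0; rewrite /= expr0 add0r.
have y01 : 0 <= y <= 1 by have := Hy 0; rewrite /= expr0 add0r.
have [K HK] := Ploc x y x01 y01.
by apply: (uP K); apply: HK.
Qed.
End Bisection.

Lemma half_double {K : numFieldType} (u : K) : (u + u) / 2 = u.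
Proof. by field. Qed.

(** * Trapezoidal means over dyadic subdivisions *)

Section DyadicMean.
Context {R : realType}.
Local Notation C := R[i].

(* The trapezoidal mean of [F] over the segment [p, p + u] divided in [2 ^ n]
   equal parts. *)
Fixpoint dmean {W : normedModType C} (n : nat) (F : C -> W) (p u : C) : W :=
  if n is m.+1 then 2^-1 *: (dmean m F p (u / 2) + dmean m F (p + u / 2) (u / 2))
  else 2^-1 *: (F p + F (p + u)).

Let segment_left (p u : C) (t : R) : 0 <= t <= 1 ->
  exists2 s, 0 <= s <= 1 & p + t%:C * u = p + s%:C * (u + u).
Proof.
move=> t01; exists (t / 2); first by lra.
by rewrite fmorph_div /= (rmorph_nat (real_complex R)); field.
Qed.

Let segment_right (p u : C) (t : R) : 0 <= t <= 1 ->
  exists2 s, 0 <= s <= 1 & p + u + t%:C * u = p + s%:C * (u + u).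
Proof.
move=> t01; exists ((1 + t) / 2); first by lra.
by rewrite fmorph_div /= rmorphD /= (rmorph_nat (real_complex R)); field.
Qed.

Section Vector.
Context {W : normedModType C}.
Implicit Types (F G : C -> W) (n : nat) (p u v : C) (t : R).

Lemma dmeanS n F p u :
  dmean n.+1 F p (u + u) = 2^-1 *: (dmean n F p u + dmean n F (p + u) u).
Proof. by rewrite /= half_double. Qed.

Lemma eq_dmean n F G p u :
  (forall t, 0 <= t <= 1 -> F (p + t%:C * u) = G (p + t%:C * u)) ->
  dmean n F p u = dmean n G p u.
Proof.
elim: n p u => [|n IH] p u FG.
  have := FG 0; have := FG 1; rewrite !rmorph0 !rmorph1 mul0r mul1r addr0 /=.
  by move=> -> //=; [move=> -> //=; lra | lra].
have [w wE] : exists w, u = w + w by exists (u / 2); field.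
rewrite wE in FG *; rewrite !dmeanS; congr (_ *: (_ + _)); apply: IH => t t01.
  by have [s s01 ->] := segment_left p w t01; apply: FG.
by have [s s01 ->] := segment_right p w t01; apply: FG.
Qed.

(** At every level the trapezoidal mean of an affine function is exactly its value at the midpoint,
    and averaging does not increase a uniform error. *)
Lemma dmean_affine n F (c0 c1 : W) p u (e : R) :
  (forall t, 0 <= t <= 1 ->
     rn (F (p + t%:C * u) - (c0 + (p + t%:C * u) *: c1)) <= e) ->
  rn (dmean n F p u - (c0 + (p + u / 2) *: c1)) <= e.
Proof.
have halfE (x : W) : x = (2^-1 : C) *: x + (2^-1 : C) *: x.
  by rewrite -scalerDl (_ : 2^-1 + 2^-1 = 1) ?scale1r //; field.
have mid (x y m1 m2 m : W) : rn (x - m1) <= e -> rn (y - m2) <= e ->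
    m1 + m2 = m + m -> rn ((2^-1 : C) *: (x + y) - m) <= e.
  move=> h1 h2 hm; rewrite [m in _ - m]halfE -scalerDr -hm -scalerBr rnZ rnV rn_nat.
  rewrite mulrC ler_pdivrMr // opprD addrACA (le_trans (ler_rnD _ _)) //; lra.
elim: n p u => [|n IH] p u H.
  have H0 := H 0; have H1 := H 1; rewrite !rmorph0 !rmorph1 mul0r mul1r addr0 in H0 H1.
  apply: (mid _ _ _ _ _ (H0 _) (H1 _)); [lra|lra|].
    have h2 : u = u / 2 + u / 2 by field.
  by move: (u / 2) h2 => h ->; module.
have [w wE] : exists w, u = w + w by exists (u / 2); field.
rewrite wE in H *; rewrite dmeanS half_double.
apply: mid (IH p w _) (IH (p + w) w _) _.
- by move=> t t01; have [s s01 ->] := segment_left p w t01; apply: H.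
- by move=> t t01; have [s s01 ->] := segment_right p w t01; apply: H.
have h2 : w = w / 2 + w / 2 by field.
by move: (w / 2) h2 => h ->; module.
Qed.

Lemma dmean_bound n F (c : W) p u (e : R) :
  (forall t, 0 <= t <= 1 -> rn (F (p + t%:C * u) - c) <= e) ->
  rn (dmean n F p u - c) <= e.
Proof.
move=> H; have := @dmean_affine n F c 0 p u e.
by rewrite scaler0 addr0; apply => t t01; rewrite scaler0 addr0 H.
Qed.

Lemma dmeanD n F G p u :
  dmean n (fun z => F z + G z) p u = dmean n F p u + dmean n G p u.
Proof.
by elim: n p u => [|n IH] p u /=; rewrite ?IH; module.
Qed.

Lemma dmeanZ n (a : C) F p u : dmean n (fun z => a *: F z) p u = a *: dmean n F p u.
Proof.
by elim: n p u => [|n IH] p u /=; rewrite ?IH; module.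
Qed.

Lemma dmean_shift n F p u v : dmean n F (p + v) u = dmean n (fun z => F (z + v)) p u.
Proof. by elim: n p u => [|n IH] p u /=; rewrite -?IH addrAC. Qed.

(** The two halves are subdivided alike, so they cancel exactly at every level and not only in the
    limit. *)
Lemma dmean_alternating n F p u :
  (forall z, F (z + u) = - F z) -> dmean n.+1 F p (u + u) = 0.
Proof.
move=> Fu; rewrite dmeanS dmean_shift.
rewrite (_ : dmean n (fun z => F (z + u)) p u = - dmean n F p u).
  by rewrite subrr scaler0.
rewrite -scaleN1r -dmeanZ; apply: eq_dmean => t _; by rewrite Fu scaleN1r.
Qed.
End Vector.

Section Scalar.
Implicit Types (F : C -> C^o) (n : nat) (p u : C) (t : R).

Lemma dmean_conj n F p u : dmean n (fun z => (F z)^* : C^o) p u = (dmean n F p u)^*.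
Proof.
have half (a : C) : 2^-1 * a^* = (2^-1 * a)^*.
  by rewrite [RHS]rmorphM; congr (_ * _); rewrite fmorphV rmorph_nat.
elim: n p u => [|n IH] p u /=; rewrite ?IH /GRing.scale /= -half -rmorphD //.
Qed.

(** The weights of the mean are positive; this stands in for estimating an integral by a dominating
    integrand. *)
Lemma rn_dmean_le_Re {W : normedModType C} n (G : C -> W) F p u :
  (forall t, 0 <= t <= 1 ->
     rn (G (p + t%:C * u)) <= complex.Re (F (p + t%:C * u))) ->
  rn (dmean n G p u) <= complex.Re (dmean n F p u : C).
Proof.
have mid (x y : W) (a b : C) : rn x <= complex.Re a -> rn y <= complex.Re b ->
    rn (2^-1 *: (x + y)) <= complex.Re (2^-1 * (a + b)).
  move=> h1 h2; rewrite rnZ rnV rn_nat.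
  rewrite (_ : 2^-1 = (2^-1)%:C :> C); last by rewrite fmorphV rmorph_nat.
  case: a b h1 h2 => [a a'] [b b'] /= h1 h2; rewrite mul0r subr0 ler_pM2l //.
  by have := ler_rnD x y; lra.
elim: n p u => [|n IH] p u H.
  have H0 := H 0; have H1 := H 1; rewrite !rmorph0 !rmorph1 mul0r mul1r addr0 in H0 H1.
  by apply: mid; [apply: H0|apply: H1]; lra.
have [w wE] : exists w, u = w + w by exists (u / 2); field.
rewrite wE in H *; rewrite !dmeanS; apply: mid; apply: IH => t t01.
  by have [s s01 ->] := segment_left p w t01; apply: H.
by have [s s01 ->] := segment_right p w t01; apply: H.
Qed.
End Scalar.
End DyadicMean.

(** * Goursat's theorem on parallelograms *)

Section Goursat.
Context {R : realType} {W : normedModType R[i]}.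
Local Notation C := R[i].
Implicit Types (F : C -> W) (n : nat) (p u v : C).

Local Notation "'h_ k" := ((2^-1 : R) ^+ k) (at level 10, k at level 9).

(* Trapezoidal approximation of the integral of [F] along the boundary of the
   parallelogram with corners p, p + u, p + u + v, p + v. *)
Definition boundary_sum n F p u v : W :=
  u *: dmean n F p u + v *: dmean n F (p + u) v
  - u *: dmean n F (p + v) u - v *: dmean n F p v.

(** Interior edges are traversed twice in opposite directions. The identity is exact because halving
    a side lowers its level of subdivision from [n.+1] to [n]. *)
Lemma boundary_sum_split n F p u v :
  boundary_sum n.+1 F p (u + u) (v + v) =
  boundary_sum n F p u v + boundary_sum n F (p + u) u v +
  boundary_sum n F (p + v) u v + boundary_sum n F (p + u + v) u v.
Proof.
have dS q w : (w + w) *: dmean n.+1 F q (w + w) =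
    w *: dmean n F q w + w *: dmean n F (q + w) w.
  by rewrite dmeanS scalerA half_double scalerDr.
rewrite /boundary_sum !dS !addrA [p + v + u]addrAC [p + v + v + u]addrAC.
rewrite [p + u + u + v]addrAC [p + v + u]addrAC; module.
Qed.

(** Affine functions have boundary sum zero, since each side contributes its midpoint value. What is
    left is at most the perimeter times the error. *)
Lemma boundary_sum_affine n F (c0 c1 : W) p u v (e : R) :
  (forall a b : R, 0 <= a <= 1 -> 0 <= b <= 1 ->
     rn (F (p + a%:C * u + b%:C * v) -
         (c0 + (p + a%:C * u + b%:C * v) *: c1)) <= e) ->
  rn (boundary_sum n F p u v) <= 2 * (rn u + rn v) * e.
Proof.
move=> H.
have e1 : rn (dmean n F p u - (c0 + (p + u / 2) *: c1)) <= e.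
  apply: dmean_affine => t t01; have := H t 0 t01.
  by rewrite rmorph0 mul0r addr0; apply; lra.
have e2 : rn (dmean n F (p + u) v - (c0 + (p + u + v / 2) *: c1)) <= e.
  apply: dmean_affine => t t01; have := H 1 t _ t01.
  by rewrite rmorph1 mul1r; apply; lra.
have e3 : rn (dmean n F (p + v) u - (c0 + (p + v + u / 2) *: c1)) <= e.
  apply: dmean_affine => t t01; have := H t 1 t01.
  by rewrite rmorph1 mul1r addrAC; apply; lra.
have e4 : rn (dmean n F p v - (c0 + (p + v / 2) *: c1)) <= e.
  apply: dmean_affine => t t01; have := H 0 t _ t01.
  by rewrite rmorph0 mul0r addr0; apply; lra.
rewrite /boundary_sum.
rewrite (_ : _ - _ - _ =
  u *: (dmean n F p u - (c0 + (p + u / 2) *: c1)) +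
  v *: (dmean n F (p + u) v - (c0 + (p + u + v / 2) *: c1)) +
  u *: - (dmean n F (p + v) u - (c0 + (p + v + u / 2) *: c1)) +
  v *: - (dmean n F p v - (c0 + (p + v / 2) *: c1))); last first.
  by module.
have b (w : C) (x : W) : rn x <= e -> rn (w *: x) <= rn w * e.
  by move=> hx; rewrite rnZ ler_wpM2l ?rn_ge0.
rewrite -[dmean n F (p + v) u - _]opprK in e3; rewrite rnN in e3.
rewrite -[dmean n F p v - _]opprK in e4; rewrite rnN in e4.
rewrite (_ : 2 * _ * e = rn u * e + rn v * e + rn u * e + rn v * e); last by ring.
do 3 apply: le_trans (ler_rnD _ _) (lerD _ (b _ _ _)) => //.
exact: b.
Qed.

Lemma goursat F p u v :
  (forall s t : R, 0 <= s <= 1 -> 0 <= t <= 1 ->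
     exists d, has_cderiv F (p + s%:C * u + t%:C * v) d) ->
  forall e : R, 0 < e -> exists N, forall n, (N <= n)%N ->
    rn (boundary_sum n F p u v) <= e.
Proof.
move=> dF e e0.
have h_gt0 k : 0 < 'h_k :> R by rewrite exprn_gt0 // invr_gt0.
pose cell s t k n := boundary_sum n F (p + s%:C * u + t%:C * v)
  (('h_k)%:C * u) (('h_k)%:C * v).
(* The tolerance is proportional to the area of the cell, so four quarters add up to exactly the
   tolerance of the whole. The level [N] may depend on the cell; each split costs one level. *)
pose P s t k := exists N, forall n, (N <= n)%N -> rn (cell s t k n) <= e * ('h_k * 'h_k).
suff : P 0 0 0.
  by rewrite /P /cell !rmorph0 !mul0r !addr0 expr0 rmorph1 !mul1r mulr1.
apply: dyadic_square_induction => [s t k|x y x01 y01].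
  move=> [N1 H1] [N2 H2] [N3 H3] [N4 H4].
  exists (maxn (maxn N1 N2) (maxn N3 N4)).+1 => -[//|n]; rewrite ltnS !geq_max.
  move=> /andP[/andP[/H1 {}H1 /H2 {}H2] /andP[/H3 {}H3 /H4 {}H4]].
  have hE : 'h_k = 'h_k.+1 + 'h_k.+1 by rewrite exprS; lra.
  rewrite /cell hE rmorphD /= !mulrDl boundary_sum_split.
  have pE (a b : C) : p + (s%:C + a) * u + (t%:C + b) * v =
    p + s%:C * u + t%:C * v + a * u + b * v by ring.
  move: H1 H2 H3 H4; rewrite /cell !rmorphD /= => H1.
  rewrite -[t%:C]addr0 pE mul0r !addr0 => H2.
  rewrite -[s%:C]addr0 pE mul0r !addr0 => H3.
  rewrite pE => H4.
  rewrite (_ : e * _ = e * ('h_k.+1 * 'h_k.+1) + e * ('h_k.+1 * 'h_k.+1) +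
    e * ('h_k.+1 * 'h_k.+1) + e * ('h_k.+1 * 'h_k.+1)); last by ring.
  by do 3 apply: le_trans (ler_rnD _ _) (lerD _ _) => //.
have [d dP] := dF x y x01 y01.
set z0 := p + x%:C * u + y%:C * v in dP.
pose D := rn u + rn v + 1.
have D0 : 0 < D by rewrite ltr_pwDr // addr_ge0 ?rn_ge0.
(* A cell of side ['h_k] has perimeter at most [2 * D * 'h_k], and its points are within ['h_k * D]
   of [z0]. With this constant the product of perimeter and affine error is at most
   [e * 'h_k ^ 2]. *)
have eta0 : 0 < e / (2 * D ^+ 2) by rewrite divr_gt0 // mulr_gt0 // exprn_gt0.
have [r r0 Hr] := dP _ eta0.
have [K HK] : exists K, 'h_K * D < r.
  have [K /(_ K (leqnn K)) HK] := halving_small (divr_gt0 r0 D0).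
  by exists K; rewrite -ltr_pdivlMr.
exists K => s t k Kk hs ht; exists 0 => n _.
have hk : 'h_k <= 'h_K by rewrite ler_wiXn2l // ?invr_ge0 // invf_le1 // ler1n.
apply: le_trans (@boundary_sum_affine n F (F z0 - z0 *: d) d _ _ _
   (e / (2 * D ^+ 2) * ('h_k * D)) _) _.
  move=> a b a01 b01; set z := _ + _ + _ + _.
  have zE : z = z0 + ((s + a * 'h_k - x)%:C * u + (t + b * 'h_k - y)%:C * v).
    by rewrite /z /z0 !rmorphB !rmorphD !rmorphM /=; ring.
  have small (q w c : R) : q <= w <= q + 'h_k -> 0 <= c <= 1 -> `|q + c * 'h_k - w| <= 'h_k.
    by move=> ? ?; have := h_gt0 k; rewrite ler_norml; nra.
  set w := (_ - _)%:C * u + _ in zE.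
  have wD : rn w <= 'h_k * D.
    apply: le_trans (ler_rnD _ _) _; rewrite !rnM !rn_real.
    have := small s x a hs a01; have := small t y b ht b01.
    by have := rn_ge0 u; have := rn_ge0 v; have := h_gt0 k; rewrite /D; nra.
  rewrite (_ : F z - _ = F (z0 + w) - F z0 - w *: d); last by rewrite -zE zE; module.
  apply: le_trans (Hr _ _) _.
    by apply: le_lt_trans wD _; apply: le_lt_trans HK; rewrite ler_pM2r.
  by rewrite expr1 ler_pM2l.
rewrite !rnM !rn_real ger0_norm ?(ltW (h_gt0 k)) // -mulrDr.
rewrite [leLHS](_ : _ = e * ('h_k * 'h_k) * ((rn u + rn v) / D)); last by field; rewrite gt_eqF.
rewrite -[leRHS]mulr1 ler_pM2l ?mulr_gt0 // ler_pdivrMr // mul1r /D; lra.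
Qed.
End Goursat.

(** * Mean values over circles *)

Section CircleMean.
Context {R : realType}.
Local Notation C := R[i].

(** The circle is the image under [cexp] of a vertical segment of length 2 pi, so a rectangle
    between two such segments corresponds to an annulus. *)
Definition cmean {W : normedModType C} n (F : C -> W) (r : R) : W :=
  dmean n (fun z => F (cexp z)) (ln r)%:C ((pi *+ 2)%:C * 'i).

Let circle_mod (r t : R) : 0 < r -> rn (cexp ((ln r)%:C + t%:C * ((pi *+ 2)%:C * 'i))) = r.
Proof.
by move=> r0; rewrite rn_cexp /= !(mulr0, mul0r, subrr, addr0) lnK.
Qed.

Lemma cmean_bound {W : normedModType C} n (F : C -> W) (c : W) (r e : R) : 0 < r ->
  (forall z, rn z = r -> rn (F z - c) <= e) -> rn (cmean n F r - c) <= e.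
Proof. by move=> r0 H; apply: dmean_bound => t _; rewrite H // circle_mod. Qed.

Lemma eq_cmean {W : normedModType C} n (F G : C -> W) (r : R) : 0 < r ->
  (forall z, rn z = r -> F z = G z) -> cmean n F r = cmean n G r.
Proof. by move=> r0 H; apply: eq_dmean => t _; rewrite H // circle_mod. Qed.

Lemma cmeanD {W : normedModType C} n (F G : C -> W) (r : R) :
  cmean n (fun z => F z + G z) r = cmean n F r + cmean n G r.
Proof. exact: dmeanD. Qed.

Lemma cmeanZ {W : normedModType C} n (a : C) (F : C -> W) (r : R) :
  cmean n (fun z => a *: F z) r = a *: cmean n F r.
Proof. exact: dmeanZ. Qed.

Lemma rn_cmean_le_Re {W : normedModType C} n (G : C -> W) (F : C -> C^o) (r : R) : 0 < r ->
  (forall z, rn z = r -> rn (G z) <= complex.Re (F z)) ->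
  rn (cmean n G r) <= complex.Re (cmean n F r : C).
Proof. by move=> r0 H; apply: rn_dmean_le_Re => t _; rewrite H // circle_mod. Qed.

(** Used for multiples of [z^-1]: opposite points cancel, and one level of subdivision already pairs
    them. *)
Lemma cmean_odd {W : normedModType C} n (F : C -> W) (r : R) :
  (forall z, F (- z) = - F z) -> cmean n.+1 F r = 0.
Proof.
move=> FN; rewrite /cmean mulr2n rmorphD mulrDl.
by apply: dmean_alternating => z; rewrite cexpDpi FN.
Qed.

(** Used for [z^-2], which changes sign after a quarter turn; pairing points at that distance takes
    two levels. *)
Lemma cmean_quarter {W : normedModType C} n (F : C -> W) (r : R) :
  (forall z, F ('i * z) = - F z) -> cmean n.+2 F r = 0.
Proof.
move=> Fi; rewrite /cmean mulr2n rmorphD mulrDl dmeanS.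
have -> : pi%:C * 'i = (pi / 2)%:C * 'i + (pi / 2)%:C * 'i :> C.
  by rewrite -mulrDl -rmorphD -splitr.
have alt z : F (cexp (z + (pi / 2)%:C * 'i)) = - F (cexp z) by rewrite cexpDpihalf Fi.
by rewrite !dmean_alternating // addr0 scaler0.
Qed.

(* Goursat's theorem for [F \o cexp] on the rectangle [ln r1, ln r] x [0, 2 pi]:
   by periodicity the means over the circles of radii r1 and r agree in the
   limit, and the former is close to [F 0]. *)
Lemma circle_mean_value {W : normedModType C} (F : C -> W) (rho r : R) : 0 < r < rho ->
  (forall z, z != 0 -> rn z < rho -> exists d, has_cderiv F z d) ->
  small_o 0 (fun h => F h - F 0) ->
  forall e : R, 0 < e -> exists N, forall n, (N <= n)%N -> rn (cmean n F r - F 0) <= e.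
Proof.
move=> /andP[r0 rrho] dF cF e e0.
have [s s0 Hs] := cF (e / 2) (divr_gt0 e0 (ltr0Sn _ _)).
(* If [r] is already at most [s / 2], the rectangle degenerates to a segment, which does no harm. *)
pose r1 := Num.min r (s / 2).
have r10 : 0 < r1 by rewrite lt_min r0 divr_gt0.
have r1s : r1 < s by rewrite gt_min orbC ltr_pdivrMr // ltr_pMr // ltr1n.
have r1r : r1 <= r by rewrite ge_min lexx.
have lnr : ln r1 <= ln r by rewrite ler_ln ?posrE.
pose Phi z := F (cexp z); pose V : C := (pi *+ 2)%:C * 'i.
pose U : C := (ln r - ln r1)%:C.
have dPhi (a b : R) : 0 <= a <= 1 -> 0 <= b <= 1 ->
    exists d, has_cderiv Phi ((ln r1)%:C + a%:C * U + b%:C * V) d.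
  move=> a01 _; set z := _ + _ + _.
  have [d Hd] : exists d, has_cderiv F (cexp z) d.
    apply: dF; first exact: cexp_neq0.
    apply: le_lt_trans rrho; rewrite rn_cexp -[leRHS]lnK ?posrE // ler_expR.
    by rewrite /z /= !(mulr0, mul0r, subr0, addr0); nra.
  by exists (cexp z *: d); apply: has_cderiv_comp Hd; apply: has_cderiv_cexp.
have V0 : 0 < rn V by rewrite rnM rn_i mulr1 rn_real normr_gt0 gt_eqF // pmulrn_lgt0 // pi_gt0.
(* After the two radial sides cancel, the boundary sum is [V] times a difference of circle means;
   the factor [rn V] in the tolerance compensates for this. *)
have [N HN] := goursat dPhi (mulr_gt0 V0 (divr_gt0 e0 (ltr0Sn _ 1))).
exists N => n /HN; rewrite /boundary_sum.
rewrite (_ : (ln r1)%:C + U = (ln r)%:C); last by rewrite -rmorphD /= addrC subrK.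
rewrite [dmean n Phi (_ + V) U]dmean_shift.
rewrite (@eq_dmean _ _ _ (fun z => Phi (z + V)) Phi); last first.
  by move=> t _; rewrite /Phi cexpD2pi.
rewrite [_ + _ - U *: _]addrAC subrr add0r -scalerBr rnZ ler_pM2l // => HJ.
have H1 : rn (cmean n F r1 - F 0) <= e / 2.
  apply: cmean_bound => // z zr; have := Hs z; rewrite zr expr0 mulr1; exact.
rewrite [e]splitr; apply: le_trans (lerD HJ H1); apply: le_trans (ler_rnD _ _).
by rewrite addrA subrK.
Qed.
End CircleMean.

(** * Cauchy estimates *)

Section CauchyEstimate.
Context {R : realType}.
Local Notation C := R[i].

Local Notation "'h_ k" := ((2^-1 : R) ^+ k) (at level 10, k at level 9).

Lemma ler_halving (a b c : R) : (forall n, a <= b + c * 'h_n) -> a <= b.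
Proof.
move=> H; rewrite leNgt; apply/negP => ba.
have h_gt0 k : 0 < 'h_k :> R by rewrite exprn_gt0 // invr_gt0.
have c0 : 0 < c.
  by have := H 0; rewrite expr0 => H0; rewrite ltNge; apply/negP => ?; lra.
have ab0 : 0 < (a - b) / c by rewrite divr_gt0 // subr_gt0.
have [K /(_ K (leqnn K))] := halving_small ab0.
by rewrite ltr_pdivlMr //; have := H K; lra.
Qed.

(** Completeness of the space is used here. Letting [m] tend to infinity in the Cauchy bound leaves
    the explicit rate [c * 'h_n], which later makes limits of derivatives uniform. *)
Lemma complete_halving {W : completeNormedModType C} (u : nat -> W) (c : R) :
  (forall n m, rn (u n - u m) <= c * ('h_n + 'h_m)) ->
  exists l, forall n, rn (u n - l) <= c * 'h_n.
Proof.
move=> H.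
have h_gt0 k : 0 < 'h_k :> R by rewrite exprn_gt0 // invr_gt0.
have c0 : 0 <= c by have := H 0 0; have := rn_ge0 (u 0 - u 0); rewrite expr0; lra.
have uc : cvg (u @ \oo).
  apply/cauchy_cvgP/cauchy_ballP => e e0.
  have {e0} [e' ee e0] : exists2 e', e = e'%:C & 0 < e'.
    exists (complex.Re e); first by rewrite RRe_real // gtr0_real.
    by rewrite -ltcR RRe_real // gtr0_real.
  have e20 : 0 < e' / 2 / (c + 1) by rewrite !divr_gt0 // ltr_pwDr.
  have [K HK] := halving_small e20.
  have hK n : (K <= n)%N -> c * 'h_n < e' / 2.
    move=> /HK; rewrite ltr_pdivlMr ?ltr_pwDr // => H'; have := h_gt0 n; nra.
  exists (u @` [set n | (K <= n)%N], u @` [set n | (K <= n)%N]).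
    by split; exists K => // n Kn; exists n.
  move=> [_ _] [/= [n Kn <-] [m Km <-]]; rewrite -ball_normE /ball_ /= ee rnE ltcR.
  by apply: le_lt_trans (H n m) _; have := hK n Kn; have := hK m Km; lra.
exists (lim (u @ \oo)) => n; apply/ler_addgt0Pr => e e0.
have e2C : (0 : C) < (e / 2)%:C by rewrite ltcR divr_gt0.
have /cvgrPdist_lt /(_ _ e2C) [K _ HK] := uc.
have e20 : 0 < e / 2 / (c + 1) by rewrite !divr_gt0 // ltr_pwDr.
have [K' HK'] := halving_small e20.
pose m := maxn K K'.
have := HK m (leq_maxl _ _); rewrite /= rnE ltcR rn_distC => h1.
have := HK' m (leq_maxr _ _); rewrite ltr_pdivlMr ?ltr_pwDr // => h2.
rewrite (_ : u n - _ = (u n - u m) + (u m - lim (u @ \oo))); last by rewrite addrA subrK.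
apply: le_trans (ler_rnD _ _) _; have := H n m; have := h_gt0 m; nra.
Qed.

(** The quotient [(phi z - phi 0) / z], completed by [d] at 0, has circle means tending to [d]. The
    part [phi 0 / z] is odd and has mean zero, so [d] is approximated by means of [phi z / z], which
    are at most [M / r]; no factor 2 is lost to [phi 0]. *)
Lemma cauchy_estimate {W : normedModType C} (phi : C -> W) (rho M : R) (d : W) :
  0 < rho ->
  (forall z, rn z < rho -> exists d, has_cderiv phi z d) ->
  (forall z, rn z < rho -> rn (phi z) <= M) ->
  has_cderiv phi 0 d -> rn d <= M / rho.
Proof.
move=> rho0 dphi phiM d0.
pose F z := if z == 0 then d else z^-1 *: (phi z - phi 0).
have dF z : z != 0 -> rn z < rho -> exists e, has_cderiv F z e.
  move=> z0 /dphi[e He].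
  have H1 := has_cderivV (has_cderiv_id z) z0.
  have H2 := has_cderivZ H1 (has_cderivB He (has_cderiv_cst (phi 0) z)).
  eexists; apply: (has_cderiv_near (r := rn z)) H2; first by rewrite rn_gt0.
  move=> h hz; rewrite /F; case: eqP => // zh.
  by move/eqP: zh hz; rewrite addr_eq0 => /eqP ->; rewrite rnN ltxx.
have cF : small_o 0 (fun h => F h - F 0).
  move=> e e0; have [r r0 H] := d0 e e0; exists r => // h hr.
  rewrite /F eqxx expr0 mulr1; case: eqP => [_|/eqP h0].
    by rewrite subrr rn0 ltW.
  have := H h hr; rewrite add0r expr1 => Hh.
  rewrite (_ : _ - d = h^-1 *: (phi h - phi 0 - h *: d)).
    by rewrite rnZ rnV mulrC ler_pdivrMr // rn_gt0.
  by rewrite [RHS]scalerBr scalerA mulVf // scale1r.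
have key r : 0 < r < rho -> rn d <= M / r.
  move=> r_int; have /andP[r0 rrho] := r_int; apply/ler_addgt0Pr => e e0.
  have [N HN] := circle_mean_value r_int dF cF e0.
  have := HN N.+1 (leqnSn N).
  rewrite (@eq_cmean _ _ _ _ (fun z => z^-1 *: phi z + - z^-1 *: phi 0)) //; last first.
    move=> z zr; rewrite /F ifN; first by rewrite scalerBr scaleNr.
    by rewrite -rn_gt0 zr.
  rewrite cmeanD [X in _ + X - _]cmean_odd; last first.
    by move=> z; rewrite invrN scaleNr.
  rewrite addr0 /F eqxx => h1.
  have h2 : rn (cmean N.+1 (fun z => z^-1 *: phi z) r) <= M / r.
    rewrite -[X in rn X]subr0; apply: cmean_bound => // z zr.
    by rewrite subr0 rnZ rnV zr mulrC ler_pM2r ?invr_gt0 // phiM // zr.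
  by have := ler_rn_dist d (cmean N.+1 (fun z => z^-1 *: phi z) r); rewrite rn_distC; lra.
rewrite ler_pdivlMr //; apply/ler_addgt0Pr => e e0.
have d1 : 0 < rn d + 1 by rewrite ltr_pwDr ?rn_ge0.
(* Chosen so that replacing [rho] by [r] costs at most [e], that is [rn d * (rho - r) <= e]. *)
pose r := rho - Num.min (rho / 2) (e / (rn d + 1)).
have hmin : 0 < Num.min (rho / 2) (e / (rn d + 1)) by rewrite lt_min !divr_gt0.
have hle : Num.min (rho / 2) (e / (rn d + 1)) <= rho / 2 by rewrite ge_min lexx.
have hle' : Num.min (rho / 2) (e / (rn d + 1)) * (rn d + 1) <= e.
  by rewrite -ler_pdivlMr // ge_min lexx orbT.
have r_int : 0 < r < rho by rewrite /r; lra.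
have := key r r_int; rewrite ler_pdivlMr; last by case/andP: r_int.
by rewrite /r; have := rn_ge0 d; nra.
Qed.

(** The square induction, applied to a property of the first coordinate alone, bisects the segment.
    Allowing slope [K + e] makes the claim true on all short cells. *)
Lemma segment_mean_value {W : normedModType C} (phi : C -> W) (K : R) :
  (forall t : R, 0 <= t <= 1 -> exists2 d, has_cderiv phi t%:C d & rn d <= K) ->
  rn (phi 1 - phi 0) <= K.
Proof.
move=> dphi; apply/ler_addgt0Pr => e e0.
have h_gt0 k : 0 < 'h_k :> R by rewrite exprn_gt0 // invr_gt0.
pose P (s t : R) k := rn (phi (s + 'h_k)%:C - phi s%:C) <= (K + e) * 'h_k.
suff : P 0 0 0 by rewrite /P expr0 add0r mulr1 rmorph1 rmorph0.
apply: (dyadic_square_induction (P := P)) => [s t k H1 H2 _ _|x y x01 _].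
  rewrite /P; have -> : 'h_k = 'h_k.+1 + 'h_k.+1 by rewrite exprS; lra.
  rewrite mulrDr addrA; apply: le_trans (lerD H2 H1); apply: le_trans (ler_rnD _ _).
  by rewrite addrA subrK.
have [d dP dK] := dphi x x01; have [r r0 Hr] := dP e e0.
have [N HN] := halving_small r0.
exists N => s t k /HN hr.
move=> /andP[sx xs] _; rewrite /P.
have H (w : R) : `|w - x| <= 'h_k -> rn (phi w%:C - phi x%:C - (w - x)%:C *: d) <= e * `|w - x|.
  move=> wx; have := Hr (w - x)%:C.
  rewrite rn_real expr1 -rmorphD (_ : x + (w - x) = w); last by ring.
  by apply; exact: le_lt_trans hr.
(* Since [x] lies in the cell, the errors at the two end points add up to at most [e * 'h_k]. *)
have Ha : rn (phi s%:C - phi x%:C - (s - x)%:C *: d) <= e * (x - s).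
  by have := H s; rewrite [`|_|]distrC ger0_norm ?subr_ge0 //; apply; lra.
have Hb : rn (phi (s + 'h_k)%:C - phi x%:C - (s + 'h_k - x)%:C *: d) <= e * (s + 'h_k - x).
  by have := H (s + 'h_k); rewrite ger0_norm ?subr_ge0 //; apply; lra.
rewrite (_ : phi _ - _ = (phi (s + 'h_k)%:C - phi x%:C - (s + 'h_k - x)%:C *: d)
  - (phi s%:C - phi x%:C - (s - x)%:C *: d) + ('h_k)%:C *: d); last first.
  by rewrite !rmorphB !rmorphD /=; module.
apply: le_trans (ler_rnD _ _) _; rewrite rnZ rn_real ger0_norm ?(ltW (h_gt0 _)) //.
have := ler_rnB (phi (s + 'h_k)%:C - phi x%:C - (s + 'h_k - x)%:C *: d)
  (phi s%:C - phi x%:C - (s - x)%:C *: d).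
by have := h_gt0 k; nra.
Qed.
End CauchyEstimate.

(** * Frechet derivatives *)

Section Frechet.
Context {R : realType}.
Local Notation C := R[i].
Local Notation "'h_ k" := ((2^-1 : R) ^+ k) (at level 10, k at level 9).

(** The derivative is a bare function, so differences and limits of derivatives need no packed
    linear structure; [differentiable_fder] and [fder_diff] translate to and from ['d f x]. *)
Definition fder {V W : normedModType C} (f : V -> W) (x : V) (L : V -> W) : Prop :=
  [/\ forall (a : C) u v, L (a *: u + v) = a *: L u + L v,
      exists M : R, forall u, rn (L u) <= M * rn u &
      small_o 1 (fun h => f (x + h) - f x - L h)].

Section Basic.
Context {V W : normedModType C}.
Implicit Types (f g : V -> W) (x h : V) (L : V -> W).

Lemma fderP f x L a u v : fder f x L -> L (a *: u + v) = a *: L u + L v.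
Proof. by case. Qed.

Lemma fder_at0 f x L : fder f x L -> L 0 = 0.
Proof. by case=> /(_ (-1) 0 0); rewrite scaler0 addr0 scaleN1r addNr. Qed.

Lemma fder_scale f x L a u : fder f x L -> L (a *: u) = a *: L u.
Proof. by move=> H; rewrite -[a *: u]addr0 (fderP _ _ _ H) (fder_at0 H) addr0. Qed.

Lemma fder_add f x L u v : fder f x L -> L (u + v) = L u + L v.
Proof. by move=> H; rewrite -[u]scale1r (fderP _ _ _ H) !scale1r. Qed.

Lemma fder_near f g x L (r : R) : 0 < r -> (forall y, rn (y - x) < r -> f y = g y) ->
  fder f x L -> fder g x L.
Proof.
move=> r0 fg [Ll Lb Lo]; split=> //; apply: (small_o_near r0) Lo => h hr.
by rewrite !fg ?subrr ?rn0 // [x + h]addrC addrK.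
Qed.

Lemma fder_bounded_linear L x : (forall (a : C) u v, L (a *: u + v) = a *: L u + L v) ->
  (exists M : R, forall u, rn (L u) <= M * rn u) -> fder L x L.
Proof.
move=> Ll Lb; split=> //; apply: small_o_ext (small_o0 1) => h.
by rewrite -[x in x + h]scale1r Ll scale1r [L x + _]addrC addrK subrr.
Qed.

Lemma fderB f g x L L' : fder f x L -> fder g x L' ->
  fder (fun y => f y - g y) x (fun h => L h - L' h).
Proof.
move=> [Ll [M LM] Lo] [Ll' [M' LM'] Lo']; split.
- by move=> a u v; rewrite Ll Ll'; module.
- exists (M + M') => u; apply: le_trans (ler_rnB _ _) _; rewrite mulrDl.
  exact: lerD.
by apply: small_o_ext (small_oB Lo Lo') => h; module.
Qed.

Lemma fderZ f x L (a : C) : fder f x L ->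
  fder (fun y => a *: f y) x (fun h => a *: L h).
Proof.
move=> [Ll [M LM] Lo]; split.
- by move=> b u v; rewrite Ll; module.
- exists (rn a * M) => u; rewrite rnZ -mulrA ler_wpM2l ?rn_ge0 //.
have := big_o_small_oZ (big_o_cst a) Lo.
by apply: small_o_ext => h; module.
Qed.

Lemma fder_shift f x h L : fder f (x + h) L -> fder (fun y => f (y + h)) x L.
Proof.
by move=> [Ll Lb Lo]; split=> //; apply: small_o_ext Lo => k; rewrite [x + h + k]addrAC.
Qed.

Lemma fder_line f x h L (z : C) : fder f (x + z *: h) L ->
  has_cderiv (fun w => f (x + w *: h)) z (L h).
Proof.
move=> fL; have [Ll _ Lo] := fL.
have ah : big_o 1 (fun w : C => w *: h) := big_oZ (big_o_id : big_o 1 (id : C -> C)) (big_o_cst h).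
apply: small_o_ext (small_o_comp ah Lo) => w.
by rewrite (fder_scale _ _ fL) scalerDl addrA.
Qed.

Lemma fder_unique f x L L' : fder f x L -> fder f x L' -> L =1 L'.
Proof.
move=> H H' h; have line M : fder f x M -> has_cderiv (fun w => f (x + w *: h)) 0 (M h).
  by move=> HM; apply: fder_line; rewrite scale0r addr0.
exact: has_cderiv_unique (line _ H) (line _ H').
Qed.

Lemma fder_cont f x L : fder f x L -> small_o 0 (fun h => f (x + h) - f x).
Proof.
move=> [_ [M LM] Lo]; apply: big_o_small_o.
have bL : big_o 1 L.
  exists (`|M| + 1); first by rewrite ltr_pwDr.
  exists 1 => // h _; apply: le_trans (LM h) _; rewrite ler_wpM2r ?rn_ge0 //.
  by rewrite (le_trans (ler_norm _)) // lerDl.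
by apply: big_o_ext (big_oD (small_o_big_o Lo) bL) => h; rewrite subrK.
Qed.

Lemma fder_loc_bounded f x L : fder f x L ->
  exists2 r : R, 0 < r & exists M : R, forall y, rn (y - x) < r -> rn (f y) <= M.
Proof.
move=> /fder_cont /(_ 1 ltr01)[r r0 H]; exists r => //; exists (1 + rn (f x)) => y yx.
have := H _ yx; rewrite expr0 mulr1 [x + _]addrC subrK => h1.
by have := ler_rn_dist (f y) (f x); lra.
Qed.

Lemma fder_mean_value f x h (K : R) :
  (forall t : R, 0 <= t <= 1 -> exists2 L, fder f (x + t%:C *: h) L & rn (L h) <= K) ->
  rn (f (x + h) - f x) <= K.
Proof.
move=> H; pose phi (z : C) := f (x + z *: h).
rewrite (_ : f (x + h) - f x = phi 1 - phi 0); last first.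
  by rewrite /phi scale1r scale0r addr0.
apply: segment_mean_value => t /H[L HL LK]; exists (L h) => //.
exact: fder_line.
Qed.

(** The one-variable estimate on the complex line [x + z *: h], which stays in the ball for
    [|z| < rho / |h|]. *)
Lemma fder_cauchy f x L (rho M : R) : 0 < rho ->
  (forall y, rn (y - x) < rho -> exists L, fder f y L) ->
  (forall y, rn (y - x) < rho -> rn (f y) <= M) ->
  fder f x L -> forall h, rn (L h) <= M / rho * rn h.
Proof.
move=> rho0 df fM fL h; have [->|h0] := eqVneq h 0.
  by rewrite (fder_at0 fL) !rn0 mulr0.
have hp : 0 < rn h by rewrite rn_gt0.
have near (z : C) : rn z < rho / rn h -> rn (x + z *: h - x) < rho.
  by rewrite ltr_pdivlMr // => zr; rewrite [x + _]addrC addrK rnZ.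
have := @cauchy_estimate _ _ (fun z => f (x + z *: h)) (rho / rn h) M (L h).
rewrite invf_div mulrA mulrAC; apply.
- exact: divr_gt0.
- by move=> z /near/df[L' HL']; exists (L' h); apply: fder_line.
- by move=> z /near/fM.
by apply: fder_line; rewrite scale0r addr0.
Qed.

(* Cauchy estimates bound first f', then the increments f(. + h) - f, then
   the increments of f'; integrate the latter along [x, x + h]. *)
Lemma fder_quadratic f x L (rho M : R) : 0 < rho ->
  (forall y, rn (y - x) < rho -> exists L, fder f y L) ->
  (forall y, rn (y - x) < rho -> rn (f y) <= M) ->
  fder f x L ->
  forall h, rn h < rho / 4 -> rn (f (x + h) - f x - L h) <= 8 * M / rho ^+ 2 * rn h ^+ 2.
Proof.
move=> rho0 df fM fL h hr.
have M0 : 0 <= M by apply: le_trans (fM x _); rewrite ?subrr ?rn0 // rn_ge0.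
have step1 y Ly k : rn (y - x) < rho / 2 -> fder f y Ly -> rn (Ly k) <= 2 * M / rho * rn k.
  move=> yx Hy; rewrite (_ : 2 * M / rho = M / (rho / 2)); last by field; rewrite gt_eqF.
  have near z : rn (z - y) < rho / 2 -> rn (z - x) < rho.
    by move=> zy; have := ler_rnD (z - y) (y - x); rewrite addrA subrK; lra.
  apply: (@fder_cauchy f y Ly) Hy k; first by lra.
    by move=> z /near/df.
  by move=> z /near/fM.
have onseg y k t : rn (y - x) < rho / 4 -> rn k < rho / 4 -> 0 <= t <= 1 ->
    rn (y + t%:C *: k - x) < rho / 2.
  move=> yx kr t01; rewrite addrAC; apply: le_lt_trans (ler_rnD _ _) _.
  by rewrite rnZ rn_real ger0_norm; have := rn_ge0 k; [nra | lra].
have step2 y k : rn (y - x) < rho / 4 -> rn k < rho / 4 ->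
    rn (f (y + k) - f y) <= 2 * M / rho * rn k.
  move=> yx kr; apply: fder_mean_value => t t01.
  have near := onseg y k t yx kr t01.
  have [Ly HLy] : exists Ly, fder f (y + t%:C *: k) Ly by apply: df; lra.
  by exists Ly => //; apply: step1 near HLy.
(* The increment [f (y + k) - f y] is at most [2 * M / rho * rn k] for [y] within [rho / 4] of [x];
   dividing by that radius produces the constant 8. *)
have step3 k L' u : rn k < rho / 4 -> fder f (x + k) L' ->
    rn (L' u - L u) <= 8 * M / rho ^+ 2 * rn k * rn u.
  move=> kr HL'; rewrite (_ : 8 * M / _ * _ = (2 * M / rho * rn k) / (rho / 4)); last first.
    by field; rewrite gt_eqF.
  apply: (@fder_cauchy (fun y => f (y + k) - f y) x (fun v => L' v - L v)).
  - by lra.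
  - move=> y yx; have [|Ly HLy] := df y; first by lra.
    have [|Lk HLk] := df (y + k).
      by have := onseg y k 1 yx kr; rewrite rmorph1 scale1r => /(_ _); lra.
    by eexists; apply: fderB (fder_shift HLk) HLy.
  - by move=> y yx; apply: step2.
  by apply: fderB (fder_shift HL') fL.
have [Ll Lb _] := fL.
have := @fder_mean_value (fun y => f y - L y) x h (8 * M / rho ^+ 2 * rn h ^+ 2).
rewrite (_ : f (x + h) - L (x + h) - (f x - L x) = f (x + h) - f x - L h); last first.
  by rewrite (fder_add _ _ fL); module.
apply => t t01.
have [|Lt HLt] := df (x + t%:C *: h).
  by have := onseg x h t; rewrite subrr rn0 => /(_ _ hr t01); lra.
exists (fun k => Lt k - L k); first exact: fderB HLt (fder_bounded_linear _ Ll Lb).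
have th : rn (t%:C *: h) <= rn h.
  by rewrite rnZ rn_real ger0_norm; have := rn_ge0 h; [nra | lra].
have QM : 0 <= 8 * M / rho ^+ 2 by rewrite !mulr_ge0 // invr_ge0 exprn_ge0 // ltW.
have thr : rn (t%:C *: h) < rho / 4 by lra.
apply: le_trans (step3 _ _ h thr HLt) _; rewrite expr2 mulrA.
by rewrite ler_wpM2r ?rn_ge0 // ler_wpM2l.
Qed.
End Basic.

Lemma nbhs0_rnP {V : normedModType C} (P : set V) :
  (\forall h \near (0 : V), P h) <-> exists2 r : R, 0 < r & forall h, rn h < r -> P h.
Proof.
split=> [/nbhs_norm0P[r /= r0 H]|[r r0 H]].
  have rR : r = (complex.Re r)%:C by rewrite RRe_real // gtr0_real.
  exists (complex.Re r); first by rewrite -ltcR -rR.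
  by move=> h hr; apply: H; rewrite /= rnE rR ltcR.
apply/nbhs_norm0P; exists r%:C; first by rewrite /= ltcR.
by move=> h /=; rewrite rnE ltcR => /H.
Qed.

Lemma small_o1P {V W : normedModType C} (E : V -> W) :
  small_o 1 E <-> forall e : C, 0 < e -> \forall h \near (0 : V), `|E h| <= e * `|h|.
Proof.
split=> [oE e e0|oE e e0].
  have eR : e = (complex.Re e)%:C by rewrite RRe_real // gtr0_real.
  have [|r r0 H] := oE (complex.Re e); first by rewrite -ltcR -eR.
  apply/nbhs0_rnP; exists r => // h hr.
  by rewrite eR !rnE -rmorphM lecR -[rn h]expr1 H.
have /oE/nbhs0_rnP[r r0 H] : (0 : C) < e%:C by rewrite ltcR.
exists r => // h /H.
by rewrite !rnE -rmorphM lecR expr1.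
Qed.

Definition mk_linear {V W : lmodType C} (L : V -> W)
    (linL : forall (a : C) u v, L (a *: u + v) = a *: L u + L v) : {linear V -> W} :=
  HB.pack_for {linear V -> W} L (GRing.isLinear.Build C V W *:%R L linL).

Lemma bounded_continuous {V W : normedModType C} (L : {linear V -> W}) :
  (exists M : R, forall u, rn (L u) <= M * rn u) <-> continuous L.
Proof.
split=> [[M LM]|cL].
  apply/linear_bounded_continuous/linear_boundedP.
  exists M%:C; split=> [|y My u]; first by rewrite complex_real.
  apply: le_trans (_ : M%:C * `|u| <= _); first by rewrite !rnE -rmorphM lecR.
  by rewrite ler_wpM2r // ltW.
have /linear_boundedP/pinfty_ex_gt0[M M0 H] := continuous_linear_bounded 0 (cL 0).
exists (complex.Re M) => u.
by rewrite -lecR rmorphM /= (RRe_real (gtr0_real M0)) -!rnE H.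
Qed.

Lemma differentiable_fder {V W : normedModType C} (f : V -> W) x :
  differentiable f x -> fder f x ('d f x).
Proof.
move=> df; split; first exact: linearP.
  exact/bounded_continuous/diff_continuous.
apply/small_o1P => e e0; have /diff_locally/eqaddoP/(_ e e0) := df.
by apply: filterS => h; rewrite !fctE /= [h + x]addrC opprD addrA.
Qed.

Lemma fder_diff {V W : normedModType C} (f : V -> W) x L :
  fder f x L -> differentiable f x /\ 'd f x = L :> (V -> W).
Proof.
move=> [Ll Lb Lo]; pose L' := mk_linear Ll.
have cL : continuous L' by apply/bounded_continuous.
have fL : f \o shift x = cst (f x) + L' +o_ 0 id.
  apply/eqaddoP => e e0; move/small_o1P/(_ e e0): Lo.
  by apply: filterS => h; rewrite !fctE /= [h + x]addrC opprD addrA.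
have dE : 'd f x = L :> (V -> W) by apply: (@diff_unique _ _ _ f L').
split=> //; apply/diff_locallyP; rewrite dE; split; first exact: cL.
exact: fL.
Qed.

(** * Differentiability of the derivative *)

Section DirectionalDerivative.
Context {V : normedModType C} {W : completeNormedModType C}.

(** The difference quotients [q n] of [f] in direction [h] approach [Lf y h] at rate [2^-n],
    uniformly for [y] near [x], by [fder_quadratic]. The Cauchy estimate for [q n - q m] then makes
    their derivatives [A n] at [x] converge, to [B]. The [q n] have a common bound [K], so their
    quadratic remainders are uniform in [n] and survive the limit. *)
Lemma fder_directional (f : V -> W) (x : V) (Lf : V -> V -> W) (rho M : R) : 0 < rho ->
  (forall y, rn (y - x) < rho -> fder f y (Lf y)) ->
  (forall y, rn (y - x) < rho -> rn (f y) <= M) ->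
  forall h, exists A, fder (fun y => Lf y h) x A.
Proof.
move=> rho0 df fM h.
have M0 : 0 <= M by apply: le_trans (fM x _); rewrite ?subrr ?rn0 // rn_ge0.
have h1 : 0 < rn h + 1 by rewrite ltr_pwDr ?rn_ge0.
(* Makes every step [t n * rn h] shorter than [rho / 8], the range that [fder_quadratic] permits on
   a ball of radius [rho / 2]. *)
pose s := rho / 16 / (rn h + 1).
have s0 : 0 < s by rewrite !divr_gt0.
have hn0 k : 0 < 'h_k :> R by rewrite exprn_gt0 // invr_gt0.
have hn1 k : 'h_k <= 1 :> R by rewrite exprn_ile1 // ?invr_ge0 // invf_le1 // ler1n.
pose t n : R := s * 'h_n.
have t0 n : 0 < t n by rewrite mulr_gt0.
have th n : t n * rn h < rho / 8.
  have : s * (rn h + 1) = rho / 16 by rewrite /s mulrVK // unitfE gt_eqF.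
  by have := hn1 n; have := hn0 n; have := rn_ge0 h; rewrite /t; nra.
have near y z : rn (y - x) < rho / 2 -> rn (z - y) < rho / 2 -> rn (z - x) < rho.
  by move=> yx zy; have := ler_rnD (z - y) (y - x); rewrite addrA subrK; lra.
(* The constant [8 * M / rho ^ 2] of [fder_quadratic] with [rho / 2] in place of [rho]. *)
pose Q := 32 * M / rho ^+ 2.
have Q0 : 0 <= Q by rewrite /Q !mulr_ge0 // invr_ge0 exprn_ge0 // ltW.
pose q n y := (t n)^-1%:C *: (f (y + (t n)%:C *: h) - f y).
have rnt n : rn ((t n)%:C *: h) = t n * rn h by rewrite rnZ rn_real gtr0_norm.
have qL n y : rn (y - x) < rho / 2 -> rn (q n y - Lf y h) <= Q * rn h ^+ 2 * t n.
  move=> yx; have yy : rn (y - x) < rho by lra.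
  have := @fder_quadratic _ _ f y (Lf y) (rho / 2) M _ _ _ (df y yy) ((t n)%:C *: h).
  rewrite rnt (fder_scale _ _ (df y yy)) => H.
  have -> : q n y - Lf y h = (t n)^-1%:C *: (f (y + (t n)%:C *: h) - f y - (t n)%:C *: Lf y h).
    by rewrite [RHS]scalerBr scalerA -rmorphM mulVf ?gt_eqF // rmorph1 scale1r.
  rewrite rnZ rn_real gtr0_norm ?invr_gt0 // mulrC ler_pdivrMr //.
  apply: le_trans (H _ _ _ _) _.
  - by lra.
  - by move=> z zy; exists (Lf z); apply/df/(near y).
  - by move=> z zy; apply/fM/(near y).
  - by have := th n; lra.
  rewrite le_eqVlt; apply/orP; left; apply/eqP; rewrite /Q; field; rewrite gt_eqF //.
have dq n y : rn (y - x) < rho / 2 ->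
    fder (q n) y (fun k => (t n)^-1%:C *: (Lf (y + (t n)%:C *: h) k - Lf y k)).
  move=> yx; apply/fderZ/fderB; last by apply: df; lra.
  apply/fder_shift/df/(near y) => //; rewrite [y + _]addrC addrK rnt.
  by have := th n; lra.
pose A n k := (t n)^-1%:C *: (Lf (x + (t n)%:C *: h) k - Lf x k).
have xx r : 0 < r -> rn (x - x) < r by rewrite subrr rn0.
have dqx n : fder (q n) x (A n) by apply/dq/xx; lra.
pose c (k : V) := Q * rn h ^+ 2 * s / (rho / 2) * rn k.
have Acauchy k n m : rn (A n k - A m k) <= c k * ('h_n + 'h_m).
  have -> : c k * ('h_n + 'h_m) = Q * rn h ^+ 2 * (t n + t m) / (rho / 2) * rn k.
    by rewrite /c /t; ring.
  apply: (@fder_cauchy _ _ (fun y => q n y - q m y) x (fun k => A n k - A m k)).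
  - by lra.
  - by move=> y yx; eexists; apply: fderB (dq n y yx) (dq m y yx).
  - move=> y yx; rewrite (_ : _ - _ = (q n y - Lf y h) - (q m y - Lf y h)); last first.
      by rewrite opprB addrA subrK.
    by rewrite mulrDr; apply: le_trans (ler_rnB _ _) (lerD _ _); apply: qL.
  exact: fderB.
have /choice[B HB] : forall k, exists l, forall n, rn (A n k - l) <= c k * 'h_n.
  by move=> k; apply: complete_halving.
have c0 k : 0 <= c k by rewrite /c !mulr_ge0 ?invr_ge0 ?exprn_ge0 ?rn_ge0 //; lra.
exists B; split.
- move=> a u v; apply/eqP; rewrite -subr_eq0 -rn_eq0 eq_le rn_ge0 andbT.
  apply: (@ler_halving _ _ 0 (c (a *: u + v) + rn a * c u + c v)) => n; rewrite add0r.
  have -> : B (a *: u + v) - (a *: B u + B v) =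
      - (A n (a *: u + v) - B (a *: u + v)) + a *: (A n u - B u) + (A n v - B v).
    by rewrite (fderP _ _ _ (dqx n)); module.
  apply: le_trans (ler_rnD _ _) _; rewrite mulrDl lerD //.
  apply: le_trans (ler_rnD _ _) _; rewrite mulrDl lerD ?rnN // rnZ -mulrA.
  by rewrite ler_wpM2l ?rn_ge0.
- have [_ [K KP] _] := dqx 0; exists (K + Q * rn h ^+ 2 * s / (rho / 2)) => u.
  have := HB u 0; have := KP u; have := ler_rn_dist (B u) (A 0 u).
  by rewrite rn_distC expr0 mulr1 /c mulrDl; lra.
pose K := 2 * M / rho * rn h + Q * rn h ^+ 2 * s.
have qK n y : rn (y - x) < rho / 2 -> rn (q n y) <= K.
  move=> yx; have H := qL n y yx.
  have : rn (Lf y h) <= 2 * M / rho * rn h.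
    rewrite (_ : 2 * M / rho = M / (rho / 2)); last by field; rewrite gt_eqF.
    apply: (@fder_cauchy _ _ f y); first by lra.
    - by move=> z zy; exists (Lf z); apply/df/(near y).
    - by move=> z zy; apply/fM/(near y).
    by apply: df; lra.
  have : Q * rn h ^+ 2 * t n <= Q * rn h ^+ 2 * s.
    apply: ler_wpM2l; first by rewrite mulr_ge0 ?exprn_ge0 ?rn_ge0.
    by rewrite /t ler_piMr // ltW.
  by have := ler_rn_dist (q n y) (Lf y h); rewrite /K; lra.
have K0 : 0 <= K by apply: le_trans (qK 0 x (xx _ _)); rewrite ?rn_ge0 //; lra.
apply: big_o_small_o; exists (8 * K / (rho / 2) ^+ 2 + 1).
  by rewrite ltr_pwDr // !mulr_ge0 // invr_ge0 exprn_ge0 //; lra.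
exists (rho / 8); first by lra.
move=> k kr.
have kx : rn (x + k - x) < rho / 2 by rewrite [x + k]addrC addrK; lra.
apply: (@ler_halving _ _ _ (2 * (Q * rn h ^+ 2 * s) + c k)) => n.
have H1 : rn (q n (x + k) - q n x - A n k) <= 8 * K / (rho / 2) ^+ 2 * rn k ^+ 2.
  apply: fder_quadratic (dqx n) _ _; last by lra.
  - by lra.
  - by move=> y yx; eexists; apply: dq.
  exact: qK.
have H2 := qL n _ kx; have H3 := qL n x (xx _ (divr_gt0 rho0 (ltr0Sn _ 1))); have H4 := HB k n.
have -> : Lf (x + k) h - Lf x h - B k = (q n (x + k) - q n x - A n k) -
  (q n (x + k) - Lf (x + k) h) + (q n x - Lf x h) + (A n k - B k) by module.
set a1 := q n (x + k) - q n x - A n k in H1 *; set a2 := q n (x + k) - _ in H2 *.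
set a3 := q n x - _ in H3 *; set a4 := A n k - _ in H4 *.
have := ler_rnD (a1 - a2 + a3) a4; have := ler_rnD (a1 - a2) a3.
have := ler_rnB a1 a2; rewrite /t in H2 H3.
have : 0 <= rn k ^+ 2 by rewrite exprn_ge0 ?rn_ge0.
by move: H1 H2 H3 H4; lra.
Qed.
End DirectionalDerivative.
End Frechet.

(** * Higher derivatives *)

Section HigherDerivatives.
Context {R : realType}.
Local Notation C := R[i].

Lemma set_slot_cons0 {V : normedModType C} m (h u : V) (s : m.-tuple V) :
  set_slot (cons_tuple h s) ord0 u = cons_tuple u s.
Proof.
apply: eq_from_tnth => j; rewrite tnth_mktuple.
case: (unliftP ord0 j) => [i ->|->]; last by rewrite dfwithin.
by rewrite dfwithout // !tnthS.
Qed.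

Lemma set_slot_consS {V : normedModType C} m (h u : V) (s : m.-tuple V) (i : 'I_m) :
  set_slot (cons_tuple h s) (lift ord0 i) u = cons_tuple h (set_slot s i u).
Proof.
apply: eq_from_tnth => j; rewrite tnth_mktuple.
case: (unliftP ord0 j) => [k ->|->]; last by rewrite dfwithout.
rewrite tnthS tnth_mktuple; have [->|ik] := eqVneq i k; first by rewrite !dfwithin.
by rewrite !dfwithout ?tnthS // (inj_eq lift_inj).
Qed.

Lemma cons_thead_behead {V : normedModType C} m (s : m.+1.-tuple V) :
  cons_tuple (thead s) (behead_tuple s) = s.
Proof. by apply: val_inj; rewrite [s in RHS]tuple_eta. Qed.

Definition prod_rn {V : normedModType C} m (s : m.-tuple V) : R :=
  \prod_(i < m) rn (tnth s i).

Lemma prod_rnE {V : normedModType C} m (s : m.-tuple V) :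
  \prod_(i < m) `|tnth s i| = (prod_rn s)%:C.
Proof. by rewrite rmorph_prod; apply: eq_bigr => i _; rewrite rnE. Qed.

Lemma prod_rn_ge0 {V : normedModType C} m (s : m.-tuple V) : 0 <= prod_rn s.
Proof. by apply: prodr_ge0 => i _; apply: rn_ge0. Qed.

Lemma prod_rn_cons {V : normedModType C} m h (s : m.-tuple V) :
  prod_rn (cons_tuple h s) = rn h * prod_rn s.
Proof.
by rewrite /prod_rn big_ord_recl; congr (_ * _); apply: eq_bigr => i _; rewrite tnthS.
Qed.

Section Uniqueness.
Context {V W : normedModType C}.

Lemma frechet_fder m (F : V -> m.-tuple V -> W) x A : is_frechet_derivative F x A ->
  forall s, fder (fun y => F y s) x (fun h => A (cons_tuple h s)).
Proof.
move=> [[Al [M AM]] Ao] s; split.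
- by move=> a u v; have := Al ord0 (cons_tuple 0 s) a u v; rewrite !set_slot_cons0.
- exists (complex.Re M * prod_rn s) => u; have := AM (cons_tuple u s).
  rewrite prod_rnE rnE lecE /= => /andP[_]; rewrite prod_rn_cons.
  by case: M {AM} => a b /=; rewrite mulr0 subr0 mulrCA mulrC.
move=> e e0.
have d0 : 0 < e / (prod_rn s + 1) by rewrite divr_gt0 // ltr_pwDr // prod_rn_ge0.
have /Ao/nbhs0_rnP[r r0 H] : (0 : C) < (e / (prod_rn s + 1))%:C by rewrite ltcR.
exists r => // h /H/(_ s); rewrite prod_rnE !rnE -!rmorphM lecR => /le_trans; apply.
rewrite expr1 mulrAC ler_wpM2r ?rn_ge0 // mulrAC ler_pdivrMr ?ltr_pwDr ?prod_rn_ge0 //.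
by rewrite ler_pM2l // lerDl.
Qed.

Lemma frechet_unique m (F : V -> m.-tuple V -> W) x A A' :
  is_frechet_derivative F x A -> is_frechet_derivative F x A' -> A = A'.
Proof.
move=> HA HA'; apply/funext => s; rewrite -(cons_thead_behead s).
exact: fder_unique (frechet_fder HA (behead_tuple s)) (frechet_fder HA' _) (thead s).
Qed.

(** [Dn] selects a derivative by choice; uniqueness identifies the selected one with any derivative
    that has been constructed. *)
Lemma DnS_eq m (f : V -> W) x A : is_frechet_derivative (Dn m f) x A ->
  Dn m.+1 f x = A.
Proof.
by move=> HA; apply: xget_unique => // B HB; apply: frechet_unique HB HA.
Qed.
End Uniqueness.

Section Holomorphic.
Context {V : normedModType C} {W : completeNormedModType C}.
Variables (f : V -> W) (U : set V).
Hypothesis openU : forall x, U x ->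
  exists2 r : R, 0 < r & forall y, rn (y - x) < r -> U y.
Hypothesis fU : forall x, U x -> exists L, fder f x L.

(** The invariant of the induction on [m]. Its local bound relative to [prod_rn s], with one [M] for
    all [s], is what turns differentiability for each fixed [s] into differentiability in operator
    norm. *)
Definition Dn_regular m :=
  [/\ forall x, U x -> forall s, exists L, fder (fun y => Dn m f y s) x L,
      forall x, U x -> exists2 r : R, 0 < r & exists2 M : R, 0 <= M &
        forall y, rn (y - x) < r -> U y /\ forall s, rn (Dn m f y s) <= M * prod_rn s &
      forall x, U x -> multilinear (Dn m f x)].

Lemma Dn_regular0 : Dn_regular 0.
Proof.
split.
- by move=> x Ux s; apply: fU.
- move=> x Ux; have [L HL] := fU Ux; have [r r0 [M HM]] := fder_loc_bounded HL.
  have [r' r'0 Hr'] := openU Ux.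
  exists (Num.min r r'); first by rewrite lt_min r0.
  exists M; first by apply: le_trans (HM x _); rewrite ?rn_ge0 // subrr rn0.
  move=> y; rewrite lt_min => /andP[yr yr']; split; first exact: Hr'.
  by move=> s; rewrite /prod_rn big_ord0 mulr1 HM.
by move=> x _ [].
Qed.

Section Step.
Variables (m : nat) (reg : Dn_regular m).

Let D x s h : W := xget (fun=> 0) [set L | fder (fun y => Dn m f y s) x L] h.

Let DP x s : U x -> fder (fun y => Dn m f y s) x (D x s).
Proof.
move=> Ux; case: reg => /(_ x Ux s)[L HL] _ _.
by rewrite /D; case: xgetP => // /(_ L).
Qed.

Let Dbound x : U x -> exists2 r : R, 0 < r & exists2 M : R, 0 <= M &
  forall y, rn (y - x) < r -> U y /\ forall s h, rn (D y s h) <= M * (rn h * prod_rn s).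
Proof.
move=> Ux; case: reg => _ /(_ x Ux)[r r0 [M M0 H]] _.
exists (r / 2); first exact: divr_gt0.
exists (M / (r / 2)); first by rewrite divr_ge0 // divr_ge0 // ltW.
move=> y yx; have Uy : U y by case: (H y) => //; lra.
split=> // s h; have near z : rn (z - y) < r / 2 -> rn (z - x) < r.
  by move=> zy; have := ler_rnD (z - y) (y - x); rewrite addrA subrK; lra.
rewrite (_ : _ * (rn h * _) = M * prod_rn s / (r / 2) * rn h); last by ring.
apply: (fder_cauchy _ _ _ (DP s Uy)); first exact: divr_gt0.
  by move=> z /near/H[Uz _]; exists (D z s); apply: DP.
by move=> z /near/H[_].
Qed.

Let DmultiS x : U x -> forall (i : 'I_m) (s : m.-tuple V) (a : C) (u v h : V),
  D x (set_slot s i (a *: u + v)) h = a *: D x (set_slot s i u) h + D x (set_slot s i v) h.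
Proof.
move=> Ux i s a u v h; have [r r0 rU] := openU Ux.
have [_ _ Dl] := reg.
have H1 := DP (set_slot s i (a *: u + v)) Ux.
have H2 := fderB (fderZ a (DP (set_slot s i u) Ux)) (fderZ (-1) (DP (set_slot s i v) Ux)).
rewrite (fder_unique H1 (fder_near r0 _ H2) h); first by rewrite scaleN1r opprK.
by move=> y /rU Uy; rewrite Dl // scaleN1r opprK.
Qed.

Let DA x (s : m.+1.-tuple V) : W := D x (behead_tuple s) (thead s).

Let DAE x s h : DA x (cons_tuple h s) = D x s h.
Proof. by rewrite /DA theadE; congr (D x _ h); apply: val_inj. Qed.

Let DA_multilinear x : U x -> multilinear (DA x).
Proof.
move=> Ux i s a u v; rewrite -(cons_thead_behead s).
case: (unliftP ord0 i) => [j ->|->].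
  by rewrite !set_slot_consS !DAE DmultiS.
by rewrite !set_slot_cons0 !DAE (fderP _ _ _ (DP _ Ux)).
Qed.

(** For fixed [s] the map is bounded by [M * prod_rn s], so the remainder given by [fder_quadratic]
    is itself proportional to [prod_rn s], on a ball that does not depend on [s]. *)
Let DA_frechet x : U x -> is_frechet_derivative (Dn m f) x (DA x).
Proof.
move=> Ux; split; first split; first exact: DA_multilinear.
  have [r r0 [M M0 H]] := Dbound Ux; exists M%:C => s.
  have [|_ Hx] := H x; first by rewrite subrr rn0.
  rewrite prod_rnE rnE -rmorphM lecR -(cons_thead_behead s) DAE prod_rn_cons.
  exact: Hx.
move=> e e0.
have eR : e = (complex.Re e)%:C by rewrite RRe_real // gtr0_real.
move: (complex.Re e) eR e0 => {}e -> ; rewrite ltcR => e0.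
case: reg => _ /(_ x Ux)[r r0 [M M0 H]] _.
have K0 : 0 < 8 * M / r ^+ 2 + 1.
  by rewrite ltr_pwDr // !mulr_ge0 // invr_ge0 exprn_ge0 // ltW.
apply/nbhs0_rnP; exists (Num.min (r / 4) (e / (8 * M / r ^+ 2 + 1))).
  by rewrite lt_min !divr_gt0.
move=> h; rewrite lt_min => /andP[hr he] s; rewrite DAE prod_rnE !rnE -!rmorphM lecR.
have := @fder_quadratic _ _ _ _ x (D x s) r (M * prod_rn s) r0 _ _ (DP s Ux) h hr.
move=> /(_ _ _)/le_trans; apply.
- by move=> y /H[Uy _]; exists (D y s); apply: DP.
- by move=> y /H[_].
rewrite (_ : 8 * _ / _ * _ = (8 * M / r ^+ 2) * rn h * rn h * prod_rn s); last by ring.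
rewrite ler_wpM2r ?prod_rn_ge0 // ler_wpM2r ?rn_ge0 //.
move: he; rewrite ltr_pdivlMr // => he.
by have := rn_ge0 h; nra.
Qed.

Let DnSE x : U x -> Dn m.+1 f x = DA x.
Proof. by move=> /DA_frechet/DnS_eq. Qed.

Lemma Dn_fder x s : U x ->
  fder (fun y => Dn m f y s) x (fun h => Dn m.+1 f x (cons_tuple h s)).
Proof.
move=> Ux; rewrite DnSE //; have := DP s Ux.
by under [X in _ -> fder _ _ X]funext do rewrite DAE.
Qed.

Lemma Dn_frechet x : U x ->
  is_frechet_derivative (Dn m f) x (Dn m.+1 f x).
Proof. by move=> Ux; rewrite DnSE //; apply: DA_frechet. Qed.

(** With its arguments fixed, [Dn m.+1 f] is the derivative of [Dn m f] in the direction of the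
    first argument, so [fder_directional] differentiates it again. *)
Lemma Dn_regularS : Dn_regular m.+1.
Proof.
split.
- move=> x Ux s; have [r r0 rU] := openU Ux.
  case: reg => _ /(_ x Ux)[r' r'0 [M M0 H]] _.
  pose t := behead_tuple s.
  have [A HA] := @fder_directional _ _ _ (fun y => Dn m f y t) x
    (fun y => D y t) r' (M * prod_rn t) r'0
    (fun y yx => DP t (H y yx).1) (fun y yx => (H y yx).2 t) (thead s).
  exists A; apply: fder_near r0 _ HA => y /rU Uy; rewrite DnSE //.
- move=> x /Dbound[r r0 [M M0 H]]; exists r => //; exists M => // y /H[Uy Hy]; split=> // s.
  by rewrite DnSE // -(cons_thead_behead s) DAE prod_rn_cons.
by move=> x Ux; rewrite DnSE //; apply: DA_multilinear.
Qed.
End Step.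

Lemma Dn_regular_all m : Dn_regular m.
Proof. by elim: m => [|m]; [exact: Dn_regular0|exact: Dn_regularS]. Qed.

End Holomorphic.
End HigherDerivatives.

(** * Functions with nonnegative real part *)

Section PositiveRealPart.
Context {R : realType}.
Local Notation C := R[i].
Local Notation "'h_ k" := ((2^-1 : R) ^+ k) (at level 10, k at level 9).

Lemma cmean_conj n (F : C -> C^o) (r : R) :
  cmean n (fun z => (F z)^* : C^o) r = (cmean n F r)^*.
Proof. exact: dmean_conj. Qed.

Lemma has_cderiv_if0 {W : normedModType C} (G : C -> W) (c : W) z d : z != 0 ->
  has_cderiv G z d -> has_cderiv (fun w => if w == 0 then c else G w) z d.
Proof.
move=> z0; apply: (has_cderiv_near (r := rn z)) => [|h hz]; first by rewrite rn_gt0.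
case: eqP => // /eqP; rewrite addr_eq0 => /eqP zh.
by move: hz; rewrite zh rnN ltxx.
Qed.

(** Take [r = rho * (1 - 'h_n / 2)] and use [(1 - t / 2) ^ 2 >= 1 - t]. *)
Lemma ler_radius (a b rho : R) : 0 <= a -> 0 < rho ->
  (forall r, 0 < r < rho -> a * r ^+ 2 <= b) -> a * rho ^+ 2 <= b.
Proof.
move=> a0 rho0 H; apply: (@ler_halving _ _ _ (a * rho ^+ 2)) => n.
have h0 : 0 < 'h_n :> R by rewrite exprn_gt0 // invr_gt0.
have h1 : 'h_n <= 1 :> R by rewrite exprn_ile1 // ?invr_ge0 // invf_le1 // ler1n.
have arho : 0 <= a * rho ^+ 2 by rewrite mulr_ge0 // exprn_ge0 // ltW.
have : a * rho ^+ 2 * (1 - 'h_n / 2) ^+ 2 <= b.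
  by rewrite -mulrA -exprMn; apply: H; nra.
have : 1 - 'h_n <= (1 - 'h_n / 2) ^+ 2 by rewrite expr2; nra.
by nra.
Qed.

(* The second coefficient is the mean of [z^-2 q z], while [z^-2 (q z)^*] has
   mean zero; their sum [z^-2 2 Re (q z)] is dominated by [2 r^-2 Re (q z)]. *)
Lemma positive_real_coef2 (q : C -> C^o) (rho : R) (q0 q1 q2 : C) : 0 < rho ->
  (forall z, z != 0 -> rn z < rho -> exists d, has_cderiv q z d) ->
  (forall z, z != 0 -> rn z < rho -> 0 <= complex.Re (q z)) ->
  small_o 2 (fun h => q h - (q0 + q1 * h + q2 * h ^+ 2) : C^o) ->
  rn q2 * rho ^+ 2 <= 2 * complex.Re q0.
Proof.
move=> rho0 dq qpos qo; apply: ler_radius => // [|r r_int]; first exact: rn_ge0.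
have /andP[r0 rrho] := r_int.
have q00 : q 0 = q0.
  by have := small_o_at0 qo; rewrite mulr0 expr0n mulr0 !addr0 => /eqP; rewrite subr_eq0 => /eqP.
pose F1 z : C^o := if z == 0 then q2 else (z * z)^-1 * (q z - q0 - q1 * z).
pose F2 z : C^o := z * z * q z.
have dsq z : has_cderiv (fun w : C => w * w : C^o) z (z * 1 + 1 * z).
  exact: has_cderivM (has_cderiv_id z) (has_cderiv_id z).
have cq : small_o 0 (fun h => q h - q 0).
  have H1 : small_o 0 (fun h : C => q1 * h : C^o).
    have sX : small_o 0 (fun h : C => h : C^o) := small_oX 0.
    exact: big_o_small_oZ (big_o_cst q1) sX.
  have H2 : small_o 0 (fun h : C => q2 * h ^+ 2 : C^o).
    have sX : small_o 0 (fun h : C => h ^+ 2 : C^o) := small_oW (small_oX 1).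
    exact: big_o_small_oZ (big_o_cst q2) sX.
  have := small_oD (small_oD (small_oW (small_oW qo)) H1) H2.
  by apply: small_o_ext => h; rewrite q00; ring.
have dF1 z : z != 0 -> rn z < rho -> exists d, has_cderiv F1 z d.
  move=> z0 /(dq _ z0)[d Hd]; eexists; apply: has_cderiv_if0 => //.
  apply: has_cderivM; first by apply: has_cderivV (dsq z) _; rewrite mulf_neq0.
  apply: has_cderivB; first by apply: has_cderivB Hd (has_cderiv_cst _ _).
  exact: has_cderivM (has_cderiv_cst (q1 : C^o) z) (has_cderiv_id z).
have cF1 : small_o 0 (fun h => F1 h - F1 0).
  move=> e e0; have [s s0 H] := qo e e0; exists s => // h hs.
  rewrite /F1 eqxx expr0 mulr1; case: eqP => [_|/eqP h0].
    by rewrite subrr rn0 ltW.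
  rewrite (_ : _ - q2 = (h * h)^-1 * (q h - (q0 + q1 * h + q2 * h ^+ 2))).
    rewrite rnM rnV rnM mulrC ler_pdivrMr -expr2; first exact: H.
    by rewrite exprn_gt0 // rn_gt0.
  by field; exact: h0.
have dF2 z : z != 0 -> rn z < rho -> exists d, has_cderiv F2 z d.
  move=> z0 /(dq _ z0)[d Hd]; eexists.
  exact: has_cderivM (dsq z) Hd.
have F20 : F2 0 = 0 by rewrite /F2 !mul0r.
have cF2 : small_o 0 (fun h => F2 h - F2 0).
  have bq : big_o 0 q.
    have := big_oD (small_o_big_o cq) (big_o_cst (q 0)).
    by apply: big_o_ext => h; rewrite subrK.
  have := small_o_big_oZ (small_oW (small_oX 1) : small_o 0 (fun h : C => h ^+ 2 : C)) bq.
  by apply: small_o_ext => h; rewrite F20 subr0 /F2 -expr2.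
apply/ler_addgt0Pr => e e0.
(* After multiplication by [r ^ 2] the errors of the means of [F1], [F2] and [q] carry the weights
   [r ^ 2], [r ^- 2] and 2. *)
pose k := r ^+ 2 + r ^- 2 + 2.
have k0 : 0 < k by rewrite /k ltr_pwDr // addr_ge0 // ?invr_ge0 exprn_ge0 // ltW.
have ek0 : 0 < e / k by rewrite divr_gt0.
have [N1 H1] := circle_mean_value r_int dF1 cF1 ek0.
have [N2 H2] := circle_mean_value r_int dF2 cF2 ek0.
have [N3 H3] := circle_mean_value r_int dq cq ek0.
(* The two additional levels are those required by [cmean_quarter]. *)
pose n := (maxn (maxn N1 N2) N3).+2.
have {}H1 : rn (cmean n F1 r - F1 0) <= e / k.
  by apply/H1/leqW/leqW; rewrite !leq_max leqnn.
have {}H2 : rn (cmean n F2 r - F2 0) <= e / k.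
  by apply/H2/leqW/leqW; rewrite !leq_max leqnn orbT.
have {}H3 : rn (cmean n q r - q 0) <= e / k.
  by apply/H3/leqW/leqW; rewrite !leq_max leqnn orbT.
pose G z : C^o := (z * z)^-1 * q z.
have nz (z : C) : rn z = r -> z != 0 by move=> zr; rewrite -rn_gt0 zr.
have F1G : cmean n F1 r = cmean n G r.
  rewrite (@eq_cmean _ _ _ F1 (fun z => G z + ((- q0 *: ((z * z)^-1 : C^o)) +
     (- q1 *: (z^-1 : C^o))))) //; last first.
    move=> z /nz z0; rewrite /F1 ifN // /G /GRing.scale /=; field; exact: z0.
  rewrite cmeanD [X in _ + X](_ : _ = 0) ?addr0 // cmeanD !cmeanZ.
  rewrite [X in - q0 *: X]cmean_quarter; last first.
    move=> z; rewrite mulrACA (_ : 'i * 'i = -1); last by rewrite -expr2 sqr_i.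
    by rewrite mulN1r invrN.
  by rewrite [X in - q1 *: X]cmean_odd ?scaler0 ?addr0 // => z; rewrite invrN.
(* On the circle [z^-2] equals [r^-4] times the conjugate of [z ^ 2]. Hence [z^-2] times the
   conjugate of [q z] is [r^-4] times the conjugate of [F2 z], and [F2] is holomorphic with value 0
   at 0. *)
pose S z : C^o := G z + (r ^- 4)%:C *: ((F2 z)^* : C^o).
have SE : cmean n S r = cmean n G r + (r ^- 4)%:C * (cmean n F2 r : C)^*.
  rewrite /S cmeanD; congr (_ + _); rewrite cmeanZ; congr (_ *: _).
  exact: cmean_conj.
have Sb : rn (cmean n S r) <= complex.Re (cmean n (fun z => (2 / r ^+ 2)%:C *: q z) r : C).
  apply: rn_cmean_le_Re => // z zr; have z0 := nz z zr.
  have qp : 0 <= complex.Re (q z) by apply: qpos => //; rewrite zr.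
  have zz : z * z^* = (r ^+ 2)%:C by rewrite -sqr_normc rnE zr rmorphXn.
  have -> : S z = (z * z)^-1 * (2 * (complex.Re (q z))%:C).
    rewrite /S /G /F2 /GRing.scale /= -addcJ !rmorphM mulrDr /=; congr (_ + _).
    rewrite (_ : (r ^- 4)%:C = (z * z^*)^-1 * (z * z^*)^-1).
      by field; rewrite z0 conjc_eq0.
    by rewrite zz -invfM -rmorphM fmorphV; congr (_ %:C^-1); ring.
  rewrite rnM rnV !rnM zr rn_real (ger0_norm qp) rn_nat -expr2 /GRing.scale /=.
  by case: (q z) => a b /=; rewrite mul0r subr0 mulrC mulrAC.
rewrite cmeanZ in Sb; rewrite F1G in H1; rewrite F20 subr0 in H2; rewrite q00 in H3.
rewrite /F1 eqxx in H1.
move: (cmean n S r) (cmean n G r) (cmean n F2 r) (cmean n q r : C) SE Sb H1 H2 H3.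
move=> s g f2 m SE Sb H1 H2 H3.
have r2 : 0 < r ^+ 2 by rewrite exprn_gt0.
have h1 : rn g <= rn s + r ^- 4 * rn f2.
  have -> : g = s - (r ^- 4)%:C * f2^* by rewrite SE addrK.
  apply: le_trans (ler_rnB _ _) _; rewrite rnM rn_conj rn_real ger0_norm //.
  by rewrite invr_ge0 exprn_ge0 // ltW.
have h2 : rn s <= 2 / r ^+ 2 * (complex.Re q0 + e / k).
  apply: le_trans Sb _; have : complex.Re m <= complex.Re q0 + e / k.
    have := Re_le_rn (m - q0); rewrite raddfB /=; lra.
  case: m {H3} => a b /= ab; rewrite mul0r subr0.
  by rewrite ler_wpM2l // divr_ge0 // ltW.
have h3 : rn q2 <= rn g + e / k.
  by have := ler_rn_dist q2 g; rewrite rn_distC; lra.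
have h4 : rn q2 <= 2 / r ^+ 2 * (complex.Re q0 + e / k) + r ^- 4 * (e / k) + e / k.
  have : r ^- 4 * rn f2 <= r ^- 4 * (e / k).
    by rewrite ler_wpM2l // invr_ge0 exprn_ge0 // ltW.
  by lra.
have := ler_wpM2r (ltW r2) h4.
rewrite [X in _ <= X -> _](_ : _ = 2 * complex.Re q0 + e); first by [].
rewrite {4}(_ : e = e / k * k); last by rewrite mulfVK // gt_eqF.
move: (e / k) => t; rewrite /k; field; rewrite gt_eqF //.
Qed.

Lemma Re_inv_ge0 (a : C) : 0 <= complex.Re a -> 0 <= complex.Re a^-1.
Proof.
case: a => a b /= a0; rewrite divr_ge0 // addr_ge0 // ?sqr_ge0 //.
Qed.

(* Apply [positive_real_coef2] to 1 / (p + e), whose second coefficient tends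
   to [p1 ^+ 2 - p2]. *)
Lemma positive_real_fekete_szego (p : C -> C^o) (rho : R) (p1 p2 : C) : 0 < rho ->
  (forall z, z != 0 -> rn z < rho -> exists d, has_cderiv p z d) ->
  (forall z, z != 0 -> rn z < rho -> 0 <= complex.Re (p z)) ->
  small_o 2 (fun h => p h - (1 + p1 * h + p2 * h ^+ 2) : C^o) ->
  rn (p1 ^+ 2 - p2) * rho ^+ 2 <= 2.
Proof.
(* The 6 comes from [2 * (1 + e) ^ 2 <= 2 + 6 * e] for [e <= 1], the other term from replacing
   [(1 + e) * p2] by [p2]. *)
move=> rho0 dp ppos po; apply: (@ler_halving _ _ _ (6 + rn p2 * rho ^+ 2)) => n.
set e := 'h_n.
have e0 : 0 < e :> R by rewrite exprn_gt0 // invr_gt0.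
have e1 : e <= 1 :> R by rewrite exprn_ile1 // ?invr_ge0 // invf_le1 // ler1n.
have t0 : 0 < 1 + e by lra.
have tC0 : (1 + e)%:C != 0 :> C by rewrite (inj_eq (@complexI R) _ 0) gt_eqF.
pose c : C := (1 + e)%:C^-1.
pose P z : C := p z + e%:C.
have p00 : p 0 = 1.
  by have := small_o_at0 po; rewrite mulr0 expr0n mulr0 !addr0 => /eqP; rewrite subr_eq0 => /eqP.
have ReP z : rn z < rho -> e <= complex.Re (P z).
  move=> zr; have [->|z0] := eqVneq z 0; first by rewrite /P p00 /=; lra.
  by rewrite /P raddfD /= lerDr ppos.
have P0 z : rn z < rho -> P z != 0.
  by move=> /ReP H; apply/eqP => Pz; move: H; rewrite Pz /=; lra.
pose q z : C^o := (P z)^-1.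
have PV : big_o 0 q.
  exists e^-1; rewrite ?invr_gt0 //; exists rho => // h /ReP H.
  rewrite expr0 mulr1 rnV lef_pV2 ?posrE //; first exact: le_trans (Re_le_rn _).
  by apply: lt_le_trans (Re_le_rn _); apply: lt_le_trans H.
(* The second Taylor polynomial of the reciprocal of [c^-1 + p1 * h + p2 * h ^ 2]. Its product with
   that polynomial is [1 + k3 * h ^ 3 + k4 * h ^ 4], and [q - Q = q * (1 - P * Q)]. *)
pose Q h := c + (- c ^+ 2 * p1) * h + (c ^+ 3 * p1 ^+ 2 - c ^+ 2 * p2) * h ^+ 2.
pose k3 := p1 * (c ^+ 3 * p1 ^+ 2 - c ^+ 2 * p2) - c ^+ 2 * p1 * p2.
pose k4 := p2 * (c ^+ 3 * p1 ^+ 2 - c ^+ 2 * p2).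
have qo : small_o 2 (fun h => q h - Q h : C^o).
  have s2 : small_o 2 (fun h : C => h ^+ 3 : C^o) := small_oX 2.
  have b2 : big_o 0 (fun h : C => h ^+ 2 : C^o).
    exact/small_o_big_o/small_oW/(small_oX 1).
  have b0 : big_o 0 (fun h : C => h : C^o) by apply/small_o_big_o/(small_oX 0).
  have bQ : big_o 0 (Q : C -> C^o).
    apply: big_oD (big_oZ (big_o_cst _) b2).
    exact: big_oD (big_o_cst _) (big_oZ (big_o_cst _) b0).
  have H1 : small_o 2 (fun h : C => h ^+ 4 : C^o) := small_oW (small_oX 3).
  have H := small_oD (small_oD (big_o_small_oZ (big_o_cst (- k3)) s2)
    (big_o_small_oZ (big_o_cst (- k4)) H1)) (small_oN (small_o_big_oZ po bQ)).
  have := big_o_small_oZ PV H; apply: (small_o_near rho0) => h hr.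
  transitivity (q h * (1 - P h * Q h)); last by rewrite mulrBr mulr1 mulKf ?P0.
  rewrite /GRing.scale /=; congr (_ * _); rewrite /P /Q /k3 /k4 (_ : e%:C = c^-1 - 1); last first.
    by rewrite /c invrK rmorphD /= rmorph1; ring.
  by field; rewrite invr_neq0.
have dq z : z != 0 -> rn z < rho -> exists d, has_cderiv q z d.
  move=> z0 /[dup] zr /(dp z z0)[d Hd]; eexists; apply: has_cderivV; last exact: P0.
  exact: has_cderivD Hd (has_cderiv_cst (e%:C : C^o) z).
have qpos z : z != 0 -> rn z < rho -> 0 <= complex.Re (q z).
  by move=> _ /ReP H; apply: Re_inv_ge0; lra.
have := positive_real_coef2 rho0 dq qpos qo.
have -> : complex.Re c = (1 + e)^-1 by rewrite /c -fmorphV.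
have -> : c ^+ 3 * p1 ^+ 2 - c ^+ 2 * p2 = ((1 + e) ^- 3)%:C * (p1 ^+ 2 - (1 + e)%:C * p2).
  by rewrite fmorphV rmorphXn /= /c; move: (1 + e)%:C tC0 => T T0; field.
rewrite rnM rn_real ger0_norm; last by rewrite invr_ge0 exprn_ge0 // ltW.
move=> H.
have {}H : rn (p1 ^+ 2 - (1 + e)%:C * p2) * rho ^+ 2 <= 2 * (1 + e) ^+ 2.
  rewrite -(ler_pM2l (_ : 0 < (1 + e) ^- 3)); last by rewrite invr_gt0 exprn_gt0.
  rewrite mulrA; apply: le_trans H _; rewrite le_eqVlt; apply/orP; left; apply/eqP.
  by field; rewrite gt_eqF.
have : rn (p1 ^+ 2 - p2) <= rn (p1 ^+ 2 - (1 + e)%:C * p2) + e * rn p2.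
  rewrite (_ : _ - p2 = (p1 ^+ 2 - (1 + e)%:C * p2) + e%:C * p2); last first.
    by rewrite rmorphD /= rmorph1; ring.
  by apply: le_trans (ler_rnD _ _) _; rewrite rnM rn_real ger0_norm // ltW.
have rho2 : 0 <= rho ^+ 2 by rewrite exprn_ge0 // ltW.
move=> /(ler_wpM2r rho2); rewrite mulrDl => H'; apply: le_trans H' _.
apply: le_trans (lerD H (lexx _)) _; rewrite expr2.
by nra.
Qed.
End PositiveRealPart.

(** * The upper bound *)

Section TaylorExpansion.
Context {R : realType} {W : normedModType R[i]}.
Local Notation C := R[i].

Lemma has_cderiv_monomial (n : nat) (w : W) (z : C) :
  has_cderiv (fun t : C => t ^+ n.+1 *: w) z ((n.+1%:R * z ^+ n) *: w).
Proof.
elim: n => [|n IH].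
  have := has_cderivZ (has_cderiv_id z) (has_cderiv_cst w z).
  by rewrite scaler0 add0r expr0 mulr1.
have := has_cderivZ (has_cderiv_id z) IH; rewrite !scalerA -scalerDl.
have -> : z * (n.+1%:R * z ^+ n) + 1 * z ^+ n.+1 = n.+2%:R * z ^+ n.+1.
  by rewrite mulrCA -exprS -mulrDl natr1.
by apply: has_cderiv_ext => t; rewrite scalerA -exprS.
Qed.

(** The mean value inequality on the segment from 0 to [h] gains one power of [h]. *)
Lemma small_o_primitive (phi psi : C -> W) (r : R) n : 0 < r ->
  (forall z, rn z < r -> has_cderiv phi z (psi z)) -> phi 0 = 0 ->
  small_o n psi -> small_o n.+1 phi.
Proof.
move=> r0 dphi phi0 opsi e e0; have [s s0 H] := opsi e e0.
exists (Num.min r s); first by rewrite lt_min r0.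
move=> h; rewrite lt_min => /andP[hr hs].
have -> : rn (phi h) = rn (phi (1 * h) - phi (0 * h)) by rewrite mul1r mul0r phi0 subr0.
apply: (segment_mean_value (phi := fun z => phi (z * h))) => t t01.
have th : rn (t%:C * h) <= rn h.
  by rewrite rnM rn_real ger0_norm; have := rn_ge0 h; [nra | lra].
exists (h *: psi (t%:C * h)).
  apply: (@has_cderiv_comp _ _ (fun z => z * h)); last by apply: dphi; lra.
  have := has_cderivM (has_cderiv_id t%:C) (has_cderiv_cst (h : C^o) t%:C).
  by rewrite mulr0 add0r mul1r.
rewrite rnZ exprS mulrCA ler_wpM2l ?rn_ge0 //.
apply: le_trans (H _ (le_lt_trans th hs)) _; rewrite ler_wpM2l ?(ltW e0) //.
by rewrite lerXn2r // nnegrE rn_ge0.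
Qed.

(** Differentiability of [b2] at 0 is a first-order expansion; integrating it once and then again
    gives those of [b1] and [b]. The factors 2 and 6 make [c2] and [c3] Taylor coefficients. *)
Lemma taylor_order3 (b b1 b2 : C -> W) (c0 c1 c2 c3 : W) (r : R) : 0 < r ->
  (forall z, rn z < r -> has_cderiv b z (b1 z)) ->
  (forall z, rn z < r -> has_cderiv b1 z (b2 z)) ->
  has_cderiv b2 0 (6 *: c3) -> b 0 = c0 -> b1 0 = c1 -> b2 0 = 2 *: c2 ->
  small_o 2 (fun h => b1 h - (c1 + h *: (2 *: c2) + h ^+ 2 *: (3 *: c3))) /\
  small_o 3 (fun h => b h - (c0 + h *: c1 + h ^+ 2 *: c2 + h ^+ 3 *: c3)).
Proof.
move=> r0 db db1 db2 b0 b10 b20.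
have mono1 (w : W) z : has_cderiv (fun t : C => t *: w) z w.
  by have := has_cderiv_monomial 0 w z; rewrite expr0 mulr1 scale1r.
have mono2 (w : W) z : has_cderiv (fun t : C => t ^+ 2 *: w) z (z *: (2 *: w)).
  by have := has_cderiv_monomial 1 w z; rewrite scalerA expr1 mulrC.
have mono3 (w : W) z : has_cderiv (fun t : C => t ^+ 3 *: w) z (z ^+ 2 *: (3 *: w)).
  by have := has_cderiv_monomial 2 w z; rewrite scalerA mulrC.
have affine (u w : W) z : has_cderiv (fun t : C => u + t *: w) z w.
  by have := has_cderivD (has_cderiv_cst u z) (mono1 w z); rewrite add0r.
have o1 : small_o 2 (fun h => b1 h - (c1 + h *: (2 *: c2) + h ^+ 2 *: (3 *: c3))).
  apply: (small_o_primitive r0 (psi := fun h => b2 h - (2 *: c2 + h *: (2 *: (3 *: c3))))).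
  - move=> z zr; apply: has_cderivB; first exact: db1.
    exact: has_cderivD (affine _ _ _) (mono2 _ _).
  - by rewrite b10 expr0n !scale0r !addr0 subrr.
  apply: small_o_ext db2 => h; rewrite add0r b20 opprD addrA.
  by rewrite [2 *: (3 *: c3)]scalerA -natrM.
split=> //.
apply: (small_o_primitive r0 (psi := fun h =>
   b1 h - (c1 + h *: (2 *: c2) + h ^+ 2 *: (3 *: c3)))) => //.
  move=> z zr; apply: has_cderivB; first exact: db.
  by apply: has_cderivD (mono3 _ _); apply: has_cderivD (affine _ _ _) (mono2 _ _).
by rewrite b0 !expr0n !scale0r !addr0 subrr.
Qed.
End TaylorExpansion.

(** * Support functionals and their rotations *)

Section SupportFunctionals.
Context {R : realType} {X : completeNormedModType R[i]}.
Local Notation C := R[i].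
Implicit Types (T : {linear X -> C^o}).

Lemma unit_ballE (x : X) : unit_ball x <-> rn x < 1.
Proof. by rewrite /unit_ball /= rnE -ltcR. Qed.

Lemma dual_norm1_bound T : dual_norm T = 1 -> forall y, rn (T y) <= rn y.
Proof.
move=> T1 y; set S := [set complex.Re `|T y| | y in [set y : X | `|y| <= 1]].
(* The default value 0 of [sup] is incompatible with dual norm 1, so [T] is bounded. *)
have hS : has_sup S.
  by apply: contrapT => /sup_out; rewrite -/(dual_norm T) T1 => /eqP; rewrite oner_eq0.
have [->|y0] := eqVneq y 0; first by rewrite linear0 !rn0.
have yp : 0 < rn y by rewrite rn_gt0.
have : rn (T ((rn y)^-1%:C *: y)) <= 1.
  rewrite -T1; apply: sup_upper_bound => //; exists ((rn y)^-1%:C *: y) => //=.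
  rewrite rnE rnZ rn_real gtr0_norm ?invr_gt0 // mulVf ?gt_eqF //.
rewrite linearZ rnZ rn_real gtr0_norm ?invr_gt0 // mulrC ler_pdivrMr //.
by rewrite mul1r.
Qed.

Definition rotate (c : C) T : {linear X -> C^o} :=
  mk_linear (fun (a : C) (u v : X) =>
    (etrans (congr1 ( *%R c) (linearP T a u v))
      (etrans (mulrDr c _ _) (congr1 (+%R^~ (c * T v)) (mulrCA c a (T u)))))
    : c * T (a *: u + v) = a *: (c * T u : C^o) + c * T v).

(** With [c] the inverse phase of [z], this carries a support functional at [x] to one at [z *: x],
    where the starlikeness hypothesis can be applied. *)
Lemma rotate_support c T x y : rn c = 1 -> c * T y = `|y| ->
  support_functionals x T -> support_functionals y (rotate c T).
Proof.
move=> c1 cy [cT T1 _]; split; last exact: cy.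
  apply/bounded_continuous; exists 1 => u; rewrite mul1r.
  by rewrite (_ : rotate c T u = c * T u) // rnM c1 mul1r dual_norm1_bound.
rewrite -T1 /dual_norm; congr (sup _); apply/seteqP; split=> _ [u u1 <-]; exists u => //;
  by rewrite -!/(rn _) (_ : rotate c T u = c * T u) // rnM c1 mul1r.
Qed.
End SupportFunctionals.

(** * Derivatives of a holomorphic map of the ball *)

Section HolomorphicOnBall.
Context {R : realType} {X : completeNormedModType R[i]}.
Local Notation C := R[i].
Variable f : X -> X.
Hypothesis holf : holomorphic_on_ball f.

Let U : set X := [set x | rn x < 1].

Let openU x : U x -> exists2 r : R, 0 < r & forall y, rn (y - x) < r -> U y.
Proof.
move=> Ux; exists (1 - rn x); first by rewrite subr_gt0.
by move=> y yx; rewrite /U /=; have := ler_rn_dist y x; lra.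
Qed.

Lemma holomorphic_fder x : rn x < 1 -> fder f x ('d f x).
Proof. by move=> /unit_ballE/holf/differentiable_fder. Qed.

Let fU x : U x -> exists L, fder f x L.
Proof. by move=> /holomorphic_fder; exists ('d f x). Qed.

Let D2 (x u v : X) := Dn 2 f x [tuple u; v].
Let D3 (x u v w : X) := Dn 3 f x [tuple u; v; w].

Lemma diffE_Dn1 x h : rn x < 1 -> Dn 1 f x [tuple h] = 'd f x h.
Proof.
move=> Ux; have H := Dn_fder openU (m := 0) (Dn_regular_all openU fU 0) [tuple] Ux.
by rewrite -(fder_unique H (holomorphic_fder Ux) h); congr (Dn 1 f x _); apply: val_inj.
Qed.

Lemma fder_diff_ball x u : rn x < 1 -> fder (fun y => 'd f y u) x (fun h => D2 x h u).
Proof.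
move=> Ux; have [r r0 rU] := openU Ux.
have H := Dn_fder openU (Dn_regular_all openU fU 1) [tuple u] Ux.
have -> : (fun h => D2 x h u) = (fun h => Dn 2 f x (cons_tuple h [tuple u])).
  by apply/funext => h; congr (Dn 2 f x _); apply: val_inj.
by apply: (fder_near r0) H => y /rU Uy; rewrite diffE_Dn1.
Qed.

Lemma fder_Dn2_ball x u v : rn x < 1 -> fder (fun y => D2 y u v) x (fun h => D3 x h u v).
Proof.
move=> Ux; have H := Dn_fder openU (Dn_regular_all openU fU 2) [tuple u; v] Ux.
have -> : (fun h => D3 x h u v) = (fun h => Dn 3 f x (cons_tuple h [tuple u; v])).
  by apply/funext => h; congr (Dn 3 f x _); apply: val_inj.
exact: H.
Qed.

Lemma Dn2_scale x u v (a : C) : rn x < 1 -> D2 x u (a *: v) = a *: D2 x u v.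
Proof.
move=> Ux; have [_ _ /(_ x Ux) H] := Dn_regular_all openU fU 2.
have E w : [tuple u; w] = set_slot (cons_tuple u [tuple v]) (lift ord0 ord0) w.
  rewrite set_slot_consS (_ : [tuple v] = cons_tuple v [tuple]); last exact: val_inj.
  by rewrite set_slot_cons0; apply: val_inj.
have H0 := H (lift ord0 ord0) (cons_tuple u [tuple v]) (-1) 0 0.
have H1 := H (lift ord0 ord0) (cons_tuple u [tuple v]) a v 0.
move: H0 H1; rewrite -!E scaler0 addr0 scaleN1r addNr addr0 /D2 => ->.
by rewrite addr0.
Qed.

(** Differentiability of [Dn 1 f] in operator norm makes the estimate uniform in [u]. Tolerance 1
    suffices, and the bound of the second derivative supplies the rest of [K]. *)
Lemma diff_lipschitz x : rn x < 1 -> exists2 r : R, 0 < r & exists2 K : R, 0 <= K &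
  forall k, rn k < r -> rn (x + k) < 1 /\
    forall u, rn ('d f (x + k) u - 'd f x u) <= K * rn k * rn u.
Proof.
move=> Ux; have [[_ [M HM]] Ho] := Dn_frechet openU (Dn_regular_all openU fU 1) Ux.
have [r r0 rU] := openU Ux.
have /nbhs0_rnP[s s0 Hs] := Ho 1 ltr01.
exists (Num.min r s); first by rewrite lt_min r0.
exists (1 + `|complex.Re M|); first exact: addr_ge0.
move=> k; rewrite lt_min => /andP[kr ks].
have Uk : rn (x + k) < 1 by apply: rU; rewrite [x + k]addrC addrK.
split=> // u; have := Hs k ks [tuple u]; have := HM (cons_tuple k [tuple u]).
rewrite !prod_rnE prod_rn_cons !rnE diffE_Dn1 // diffE_Dn1 //.
have -> : prod_rn [tuple u] = rn u.
  rewrite (_ : [tuple u] = cons_tuple u [tuple]); last exact: val_inj.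
  by rewrite prod_rn_cons /prod_rn big_ord0 mulr1.
set A := Dn 2 f x _; rewrite mul1r -rmorphM lecR lecE => /andP[_] /= h1 h2.
have h3 : rn A <= `|complex.Re M| * (rn k * rn u).
  apply: le_trans h1 _; case: M {HM} => a b /=; rewrite mulr0 subr0.
  by rewrite ler_wpM2r ?ler_norm // mulr_ge0 ?rn_ge0.
have := ler_rn_dist ('d f (x + k) u - 'd f x u) A.
by rewrite mulrDl mulrDl mul1r -mulrA; lra.
Qed.
End HolomorphicOnBall.

(** * Expansion of (Df)^-1 f along a complex line *)

Section UpperBound.
Context {R : realType} {X : completeNormedModType R[i]}.
Local Notation C := R[i].
Variable f : X -> X.
Hypothesis holf : holomorphic_on_ball f.
Hypothesis invf : locally_biholomorphic f.

(** The bounded inverse gives the lower bound [N^-1] at [x], and near [x] the derivative moves by at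
    most half of it. This turns residuals of ['d f y w = f y] into errors of [w]. *)
Lemma diff_lower x : rn x < 1 -> exists2 r : R, 0 < r & exists2 c : R, 0 < c &
  forall k, rn k < r -> forall u, c * rn u <= rn ('d f (x + k) u).
Proof.
move=> Ux; have [B [/bounded_continuous[M HM] AB BA]] := invf ((unit_ballE x).2 Ux).
have [r r0 [K K0 H]] := diff_lipschitz holf Ux.
pose N := `|M| + 1; have N0 : 0 < N by rewrite ltr_pwDr.
have low u : N^-1 * rn u <= rn ('d f x u).
  rewrite mulrC ler_pdivrMr // -{1}[u]AB mulrC; apply: le_trans (HM _) _.
  by rewrite ler_wpM2r ?rn_ge0 // (le_trans (ler_norm _)) // lerDl.
have K1 : 0 < K + 1 by rewrite ltr_pwDr.
exists (Num.min r (N^-1 / 2 / (K + 1))); first by rewrite lt_min r0 !divr_gt0 // invr_gt0.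
exists (N^-1 / 2); first by rewrite divr_gt0 // invr_gt0.
move=> k; rewrite lt_min ltr_pdivlMr // => /andP[/H[_ {}H] kK] u.
have := ler_rn_dist ('d f x u) ('d f (x + k) u); rewrite rn_distC.
have : K * rn k * rn u <= N^-1 / 2 * rn u.
  by rewrite ler_wpM2r ?rn_ge0 //; have := rn_ge0 k; nra.
by have := low u; have := H u; lra.
Qed.

Let v y := inv_at ('d f y) (f y).

Lemma inv_atP y : rn y < 1 -> 'd f y (v y) = f y.
Proof.
move=> Uy; have [B [_ _ BA]] := invf ((unit_ballE y).2 Uy).
by rewrite /v /inv_at; apply: (@xgetPex _ 0 [set w | 'd f y w = f y]); exists (B (f y)) => /=.
Qed.

Let small_o_lower {V W W' : normedZmodType C} n (E : V -> W) (F : V -> W') (c r : R) :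
  0 < c -> 0 < r -> (forall h, rn h < r -> c * rn (E h) <= rn (F h)) ->
  small_o n F -> small_o n E.
Proof.
move=> c0 r0 H oF e e0; have [s s0 HF] := oF (e * c) (mulr_gt0 e0 c0).
exists (Num.min r s); first by rewrite lt_min r0.
move=> h; rewrite lt_min => /andP[/H h1 /HF h2].
by rewrite -(ler_pM2l c0) mulrA [c * e]mulrC (le_trans h1).
Qed.

(** [A] and [B] are the derivatives of [f] at the shifted and the original point, [u] and [u0] the
    values of [v] there. Differentiating [Df v = f] gives the equation for [d]; the three terms on
    the right are the remainders of [f] and of [Df] applied to [u0], and the increment of [Df]
    applied to [d]. *)
Let difference_quotient (A B : {linear X -> X}) (u u0 d b b0 q q' : X) (h : C) :
  A u = b -> B u0 = b0 -> B d = q - q' ->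
  A (u - u0 - h *: d) =
  (b - b0 - h *: q) - (A u0 - B u0 - h *: q') - h ^+ 1 *: (A d - B d).
Proof. by move=> Au Bu0 Bd; rewrite !linearB linearZ Au Bu0 Bd; module. Qed.

Lemma inv_at_cderiv x z : rn (z *: x) < 1 ->
  exists d, has_cderiv (fun t : C => v (t *: x)) z d.
Proof.
move=> Uz; have [r r0 [c c0 low]] := diff_lower Uz.
have [s s0 [K K0 lip]] := diff_lipschitz holf Uz.
have [B [_ AB BA]] := invf ((unit_ballE _).2 Uz).
set y := z *: x in Uz low lip AB BA *.
have db : has_cderiv (fun t : C => f (t *: x)) z ('d f y x).
  have := @fder_line _ _ _ f 0 x ('d f y) z; rewrite add0r => /(_ (holomorphic_fder holf Uz)).
  by apply: has_cderiv_ext => t; rewrite add0r.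
have dA u : has_cderiv (fun t : C => 'd f (t *: x) u) z (Dn 2 f y [tuple x; u]).
  have := @fder_line _ _ _ (fun w => 'd f w u) 0 x _ z.
  rewrite add0r => /(_ _ (fder_diff_ball holf u Uz)).
  by apply: has_cderiv_ext => t; rewrite add0r.
pose d := B ('d f y x - Dn 2 f y [tuple x; v y]); exists d.
have dE : 'd f y d = 'd f y x - Dn 2 f y [tuple x; v y] by rewrite BA.
have [t t0 Ht] : exists2 t : R, 0 < t & forall h : C, rn h < t -> rn (h *: x) < Num.min r s.
  exists (Num.min r s / (rn x + 1)); first by rewrite divr_gt0 ?lt_min ?r0 // ltr_pwDr ?rn_ge0.
  move=> h; rewrite ltr_pdivlMr ?ltr_pwDr ?rn_ge0 // rnZ; apply: le_lt_trans.
  by rewrite ler_wpM2l ?rn_ge0 // lerDl.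
have o3 := big_o_small_oZ (big_oX 1) (has_cderiv_cont (dA d)).
rewrite /has_cderiv; have o4 := small_oB (small_oB db (dA (v y))) o3.
apply: (small_o_lower c0 t0 _ o4) => h ht.
have := Ht h ht; rewrite lt_min => /andP[hr hs].
have yE : (z + h) *: x = y + h *: x by rewrite scalerDl.
have [Uh _] := lip _ hs.
rewrite yE; apply: le_trans (low _ hr _) _; rewrite le_eqVlt; apply/orP; left; apply/eqP.
by congr rn; apply: difference_quotient; rewrite ?inv_atP.
Qed.

(** Used with [A = Df(h x)] and [w = v(h x)]. Comparing powers of [h] in [A w = f(h x)] gives the
    coefficients [- p] and [2 *: e - 2 *: c]; each line on the right is then a Taylor remainder of
    total order 3. *)
Let expansion_remainder (A : {linear X -> X}) (w b x p c e : X) (h : C) : A w = b ->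
  A (w - (h *: x + h ^+ 2 *: - p + h ^+ 3 *: (2 *: e - 2 *: c))) =
  b - (h *: x + h ^+ 2 *: p + h ^+ 3 *: c)
  - h ^+ 1 *: (A x - (x + h *: (2 *: p) + h ^+ 2 *: (3 *: c)))
  - h ^+ 2 *: (A (- p) - (- p - h *: (2 *: e)))
  - h ^+ 3 *: (A (2 *: e - 2 *: c) - (2 *: e - 2 *: c)).
Proof.
move=> Aw; have E (y z : X) : A (w - (h *: x + h ^+ 2 *: y + h ^+ 3 *: z)) =
    b - (h *: A x + h ^+ 2 *: A y + h ^+ 3 *: A z).
  rewrite linearB Aw; congr (_ - _); rewrite linearD; congr (_ + _); last exact: linearZ.
  by rewrite linearD; congr (_ + _); exact: linearZ.
by rewrite E; module.
Qed.

Section Point.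
Variable x : X.
Hypotheses (f0 : f 0 = 0) (df0 : forall u, 'd f 0 u = u) (Ux : rn x < 1) (x0 : x != 0).

Let a2 := taylor2 f x x.
Let a3 := taylor3 f x x x.
Let w2 := - a2.
Let w3 := 2 *: taylor2 f x a2 - 2 *: a3.

Let rho := (rn x)^-1.
Let xp : 0 < rn x. Proof. by rewrite rn_gt0. Qed.
Let rho0 : 0 < rho. Proof. by rewrite invr_gt0. Qed.

Let inball (z : C) : rn z < rho -> rn (z *: x) < 1.
Proof. by rewrite rnZ -ltr_pdivlMr // div1r. Qed.

Lemma inv_at_expansion :
  small_o 3 (fun h : C => v (h *: x) - (h *: x + h ^+ 2 *: w2 + h ^+ 3 *: w3)).
Proof.
have U0 : rn (0 : X) < 1 by rewrite rn0.
have line (g : X -> X) L z : fder g (z *: x) L ->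
    has_cderiv (fun t : C => g (t *: x)) z (L x).
  move=> H; have := @fder_line _ _ _ g 0 x L z; rewrite add0r => /(_ H).
  by apply: has_cderiv_ext => t; rewrite add0r.
have db z : rn z < rho -> has_cderiv (fun t : C => f (t *: x)) z ('d f (z *: x) x).
  by move=> /inball Uz; apply: line; apply: holomorphic_fder.
have dA u z : rn z < rho ->
    has_cderiv (fun t : C => 'd f (t *: x) u) z (Dn 2 f (z *: x) [tuple x; u]).
  move=> /inball Uz.
  exact: (line (fun y => 'd f y u) _ z (fder_diff_ball holf u Uz)).
have D30 : Dn 3 f 0 [tuple x; x; x] = 6 *: a3.
  by rewrite /a3 /taylor3 scalerA mulfV ?scale1r // pnatr_eq0.
have dA2 : has_cderiv (fun t : C => Dn 2 f (t *: x) [tuple x; x]) 0 (6 *: a3).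
  have H := fder_Dn2_ball holf x x U0; move: H; rewrite -(scale0r x) => H.
  by have := line (fun y => Dn 2 f y [tuple x; x]) _ 0 H; rewrite scale0r D30.
have fx0 : f (0 *: x) = 0 by rewrite scale0r.
have dx0 u : 'd f (0 *: x) u = u by rewrite scale0r df0.
have D20 u : Dn 2 f (0 *: x) [tuple x; u] = 2 *: taylor2 f x u.
  by rewrite scale0r /taylor2 scalerA mulfV ?scale1r // pnatr_eq0.
have [e1 e2] := taylor_order3 rho0 db (dA x) dA2 fx0 (dx0 x) (D20 x).
have rn0rho : rn (0 : C) < rho by rewrite rn0.
have A0 : small_o 1 (fun h : C => 'd f (h *: x) w2 - (w2 - h *: (2 *: taylor2 f x a2))).
  have D2w : Dn 2 f (0 *: x) [tuple x; w2] = - (2 *: taylor2 f x a2).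
    by rewrite -D20 scale0r /w2 -scaleN1r Dn2_scale ?scaleN1r.
  apply: small_o_ext (dA w2 0 rn0rho) => h.
  rewrite add0r D2w dx0 scalerN; module.
have A3 : small_o 0 (fun h : C => 'd f (h *: x) w3 - w3).
  apply: small_o_ext (has_cderiv_cont (dA w3 0 rn0rho)) => h.
  by rewrite add0r; congr (_ - _); apply: dx0.
have [r r0 [c c0 low]] := diff_lower U0.
have [t t0 Ht] : exists2 t : R, 0 < t & forall h : C, rn h < t -> rn (h *: x) < r.
  exists (r * rho); first exact: mulr_gt0.
  by move=> h; rewrite rnZ -ltr_pdivrMr // invrK.
have t'0 : 0 < Num.min t rho by rewrite lt_min t0.
have E2 : small_o 3 (fun h : C => f (h *: x) - (h *: x + h ^+ 2 *: a2 + h ^+ 3 *: a3)).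
  by apply: small_o_ext e2 => h; rewrite add0r.
have E1 := big_o_small_oZ (big_oX 1) e1.
have E3 := big_o_small_oZ (big_oX 2) A0.
have E4 := big_o_small_oZ (big_oX 3) A3.
have E := small_oB (small_oB (small_oB E2 E1) E3) E4.
apply: (small_o_lower c0 t'0 _ E) => h; rewrite lt_min => /andP[ht hrho].
apply: le_trans (_ : rn ('d f (h *: x) (v (h *: x) - (h *: x + h ^+ 2 *: w2 + h ^+ 3 *: w3))) <= _).
  by have := low (h *: x) (Ht h ht); rewrite add0r.
rewrite le_eqVlt; apply/orP; left; apply/eqP; congr rn.
by apply: expansion_remainder; apply: inv_atP; apply: inball.
Qed.
End Point.
End UpperBound.

(** * The Fekete-Szego inequality *)

Section FeketeSzegoBound.
Context {R : realType} {X : completeNormedModType R[i]}.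
Local Notation C := R[i].

Lemma fekete_szego_bound (alpha : R) (f : X -> X) (x : X) (T : {linear X -> C^o}) :
  alpha < 1 -> almost_starlike alpha f -> unit_ball x -> x != 0 ->
  support_functionals x T ->
  `|fekete_szego alpha f x T| <= (2 * (1 - alpha))%:C * `|x| ^+ 4.
Proof.
move=> alpha1 [holf [f0 df0] invf starf] /unit_ballE Ux x0 HT.
have [cT T1 Tx] := HT.
have xp : 0 < rn x by rewrite rn_gt0.
have a1 : 0 < 1 - alpha by rewrite subr_gt0.
have aC : (1 - alpha)%:C != 0 :> C by rewrite (inj_eq (@complexI R) _ 0) gt_eqF.
have xC : (rn x)%:C != 0 :> C by rewrite (inj_eq (@complexI R) _ 0) gt_eqF.
pose a2 := taylor2 f x x; pose a3 := taylor3 f x x x.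
pose w2 := - a2; pose w3 := 2 *: taylor2 f x a2 - 2 *: a3.
pose v y := inv_at ('d f y) (f y).
have vo : small_o 3 (fun h : C => v (h *: x) - (h *: x + h ^+ 2 *: w2 + h ^+ 3 *: w3)).
  exact: inv_at_expansion.
pose rho := (rn x)^-1; have rho0 : 0 < rho by rewrite invr_gt0.
have inball (z : C) : rn z < rho -> rn (z *: x) < 1.
  by rewrite rnZ -ltr_pdivlMr // div1r.
have Tb := dual_norm1_bound T1.
pose c : C := (rn x)%:C * (1 - alpha)%:C.
have c0 : c != 0 by rewrite mulf_neq0.
pose p z : C^o := if z == 0 then 1 else (T (v (z *: x)) / z - alpha%:C * (rn x)%:C) / c.
pose p1 : C := T w2 / c; pose p2 : C := T w3 / c.
have dp z : z != 0 -> rn z < rho -> exists d, has_cderiv p z d.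
  move=> z0 /inball Uz; have [d Hd] := inv_at_cderiv holf invf Uz.
  have HTd : has_cderiv (fun z => T (v (z *: x)) : C^o) z (T d).
    move=> e /Hd[r r0 H]; exists r => // h /H; apply: le_trans.
    by rewrite -linearZ -!linearB.
  eexists; apply: has_cderiv_if0 => //.
  apply: has_cderivM (has_cderiv_cst (c^-1 : C^o) z).
  apply: has_cderivB (has_cderiv_cst (alpha%:C * (rn x)%:C : C^o) z).
  exact: has_cderivM HTd (has_cderivV (has_cderiv_id z) z0).
have ppos z : z != 0 -> rn z < rho -> 0 <= complex.Re (p z).
  move=> z0 zrho; have Uz := inball z zrho.
  have zp : 0 < rn z by rewrite rn_gt0.
  pose k : C := (rn z)%:C / z.
  have k1 : rn k = 1 by rewrite /k rnM rnV rn_real ger0_norm ?rn_ge0 // mulfV // gt_eqF.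
  have kT : k * T (z *: x) = `|z *: x|.
    rewrite linearZ Tx /= rnE normrZ !rnE /k /GRing.scale /=; field; exact: z0.
  have zx0 : z *: x != 0 by rewrite scaler_eq0 negb_or z0.
  have := starf _ ((unit_ballE _).2 Uz) zx0 _ (rotate_support k1 kT HT).
  rewrite rnE rnZ -rmorphM lecR -/(v (z *: x)).
  rewrite (_ : rotate k T (v (z *: x)) = k * T (v (z *: x))) // => H.
  (* Multiplying numerator and denominator by [k] makes the denominator real and positive, so the
     sign of [Re (p z)] is read off from [H]. *)
  rewrite /p ifN // (_ : _ / c = ((rn z * rn x * (1 - alpha))^-1)%:C *
     (k * T (v (z *: x)) - (alpha * (rn z * rn x))%:C)); last first.
    rewrite /c /k fmorphV !rmorphM /=.
    move: aC; move: (1 - alpha)%:C => b b0; field.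
    by rewrite z0 xC b0 (inj_eq (@complexI R) _ 0) gt_eqF.
  move: (k * T _) H => [m m'] /= H; rewrite mul0r subr0 mulr_ge0 ?subr_ge0 //.
  by rewrite invr_ge0 !mulr_ge0 // ltW.
have TE (u u1 u2 u3 : X) (k1 k2 k3 : C) : T (u - (k1 *: u1 + k2 *: u2 + k3 *: u3)) =
    T u - (k1 * T u1 + k2 * T u2 + k3 * T u3).
  rewrite linearB; congr (_ - _); rewrite linearD; congr (_ + _); last exact: linearZ.
  by rewrite linearD; congr (_ + _); exact: linearZ.
have po : small_o 2 (fun h => p h - (1 + p1 * h + p2 * h ^+ 2) : C^o).
  move=> e e0; have c1 : 0 < rn c by rewrite rn_gt0.
  have [r r0 H] := vo (e * rn c) (mulr_gt0 e0 c1).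
  exists r => // h hr; rewrite /p; case: eqP => [->|/eqP h0].
    by rewrite expr0n /= !mulr0 !addr0 subrr !rn0 expr0n mulr0.
  have hp : 0 < rn h by rewrite rn_gt0.
  rewrite (_ : _ - _ = (h * c)^-1 * T (v (h *: x) - (h *: x + h ^+ 2 *: w2 + h ^+ 3 *: w3))).
    rewrite rnM rnV rnM mulrC ler_pdivrMr ?mulr_gt0 //.
    apply: le_trans (Tb _) _; apply: le_trans (H h hr) _.
    by rewrite le_eqVlt; apply/orP; left; apply/eqP; ring.
  rewrite TE Tx rnE /p1 /p2.
  move: (T (v _)) (T w2) (T w3) => t1 t2 t3.
  have -> : alpha%:C = 1 - (1 - alpha)%:C :> C by rewrite rmorphB /= rmorph1 opprB addrC subrK.
  move: aC; rewrite /c; move: (1 - alpha)%:C => b b0; field.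
  by rewrite h0 b0 xC.
have := positive_real_fekete_szego rho0 dp ppos po.
rewrite /rho exprVn ler_pdivrMr ?exprn_gt0 // => key.
have -> : fekete_szego alpha f x T = ((1 - alpha) * rn x ^+ 2)%:C * (p1 ^+ 2 - p2).
  rewrite /fekete_szego rnE -/a2 -/a3 /p1 /p2 /c.
  have -> : T w2 = - T a2 by rewrite linearN.
  have -> : T w3 = 2 * T (taylor2 f x a2) - 2 * T a3.
    by rewrite linearB; congr (_ - _); exact: linearZ.
  rewrite rmorphM rmorphXn /=.
  move: aC; move: (1 - alpha)%:C => b b0; field.
  by rewrite b0 xC.
rewrite !rnE -rmorphXn -rmorphM lecR rnM rn_real ger0_norm; last first.
  by rewrite mulr_ge0 ?exprn_ge0 // ltW.
have x2 : 0 <= (1 - alpha) * rn x ^+ 2 by rewrite mulr_ge0 ?exprn_ge0 // ltW.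
apply: le_trans (ler_wpM2l x2 key) _.
by rewrite le_eqVlt; apply/orP; left; apply/eqP; ring.
Qed.
End FeketeSzegoBound.

(** * Support functionals *)

Section HahnBanach.
Context {R : realType} {X : completeNormedModType R[i]}.
Local Notation C := R[i].

(* A real-linear functional dominated by the norm is encoded by its graph. *)
Definition dominated_graph (u : X) (G : set (X * R)) : Prop :=
  [/\ G (u, rn u),
      forall (a : R) p q, G p -> G q -> G (a%:C *: p.1 + q.1, a * p.2 + q.2) &
      forall p, G p -> p.2 <= rn p.1].

Section Graph.
Variables (u : X) (G : set (X * R)).
Hypothesis dG : dominated_graph u G.

Let lin (a : R) y z s t : G (y, s) -> G (z, t) -> G (a%:C *: y + z, a * s + t).
Proof. by case: dG => _ H _ Hy Hz; apply: (H a (y, s) (z, t)). Qed.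

Let bound y s : G (y, s) -> s <= rn y. Proof. by case: dG => _ _ H /H. Qed.

Lemma dominated_graph0 : G (0, 0).
Proof.
case: dG => H _ _; have := lin (-1) H H.
by rewrite rmorphN rmorph1 scaleN1r addNr mulN1r addNr.
Qed.

Let scal (a : R) y s : G (y, s) -> G (a%:C *: y, a * s).
Proof. by move=> H; have := lin a H dominated_graph0; rewrite !addr0. Qed.

Let add y z s t : G (y, s) -> G (z, t) -> G (y + z, s + t).
Proof. by move=> Hy Hz; have := lin 1 Hy Hz; rewrite rmorph1 scale1r mul1r. Qed.

Lemma dominated_graph_fun y s t : G (y, s) -> G (y, t) -> s = t.
Proof.
move=> Hs Ht; apply/eqP; rewrite eq_le.
have /bound := lin (-1) Hs Ht; have /bound := lin (-1) Ht Hs.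
by rewrite rmorphN rmorph1 scaleN1r addNr rn0 !mulN1r; lra.
Qed.

(** The value [c] at [x0] must lie above all [s - |y - x0|] and below all [|y + x0| - s]; the
    triangle inequality separates the two families. Multiples of [x0] reduce to [x0] and [- x0] by
    scaling with [1 / |t|]. *)
Lemma dominated_graph_extend x0 : (forall s, ~ G (x0, s)) ->
  exists2 B, dominated_graph u B & G `<` B.
Proof.
move=> Nx0; pose S := [set p.2 - rn (p.1 - x0) | p in G].
have ubS y s : G (y, s) -> ubound S (rn (y + x0) - s).
  move=> Hy _ [[z t] /= Hz <-].
  have := bound (add Hy Hz); have := ler_rnD (y + x0) (z - x0).
  by rewrite addrACA subrr addr0; lra.
have supS : has_sup S.
  by split; [exists (0 - rn (0 - x0)); exists (0, 0) => //; exact: dominated_graph0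
            | exists (rn (0 + x0) - 0); apply: ubS; exact: dominated_graph0].
pose c := sup S.
have c_le y s : G (y, s) -> s + c <= rn (y + x0).
  move=> Hy; have : c <= rn (y + x0) - s by apply: ge_sup; [case: supS | apply: ubS].
  by lra.
have c_ge y s : G (y, s) -> s - c <= rn (y - x0).
  move=> Hy; have : s - rn (y - x0) <= c by apply: sup_upper_bound => //; exists (y, s).
  by lra.
pose B := [set p | exists y s (t : R), G (y, s) /\ p = (y + t%:C *: x0, s + t * c)].
have GB : G `<=` B.
  move=> [y s] Hy; exists y, s, 0; split=> //.
  by rewrite rmorph0 scale0r mul0r !addr0.
exists B.
  split; first by apply: GB; case: dG.
  - move=> a _ _ [y [s [t [Hy ->]]]] [z [s' [t' [Hz ->]]]] /=.
    exists (a%:C *: y + z), (a * s + s'), (a * t + t'); split; first exact: lin.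
    congr (_, _); last by ring.
    by rewrite rmorphD rmorphM /=; module.
  move=> _ [y [s [t [Hy ->]]]] /=.
  have [t0|t0|->] := ltgtP t 0; last by rewrite rmorph0 scale0r mul0r !addr0 bound.
    have := c_ge _ _ (scal (- t^-1) Hy).
    have -> : (- t^-1)%:C *: y - x0 = (- t^-1)%:C *: (y + t%:C *: x0).
      rewrite scalerDr scalerA (_ : _ * t%:C = -1) ?scaleN1r //.
      by rewrite -rmorphM mulNr mulVf ?lt_eqF // rmorphN rmorph1.
    rewrite rnZ rn_real normrN normfV ltr0_norm // => H.
    have Nt : 0 < - t by lra.
    have := ler_wpM2l (ltW Nt) H; rewrite mulrA mulfV ?gt_eqF // mul1r; apply: le_trans.
    by rewrite le_eqVlt; apply/orP; left; apply/eqP; field; rewrite lt_eqF.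
  have := c_le _ _ (scal t^-1 Hy).
  have -> : (t^-1)%:C *: y + x0 = (t^-1)%:C *: (y + t%:C *: x0).
    by rewrite scalerDr scalerA -rmorphM mulVf ?gt_eqF // rmorph1 scale1r.
  rewrite rnZ rn_real normfV gtr0_norm // => H.
  have := ler_wpM2l (ltW t0) H; rewrite mulrA mulfV ?gt_eqF // mul1r; apply: le_trans.
  by rewrite le_eqVlt; apply/orP; left; apply/eqP; field; rewrite gt_eqF.
split=> // BG; apply: (Nx0 c); apply: BG; exists 0, 0, 1; split; first exact: dominated_graph0.
by rewrite rmorph1 scale1r mul1r !add0r.
Qed.
End Graph.

Lemma dominated_functional (u : X) : exists l : X -> R,
  [/\ forall (a : R) x y, l (a%:C *: x + y) = a * l x + l y,
      l u = rn u & forall x, l x <= rn x].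
Proof.
pose P (G : set (X * R)) := G = set0 \/ dominated_graph u G.
have [F FP tot|A [AP maxA]] := @Zorn_bigcup _ P.
  have [[G0 FG0 [p0 Gp0]]|] := pselect (exists2 G, F G & G !=set0); last first.
    move=> nF; left; apply/seteqP; split=> // p [G FG Gp].
    by apply: nF; exists G => //; exists p.
  have dom G p : F G -> G p -> dominated_graph u G.
    by move=> FG Gp; case: (FP _ FG) => // GE; move: Gp; rewrite GE.
  right; split.
  - by exists G0 => //; case: (dom _ _ FG0 Gp0).
  - move=> a p q [G1 F1 G1p] [G2 F2 G2q].
    have [G12|G21] := tot _ _ F1 F2.
      by exists G2 => //; have [_ H _] := dom _ _ F2 G2q; apply: H => //; apply: G12.
    by exists G1 => //; have [_ H _] := dom _ _ F1 G1p; apply: H => //; apply: G21.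
  by move=> p [G FG Gp]; have [_ _ H] := dom _ _ FG Gp; apply: H.
have dA : dominated_graph u A.
  (* A maximal graph is not empty: the graph over the real line through [u] would be larger. *)
  case: AP => // A0; pose G0 := [set p : X * R | exists t : R, p = (t%:C *: u, t * rn u)].
  have dG0 : dominated_graph u G0.
    split.
    - by exists 1; rewrite rmorph1 scale1r mul1r.
    - move=> a _ _ [t ->] [t' ->] /=; exists (a * t + t'); congr (_, _); last by ring.
      by rewrite rmorphD rmorphM /=; module.
    by move=> _ [t ->] /=; rewrite rnZ rn_real ler_wpM2r ?rn_ge0 // ler_norm.
  exfalso; apply: (maxA G0); last by right.
  by rewrite A0; split=> // /(_ (u, rn u)); apply; case: dG0.
have /choice[l lP] : forall x, exists s, A (x, s).
  move=> x; apply: contrapT => /forallNP /(dominated_graph_extend dA)[B dB AB].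
  by apply: (maxA B) => //; right.
have [Au lin bd] := dA.
exists l; split.
- move=> a x y; have := lin a (x, l x) (y, l y) (lP x) (lP y).
  exact: (dominated_graph_fun dA (lP _)).
- exact: (dominated_graph_fun dA (lP u) Au).
by move=> x; apply: bd (lP x).
Qed.

(** Complexify [l] as [l x - i l(i x)]. Rotating [x] until [T x] is real and nonnegative bounds
    [|T x|] by a value of [l]. At [u] the real part is already [|u|], so this bound leaves no room
    for an imaginary part. *)
Lemma exists_support_functional (u : X) : u != 0 ->
  exists T : {linear X -> C^o}, support_functionals u T.
Proof.
move=> u0; have [l [lin lu lb]] := dominated_functional u.
have l0 : l 0 = 0 by have := lin (-1) 0 0; rewrite scaler0 addr0 mulN1r addNr.
have lD x y : l (x + y) = l x + l y by have := lin 1 x y; rewrite rmorph1 scale1r mul1r.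
have lZ a x : l (a%:C *: x) = a * l x by have := lin a x 0; rewrite !addr0 l0 addr0.
pose t (x : X) : C^o := l x +i* - l ('i *: x).
have tlin (a : C) x y : t (a *: x + y) = a *: t x + t y.
  case: a => a b; have -> : a +i* b = a%:C + b%:C * 'i :> C by rewrite [LHS]complexE mulrC.
  rewrite /t !scalerDr !lD.
  have -> : (a%:C + b%:C * 'i) *: x = a%:C *: x + b%:C *: ('i *: x) by module.
  have -> : 'i *: (a%:C *: x + b%:C *: ('i *: x)) = a%:C *: ('i *: x) + (- b)%:C *: x.
    rewrite scalerDr !scalerA; congr (_ *: _ + _ *: _); first by rewrite mulrC.
    by apply/eqP; rewrite eq_complex /=; apply/andP; split; apply/eqP; ring.
  rewrite !lD !lZ /GRing.scale /=.
  by apply/eqP; rewrite eq_complex /=; apply/andP; split; apply/eqP; ring.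
pose T := mk_linear tlin.
have TE x : T x = t x by [].
have Tb x : rn (T x) <= rn x.
  have [->|Tx0] := eqVneq (T x) 0; first by rewrite rn0 rn_ge0.
  have Tp : 0 < rn (T x) by rewrite rn_gt0.
  pose c : C := (rn (T x))%:C / T x.
  have c1 : rn c = 1 by rewrite /c rnM rnV rn_real ger0_norm ?rn_ge0 // mulfV // gt_eqF.
  have : T (c *: x) = (rn (T x))%:C.
    by rewrite linearZ; apply: mulfVK.
  rewrite TE => -[<- _]; apply: le_trans (lb _) _.
  by rewrite rnZ c1 mul1r.
have Tu : T u = `|u|.
  have H := Tb u; rewrite TE /t lu in H *; rewrite rnE.
  suff -> : l ('i *: u) = 0 by rewrite oppr0.
  move: H; rewrite -(ler_pXn2r (n := 2)) ?nnegrE ?rn_ge0 // -lecR !rmorphXn /= -rnE.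
  rewrite -add_Re2_Im2 /= lecE /= => /andP[_]; rewrite sqrrN => H.
  apply/eqP; rewrite -sqrf_eq0 eq_le sqr_ge0 andbT.
  move: H; rewrite mulr0 subr0; lra.
exists T; split=> //.
  by apply/bounded_continuous; exists 1 => x; rewrite mul1r.
have up : 0 < rn u by rewrite rn_gt0.
apply/eqP; rewrite eq_le; apply/andP; split.
  apply: ge_sup; first by exists (rn (T 0)); exists 0 => //=; rewrite normr0.
  move=> _ [y /= y1 <-]; apply: le_trans (Tb y) _.
  by rewrite -lecR -rnE.
apply: sup_upper_bound.
  split; first by exists (rn (T 0)); exists 0 => //=; rewrite normr0.
  exists 1 => _ [y /= y1 <-]; apply: le_trans (Tb y) _.
  by rewrite -lecR -rnE.
exists ((rn u)^-1%:C *: u).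
  by rewrite /= rnE rnZ rn_real gtr0_norm ?invr_gt0 // mulVf ?gt_eqF.
transitivity (rn (T ((rn u)^-1%:C *: u))) => //.
rewrite linearZ rnZ Tu rnE !rn_real !gtr0_norm ?invr_gt0 //.
by rewrite mulVf ?gt_eqF.
Qed.
End HahnBanach.

(** * Sharpness *)

Section ComplexLogarithm.
Context {R : realType}.
Local Notation C := R[i].

Lemma continuous_bound (g : R -> R) (x : R) : {for x, continuous g} ->
  forall e : R, 0 < e -> exists2 r : R, 0 < r & forall y, `|y - x| < r -> `|g y - g x| <= e.
Proof.
move=> /cvgrPdist_le cg e /cg [r /= r0 H]; exists r => // y yx.
by rewrite distrC; apply: H; rewrite /ball_ /= distrC.
Qed.

(* Principal branch, used on the right half-plane only. *)
Definition clog (z : C) : C := ln (rn z) +i* atan (complex.Im z / complex.Re z).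

Lemma clog1 : clog 1 = 0.
Proof. by rewrite /clog rn1 ln1 /= mul0r atan0. Qed.

Lemma clogK z : 0 < complex.Re z -> cexp (clog z) = z.
Proof.
case: z => x y /= x0; rewrite /cexp /= lnK; last first.
  by rewrite posrE rn_gt0; apply/eqP => -[xE _]; rewrite xE ltxx in x0.
set t := y / x; set s := Num.sqrt (1 + t ^+ 2).
have s0 : 0 < s by rewrite sqrtr_gt0 ltr_pwDl // sqr_ge0.
have cs : cos (atan t) = s^-1 := cos_atan t.
have sn : sin (atan t) = t / s.
  by have := atanK t; rewrite /tan cs invrK => {2}<-; rewrite mulfK // gt_eqF.
have -> : rn (x +i* y) = x * s.
  rewrite /rn normc_def /= (_ : x ^+ 2 + y ^+ 2 = x ^+ 2 * (1 + t ^+ 2)).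
    by rewrite sqrtrM ?sqr_ge0 // sqrtr_sqr gtr0_norm.
  by rewrite /t; field; rewrite gt_eqF.
rewrite cs sn; apply/eqP; rewrite eq_complex /= !(mul0r, addr0, subr0); apply/andP; split.
  by rewrite mulfK // gt_eqF.
by rewrite /t; apply/eqP; field; rewrite !gt_eqF.
Qed.

Lemma clog_continuous z : 0 < complex.Re z -> small_o 0 (fun h => clog (z + h) - clog z).
Proof.
move=> z0 e e0; set x := complex.Re z in z0 *; set y := complex.Im z.
have zp : 0 < rn z by apply: lt_le_trans z0 (Re_le_rn z).
have e2 : 0 < e / 2 by rewrite divr_gt0.
have [r r0 Hr] := continuous_bound (continuous_ln zp) e2.
have [s s0 Hs] := continuous_bound (@continuous_atan R (y / x)) e2.
(* Bounds the change of [Im / Re] per unit of [h] while [|h| < x / 2], where the new real part still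
   exceeds [x / 2]. *)
pose k := 2 * (x + `|y|) / x ^+ 2.
have k0 : 0 < k by rewrite /k divr_gt0 ?exprn_gt0 // mulr_gt0 // ltr_pwDl.
exists (Num.min r (Num.min (x / 2) (s / k))).
  by rewrite !lt_min r0 (divr_gt0 s0 k0) (divr_gt0 z0).
move=> h; rewrite lt_min lt_min => /and3P[hr hx]; rewrite ltr_pdivlMr // => hs.
rewrite expr0 mulr1 (splitr e); apply: le_trans (rn_le_ReIm _) _.
rewrite !raddfB /= lerD //.
  apply: Hr; apply: le_lt_trans hr; rewrite ler_norml.
  have := ler_rn_dist (z + h) z; have := ler_rn_dist z (z + h).
  by rewrite rn_distC (_ : z + h - z = h); [lra | rewrite addrC addKr].
apply: Hs; apply: le_lt_trans hs; rewrite !raddfD -/x -/y.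
have ha := normr_Re_le h.
have hb : `|complex.Im h| <= rn h.
  have := normr_Re_le ('i * h); rewrite rnM rn_i mul1r.
  by case: (h) => a b /=; rewrite mul0r mul1r sub0r normrN.
set a := complex.Re h in ha *; set b := complex.Im h in hb *.
have xa : x / 2 < x + a by have := ler_norm (- a); rewrite normrN; lra.
have xa0 : 0 < x + a by lra.
have -> : (y + b) / (x + a) - y / x = (b * x - y * a) / (x * (x + a)).
  by field; rewrite !gt_eqF.
have xxa : 0 < x * (x + a) by rewrite mulr_gt0.
rewrite normrM normfV (gtr0_norm xxa) ler_pdivrMr //.
have h1 : `|b * x - y * a| <= rn h * (x + `|y|).
  apply: le_trans (ler_normB _ _) _; rewrite !normrM (gtr0_norm z0) mulrDr.
  by rewrite lerD // ?ler_wpM2r // ?(ltW z0) // mulrC ler_wpM2r.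
apply: le_trans h1 _; rewrite /k.
have -> : rn h * (2 * (x + `|y|) / x ^+ 2) * (x * (x + a)) =
    rn h * (x + `|y|) * (2 * (x + a) / x) by field; rewrite gt_eqF.
rewrite ler_peMr //; first by rewrite mulr_ge0 ?rn_ge0 // addr_ge0 // ltW.
by rewrite ler_pdivlMr //; lra.
Qed.

(* Inverse function rule: [cexp] has derivative [z] at [clog z]. *)
Lemma has_cderiv_clog z : 0 < complex.Re z -> has_cderiv (clog : C -> C^o) z z^-1.
Proof.
move=> z0; have zp : 0 < rn z by apply: lt_le_trans z0 (Re_le_rn z).
have nz : z != 0 by rewrite -rn_gt0.
pose k h := clog (z + h) - clog z.
pose E w : C^o := cexp (clog z + w) - cexp (clog z) - w * cexp (clog z).
have oE : small_o 1 E := has_cderiv_cexp (clog z).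
have kE h : rn h < complex.Re z -> E (k h) = h - k h * z.
  move=> hz; rewrite /E /k [clog z + _]addrC subrK !clogK //; first by rewrite [z + h]addrC addrK.
  rewrite raddfD /=; have := normr_Re_le h.
  by have := ler_norm (- complex.Re h); rewrite normrN; lra.
(* The remainder bound gives [|h - k z| <= |z| / 2 * |k|], and absorbing the right side yields
   [|k| <= 2 |h| / |z|]. Only then can [k] be substituted into [oE]. *)
have bk : big_o 1 k.
  have zp2 : 0 < rn z / 2 by rewrite divr_gt0.
  have [r r0 Hr] := oE _ zp2.
  have [s s0 Hs] := clog_continuous z0 (divr_gt0 r0 (ltr0Sn _ 1)).
  exists (2 / rn z); first exact: divr_gt0.
  exists (Num.min s (complex.Re z)); first by rewrite lt_min s0.
  move=> h; rewrite lt_min => /andP[/Hs + hz]; rewrite expr0 mulr1 -/(k h) => kr.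
  have := Hr (k h) (le_lt_trans kr _); rewrite kE // !expr1 => /(_ _) H.
  have {}H : rn (h - k h * z) <= rn z / 2 * rn (k h) by apply: H; lra.
  rewrite mulrAC ler_pdivlMr //; have := ler_rn_dist (k h * z) h.
  by rewrite rn_distC rnM; lra.
have := big_o_small_oZ (big_o_cst (- z^-1)) (small_o_comp bk oE).
apply: (small_o_near z0) => h hz; rewrite kE // /GRing.scale /= /k; field.
exact: nz.
Qed.
End ComplexLogarithm.

(** * The scalar factor of the extremal map *)

Section ExtremalFactor.
Context {R : realType}.
Local Notation C := R[i].
Variable alpha : R.
Hypotheses (alpha_ge0 : 0 <= alpha) (alpha_lt1 : alpha < 1).
Local Notation beta := (1 - 2 * alpha).

Lemma betaM_lt1 (s : C) : rn s < 1 -> rn (beta%:C * s) < 1.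
Proof.
move=> s1; rewrite rnM rn_real; apply: le_lt_trans s1.
rewrite ler_piMl ?rn_ge0 // ler_norml; have := alpha_ge0; have := alpha_lt1; lra.
Qed.

Lemma one_sub_beta_neq0 (s : C) : rn s < 1 -> 1 - beta%:C * s != 0.
Proof.
move=> /betaM_lt1 s1; rewrite subr_eq0; apply/eqP => E.
by move: s1; rewrite -E rn1 ltxx.
Qed.

(** The primitive is [- (1 - alpha) / beta * clog (1 - beta * s)]; for [alpha = 1 / 2] it
    degenerates to a linear function and is treated apart. *)
Lemma extremal_exponent : exists2 A : C -> C^o, A 0 = 0 &
  forall s, rn s < 1 -> has_cderiv A s ((1 - alpha)%:C / (1 - beta%:C * s)).
Proof.
have lin (k : C) s : has_cderiv (fun s => k * s : C^o) s k.
  have := has_cderivM (has_cderiv_cst (k : C^o) s) (has_cderiv_id s).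
  by rewrite mulr1 mul0r addr0.
have [b0|b0] := eqVneq beta 0.
  exists (fun s => (1 - alpha)%:C * s); first by rewrite mulr0.
  by move=> s _; rewrite b0 rmorph0 mul0r subr0 divr1; apply: lin.
have bC : beta%:C != 0 :> C by rewrite (inj_eq (@complexI R) _ 0).
exists (fun s => - ((1 - alpha)%:C / beta%:C) * clog (1 - beta%:C * s)).
  by rewrite mulr0 subr0 clog1 mulr0.
move=> s s1; have sN := one_sub_beta_neq0 s1.
have Re0 : 0 < complex.Re (1 - beta%:C * s).
  have -> : complex.Re (1 - beta%:C * s) = 1 - complex.Re (beta%:C * s) by rewrite raddfB.
  rewrite subr_gt0.
  exact: le_lt_trans (Re_le_rn _) (betaM_lt1 s1).
have d1 : has_cderiv (fun s => 1 - beta%:C * s : C^o) s (- beta%:C).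
  by have := has_cderivB (has_cderiv_cst (1 : C^o) s) (lin beta%:C s); rewrite add0r.
have := has_cderiv_comp d1 (lin (- ((1 - alpha)%:C / beta%:C)) _).
have d2 := has_cderiv_comp d1 (has_cderiv_clog Re0).
have := has_cderivM (has_cderiv_cst (- ((1 - alpha)%:C / beta%:C) : C^o) s) d2.
rewrite mul0r addr0 => + _; congr has_cderiv; rewrite /GRing.scale /=.
move: bC sN; move: beta%:C (1 - alpha)%:C => b a b0' sN; field.
by rewrite sN b0'.
Qed.

(** [phi t] is [1 - beta * t ^ 2] to the power [- (1 - alpha) / beta]. Writing it as
    [cexp (A (t ^ 2))] covers [beta = 0] and makes nonvanishing immediate. *)
Lemma extremal_factor : exists phi dphi : C -> C, [/\ phi 0 = 1,
  forall t, rn t < 1 -> has_cderiv (phi : C -> C^o) t (dphi t),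
  forall t, rn t < 1 -> phi t != 0,
  forall t, rn t < 1 -> dphi t = phi t * (2 * (1 - alpha)%:C * t / (1 - beta%:C * t ^+ 2)) &
  small_o 2 (fun h => phi h - (1 + (1 - alpha)%:C * h ^+ 2) : C^o)].
Proof.
have [A A0 dA] := extremal_exponent.
have sq1 (t : C) : rn t < 1 -> rn (t ^+ 2) < 1.
  by move=> t1; rewrite rnX exprn_ilt1 // rn_ge0.
pose phi t := cexp (A (t ^+ 2)).
exists phi, (fun t => phi t * (2 * (1 - alpha)%:C * t / (1 - beta%:C * t ^+ 2))).
split=> //.
- by rewrite /phi expr0n A0 cexp0.
- move=> t /sq1 t1.
  have dsq : has_cderiv (fun w : C => w ^+ 2 : C^o) t (t * 1 + 1 * t).
    exact: has_cderivM (has_cderiv_id t) (has_cderiv_id t).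
  have := has_cderiv_comp (has_cderiv_comp dsq (dA _ t1)) (has_cderiv_cexp _).
  congr has_cderiv; rewrite /GRing.scale /= -/(phi t).
  have := one_sub_beta_neq0 t1; move: beta%:C (phi t) => b p nb; field.
  exact: nb.
- by move=> t _; apply: cexp_neq0.
have d0 : rn (0 : C) < 1 by rewrite rn0.
(* A first-order expansion in [s = h ^ 2] is a second-order expansion in [h]. *)
have := has_cderiv_comp (dA 0 d0) (has_cderiv_cexp _).
rewrite mulr0 subr0 divr1 A0 cexp0 /GRing.scale /= mulr1 => H e e0.
have [r r0 Hr] := H e e0; exists (Num.min r 1); first by rewrite lt_min r0 ltr01.
move=> h; rewrite lt_min => /andP[hr h1].
have h2 : rn (h ^+ 2) < r.
  by rewrite rnX expr2; have := rn_ge0 h; nra.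
have := Hr _ h2; rewrite add0r A0 cexp0 expr1 rnX; apply: le_trans.
by rewrite le_eqVlt; apply/orP; left; apply/eqP; congr rn; rewrite /phi /GRing.scale /=; ring.
Qed.

(** The quotient is [alpha + (1 - alpha) * (1 - s) / (1 + s)], and the Cayley transform maps the
    disc into the right half-plane. *)
Lemma extremal_real_part (s : C) : rn s < 1 ->
  1 + s != 0 /\ alpha <= complex.Re ((1 - beta%:C * s) / (1 + s)).
Proof.
move=> s1; have s0 : 1 + s != 0.
  by rewrite addr_eq0; apply/eqP => E; move: s1; rewrite -[s]opprK -E rnN rn1 ltxx.
split=> //.
have -> : (1 - beta%:C * s) / (1 + s) = alpha%:C + (1 - alpha)%:C * ((1 - s) / (1 + s)).
  by rewrite !rmorphB !rmorphM /= rmorph1 (rmorph_nat (real_complex R)); field.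
have H : 0 <= complex.Re ((1 - s) / (1 + s)).
  have : rn s ^+ 2 < 1 by rewrite exprn_ilt1 // rn_ge0.
  rewrite -ltcR rmorphXn /= -rnE -add_Re2_Im2 ltcR; case: s {s1} s0 => a b /= s0 ab.
  rewrite (_ : _ - _ = (1 - a ^+ 2 - b ^+ 2) / ((1 + a) ^+ 2 + (0 + b) ^+ 2)); last by ring.
  by rewrite divr_ge0 //; [lra | rewrite addr_ge0 ?sqr_ge0].
by move: (_ / _) H => [a b] /= H; rewrite mul0r subr0 lerDl mulr_ge0 // subr_ge0 ltW.
Qed.
End ExtremalFactor.

(** * The extremal map and its Taylor coefficients *)

Section ExtremalMap.
Context {R : realType} {X : completeNormedModType R[i]}.
Local Notation C := R[i].

Lemma small_o_monomials2 {W : normedModType C} n (p q : W) :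
  small_o n.+1 (fun h : C => h ^+ n *: p + h ^+ n.+1 *: q) -> p = 0 /\ q = 0.
Proof.
have lead m (c : W) : small_o m (fun h : C => h ^+ m *: c) -> c = 0.
  move=> oc; apply/eqP; rewrite -rn_eq0 eq_le rn_ge0 andbT.
  apply/ler_addgt0Pr => e e0; rewrite add0r; have [r r0 H] := oc e e0.
  have r20 : 0 < r / 2 by rewrite divr_gt0.
  have := H (r / 2)%:C; rewrite rnZ rnX rn_real gtr0_norm // [leLHS]mulrC.
  rewrite ler_pM2r ?exprn_gt0 //; apply.
  by rewrite ltr_pdivrMr // ltr_pMr // ltr1n.
move=> H; have p0 : p = 0.
  apply: (lead n); have H1 : small_o n (fun h : C => h ^+ n.+1 *: q).
    by have := small_o_big_oZ (small_oX n) (big_o_cst q); rewrite addn0.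
  by apply: small_o_ext (small_oB (small_oW H) H1) => h; rewrite addrK.
split=> //; apply: (lead n.+1); apply: small_o_ext H => h.
by rewrite p0 scaler0 add0r.
Qed.

Variables (alpha : R) (T : {linear X -> C^o}).
Hypotheses (alpha_ge0 : 0 <= alpha) (alpha_lt1 : alpha < 1).
Hypothesis Tb : forall y, rn (T y) <= rn y.
Local Notation beta := (1 - 2 * alpha).

Variables phi dphi : C -> C.
Hypotheses (phi0 : phi 0 = 1)
  (dphiP : forall t, rn t < 1 -> has_cderiv (phi : C -> C^o) t (dphi t))
  (phi_neq0 : forall t, rn t < 1 -> phi t != 0)
  (dphiE : forall t, rn t < 1 ->
     dphi t = phi t * (2 * (1 - alpha)%:C * t / (1 - beta%:C * t ^+ 2)))
  (phi_taylor : small_o 2 (fun h => phi h - (1 + (1 - alpha)%:C * h ^+ 2) : C^o)).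

Definition extremal_map (x : X) : X := phi (T x) *: x.

Local Notation f := extremal_map.

Definition extremal_diff (x h : X) : X := phi (T x) *: h + (dphi (T x) * T h) *: x.

Let T1 x : rn x < 1 -> rn (T x) < 1. Proof. exact: le_lt_trans (Tb x). Qed.

Let TZ a u : T (a *: u) = a * T u. Proof. exact: linearZ. Qed.
Let TD u v : T (u + v) = T u + T v. Proof. exact: linearD. Qed.
Let TB u v : T (u - v) = T u - T v. Proof. exact: linearB. Qed.

Lemma extremal_fder x : rn x < 1 -> fder f x (extremal_diff x).
Proof.
move=> /T1 t1; set t := T x in t1.
have bT : big_o 1 (T : X -> C^o).
  by exists 1 => //; exists 1 => // h _; rewrite mul1r expr1 Tb.
have oa := small_o_comp bT (dphiP t1).
have od : small_o 0 (fun h => phi (t + T h) - phi t : C^o).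
  exact: small_o_comp bT (has_cderiv_cont (dphiP t1)).
split.
- move=> a u v; rewrite /extremal_diff -/t.
  by rewrite TD TZ; move: (phi t) (dphi t) (T u) (T v) => p d tu tv; module.
- exists (rn (phi t) + rn (dphi t) * rn x) => u; rewrite /extremal_diff -/t.
  apply: le_trans (ler_rnD _ _) _; rewrite !rnZ rnM mulrDl lerD // mulrAC.
  by rewrite ler_wpM2l ?mulr_ge0 ?rn_ge0.
have H1 := small_o_big_oZ oa (big_o_cst x).
have H2 := small_o_big_oZ od (big_o_id : big_o 1 (id : X -> X)).
apply: small_o_ext (small_oD H1 H2) => h.
rewrite [T h *: (dphi t : C^o)](_ : _ = T h * dphi t) // /extremal_map /extremal_diff TD -/t.
by move: (phi (t + T h)) (phi t) (dphi t) (T h) => p1 p d th; module.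
Qed.

Lemma extremal_diffE x h : rn x < 1 -> 'd f x h = extremal_diff x h.
Proof. by move=> /extremal_fder/fder_diff[_ ->]. Qed.

Let sq1 (t : C) : rn t < 1 -> rn (t ^+ 2) < 1.
Proof. by move=> t1; rewrite rnX exprn_ilt1 // rn_ge0. Qed.

(** The eigenvalue of [extremal_diff x] on [x] when [t = T x]; also [T (extremal_diff x h) = radial
    (T x) * T h]. *)
Let radial t := phi t + t * dphi t.

(** [2 * (1 - alpha) - beta = 1] turns [1 + t * dphi t / phi t] into this quotient, the reciprocal
    of the one in [extremal_real_part] at [t ^ 2]. *)
Let radialE t : rn t < 1 -> radial t = phi t * ((1 + t ^+ 2) / (1 - beta%:C * t ^+ 2)).
Proof.
move=> t1; rewrite /radial dphiE //.
have bE : beta%:C = 2 * (1 - alpha)%:C - 1 :> C.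
  by rewrite !rmorphB !rmorphM /= rmorph1 (rmorph_nat (real_complex R)); ring.
have := one_sub_beta_neq0 alpha_ge0 alpha_lt1 (sq1 t1); rewrite bE.
move: (1 - alpha)%:C => a nb; field; exact: nb.
Qed.

Let radial_neq0 t : rn t < 1 -> radial t != 0.
Proof.
move=> t1; rewrite radialE // !mulf_neq0 ?phi_neq0 ?invr_neq0 //.
  by case: (extremal_real_part alpha_lt1 (sq1 t1)).
exact: one_sub_beta_neq0 (sq1 t1).
Qed.

(** The Sherman-Morrison formula: [extremal_diff x] is a scalar operator plus the rank one operator
    [dphi (T x) * T h] times [x]. *)
Definition extremal_diff_inv (x y : X) : X :=
  (phi (T x))^-1 *: (y - (dphi (T x) * T y / radial (T x)) *: x).

Let extremal_diffK x : rn x < 1 -> cancel (extremal_diff x) (extremal_diff_inv x).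
Proof.
move=> /T1 t1 h; rewrite /extremal_diff /extremal_diff_inv.
have p0 := phi_neq0 t1; have r0 := radial_neq0 t1.
have -> : T (phi (T x) *: h + (dphi (T x) * T h) *: x) = radial (T x) * T h.
  by rewrite TD !TZ /radial; ring.
rewrite (_ : dphi (T x) * (radial (T x) * T h) / radial (T x) = dphi (T x) * T h).
  by rewrite addrK scalerA mulVf // scale1r.
by field.
Qed.

Let extremal_diff_invK x : rn x < 1 -> cancel (extremal_diff_inv x) (extremal_diff x).
Proof.
move=> /T1 t1 y; rewrite /extremal_diff /extremal_diff_inv.
have p0 := phi_neq0 t1; have r0 := radial_neq0 t1.
have -> : T ((phi (T x))^-1 *: (y - (dphi (T x) * T y / radial (T x)) *: x)) =
    T y / radial (T x).
  rewrite TZ TB TZ.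
  have E : dphi (T x) * T x = radial (T x) - phi (T x) by rewrite /radial; ring.
  rewrite (_ : dphi (T x) * T y / radial (T x) * T x =
    (dphi (T x) * T x) * T y / radial (T x)); last by ring.
  by rewrite E; field; rewrite p0 r0.
by rewrite scalerA mulfV // scale1r mulrA subrK.
Qed.

Lemma extremal_has_inverse x : rn x < 1 -> has_bounded_inverse ('d f x).
Proof.
move=> Ux; have lin (a : C) u v : extremal_diff_inv x (a *: u + v) =
    a *: extremal_diff_inv x u + extremal_diff_inv x v.
  rewrite /extremal_diff_inv TD TZ.
  by move: (phi _) (dphi _) (radial _) (T u) (T v) => p d r tu tv; module.
exists (mk_linear lin); split.
- apply/bounded_continuous.
  exists (rn (phi (T x))^-1 * (1 + rn (dphi (T x)) / rn (radial (T x)) * rn x)) => u.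
  rewrite [rn (mk_linear _ _)](_ : _ = rn (extremal_diff_inv x u)) //.
  rewrite /extremal_diff_inv rnZ -[leRHS]mulrA ler_wpM2l ?rn_ge0 //.
  apply: le_trans (ler_rnB _ _) _; rewrite mulrDl mul1r lerD // rnZ !rnM rnV.
  rewrite [leLHS](_ : _ = rn (dphi (T x)) / rn (radial (T x)) * rn x * rn (T u)); last by ring.
  by rewrite ler_wpM2l // !mulr_ge0 ?invr_ge0 ?rn_ge0.
- by move=> h; rewrite extremal_diffE //; apply: extremal_diffK.
by move=> h; rewrite extremal_diffE //; apply: extremal_diff_invK.
Qed.

(** Since [x] is an eigenvector of the derivative, solving for the preimage of [f x] amounts to
    dividing [phi (T x)] by [radial (T x)]. *)
Lemma extremal_inv_at x : rn x < 1 ->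
  inv_at ('d f x) (f x) = ((1 - beta%:C * T x ^+ 2) / (1 + T x ^+ 2)) *: x.
Proof.
move=> Ux; have t1 := T1 Ux.
have [nz _] := extremal_real_part alpha_lt1 (sq1 t1).
have nb := one_sub_beta_neq0 alpha_ge0 alpha_lt1 (sq1 t1).
set y := _ *: x; have Hy : 'd f x y = f x.
  rewrite extremal_diffE // /extremal_diff TZ /extremal_map.
  rewrite scalerA -scalerDl; congr (_ *: _).
  have E := radialE t1.
  transitivity (radial (T x) * ((1 - beta%:C * T x ^+ 2) / (1 + T x ^+ 2))).
    by rewrite /radial; ring.
  rewrite E; move: nb nz; move: (1 - beta%:C * T x ^+ 2) (1 + T x ^+ 2) => b c b0 c0; field.
  by rewrite b0 c0.
rewrite /inv_at; apply: xget_unique => //= w Hw.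
by rewrite -[w](extremal_diffK Ux) -[y](extremal_diffK Ux) -!extremal_diffE // Hw Hy.
Qed.

(** The preimage of [f x] is a multiple of [x], so a support functional [S] at [x] sees only
    [S x = |x|], and the condition is the same for all of them. *)
Lemma extremal_almost_starlike : almost_starlike alpha f.
Proof.
have ball0 : rn (0 : X) < 1 by rewrite rn0.
split.
- by move=> x /unit_ballE/extremal_fder/fder_diff[].
- split=> [|v]; first by rewrite /extremal_map scaler0.
  by rewrite extremal_diffE // /extremal_diff scaler0 addr0 raddf0 phi0 scale1r.
- by move=> x /unit_ballE/extremal_has_inverse.
move=> x /unit_ballE Ux x0 S [_ _ Sx].
have [_ aRe] := extremal_real_part alpha_lt1 (sq1 (T1 Ux)).
rewrite extremal_inv_at //.
have -> : S (((1 - beta%:C * T x ^+ 2) / (1 + T x ^+ 2)) *: x) =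
    ((1 - beta%:C * T x ^+ 2) / (1 + T x ^+ 2)) * `|x|.
  by rewrite linearZ Sx.
rewrite rnE -rmorphM lecR; move: (_ / _) aRe => [a b] /= aRe.
by rewrite mulr0 subr0 ler_wpM2r ?rn_ge0.
Qed.

Lemma extremal_taylor x : rn x < 1 ->
  taylor2 f x x = 0 /\ taylor3 f x x x = ((1 - alpha)%:C * T x ^+ 2) *: x.
Proof.
move=> Ux; have ball0 : rn (0 : X) < 1 by rewrite rn0.
have holf : holomorphic_on_ball f by move=> y /unit_ballE/extremal_fder/fder_diff[].
have inball (z : C) : rn z < 1 -> rn (z *: x) < 1.
  by move=> z1; rewrite rnZ; have := rn_ge0 x; nra.
have line (g : X -> X) L (z : C) : fder g (z *: x) L ->
    has_cderiv (fun t : C => g (t *: x)) z (L x).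
  move=> H; have := @fder_line _ _ _ g 0 x L z; rewrite add0r => /(_ H).
  by apply: has_cderiv_ext => t; rewrite add0r.
have db (z : C) : rn z < 1 -> has_cderiv (fun t : C => f (t *: x)) z ('d f (z *: x) x).
  by move=> /inball Uz; apply: line; apply: holomorphic_fder.
have dA (z : C) : rn z < 1 ->
    has_cderiv (fun t : C => 'd f (t *: x) x) z (Dn 2 f (z *: x) [tuple x; x]).
  move=> /inball Uz.
  exact: (line (fun y => 'd f y x) _ z (fder_diff_ball holf x Uz)).
set a2 := taylor2 _ x x; set a3 := taylor3 _ x x x.
have dA2 : has_cderiv (fun t : C => Dn 2 f (t *: x) [tuple x; x]) 0 (6 *: a3).
  have H := fder_Dn2_ball holf x x ball0; move: H; rewrite -(scale0r x) => H.
  have := line (fun y => Dn 2 f y [tuple x; x]) _ 0 H; rewrite scale0r.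
  by rewrite /a3 /taylor3 scalerA mulfV ?scale1r // pnatr_eq0.
have f0 : f (0 *: x) = 0 by rewrite scale0r /extremal_map scaler0.
have df0 : 'd f (0 *: x) x = x.
  by rewrite scale0r extremal_diffE // /extremal_diff raddf0 scaler0 addr0 phi0 scale1r.
have D20 : Dn 2 f (0 *: x) [tuple x; x] = 2 *: a2.
  by rewrite scale0r /a2 /taylor2 scalerA mulfV ?scale1r // pnatr_eq0.
have [_ o1] := taylor_order3 ltr01 db dA dA2 f0 df0 D20.
have bT : big_o 1 (fun h : C => T (h *: x) : C^o).
  have := big_oZ (big_oX 1) (big_o_cst (T x : C^o)).
  by apply: big_o_ext => h; rewrite TZ.
(* The expansion of [phi], transported to [f (h *: x)], is subtracted from the Taylor expansion
   [o1]; the coefficients must agree. *)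
have o2 := big_o_small_oZ (big_oX 1) (small_o_big_oZ (small_o_comp bT phi_taylor) (big_o_cst x)).
have o3 : small_o 3 (fun h : C => h ^+ 2 *: (- a2) +
    h ^+ 3 *: (((1 - alpha)%:C * T x ^+ 2) *: x - a3)).
  apply: small_o_ext (small_oB o1 o2) => h; rewrite /extremal_map TZ.
  by move: (phi (h * T x)) => p; module.
have [/eqP] := small_o_monomials2 o3.
by rewrite oppr_eq0 => /eqP-> /eqP; rewrite subr_eq0 => /eqP <-.
Qed.
End ExtremalMap.

Theorem theorem2p3 (R : realType) (X : completeNormedModType R[i])
    (X_neq0 : exists v : X, v != 0)
    (alpha : R) (alpha_ge0 : 0 <= alpha) (alpha_lt1 : alpha < 1) :
  (forall f : X -> X, almost_starlike alpha f ->
    forall x : X, unit_ball x -> x != 0 ->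
    forall T : {linear X -> R[i]^o}, support_functionals x T ->
      `|fekete_szego alpha f x T| <= (2 * (1 - alpha))%:C * `|x| ^+ 4)
  /\
  (forall c : R,
    (forall f : X -> X, almost_starlike alpha f ->
      forall x : X, unit_ball x -> x != 0 ->
      forall T : {linear X -> R[i]^o}, support_functionals x T ->
        `|fekete_szego alpha f x T| <= c%:C * `|x| ^+ 4) ->
    2 * (1 - alpha) <= c).
Proof.
split=> [f starf x Ux x0 T HT|c Hc]; first exact: fekete_szego_bound.
have [v v0] := X_neq0.
have [x Ux x0] : exists2 x : X, rn x < 1 & x != 0.
  have vp : 0 < rn v by rewrite rn_gt0.
  exists ((2 * rn v)^-1%:C *: v); last first.
    rewrite scaler_eq0 negb_or v0 andbT (inj_eq (@complexI R) _ 0).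
    by rewrite invr_neq0 // gt_eqF // mulr_gt0.
  rewrite rnZ rn_real gtr0_norm ?invr_gt0 ?mulr_gt0 // invfM mulfVK ?gt_eqF //.
  by rewrite invf_lt1 // ltr1n.
have [T HT] := exists_support_functional x0; have [_ T1 Tx] := HT.
have Tb := dual_norm1_bound T1.
have [phi [dphi [phi0 dphiP pn0 dphiE ptay]]] := extremal_factor alpha_ge0 alpha_lt1.
have starf := extremal_almost_starlike alpha_ge0 alpha_lt1 Tb phi0 dphiP pn0 dphiE.
have [t2 t3] := extremal_taylor Tb phi0 dphiP ptay Ux.
have := Hc _ starf x ((unit_ballE x).2 Ux) x0 T HT.
have xp : 0 < rn x by rewrite rn_gt0.
have holf : holomorphic_on_ball (extremal_map T phi) by case: starf.
have t20 : taylor2 (extremal_map T phi) x 0 = 0.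
  have U0 : rn (0 : X) < 1 by rewrite rn0.
  have := @Dn2_scale _ _ _ holf 0 x 0 0 U0; rewrite !scale0r => E.
  by rewrite /taylor2 E scaler0.
(* Only the cubic term survives, and [T x = |x|] makes it equal to [2 * (1 - alpha) * |x| ^ 4], so
   any admissible [c] is at least the stated constant. *)
rewrite /fekete_szego t2 t20 t3 raddf0 mulr0 mul0r subr0 expr0n mul0r addr0.
have -> : T (((1 - alpha)%:C * T x ^+ 2) *: x) = (1 - alpha)%:C * T x ^+ 2 * T x.
  exact: linearZ.
rewrite Tx [`|x|]rnE.
rewrite (_ : 2 * _ * (rn x)%:C = (2 * (1 - alpha) * rn x ^+ 4)%:C); last first.
  by rewrite !rmorphM (rmorph_nat (real_complex R)) /=; ring.
rewrite rnE rn_real -rmorphXn -rmorphM lecR ger0_norm; last first.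
  by rewrite !mulr_ge0 ?exprn_ge0 ?rn_ge0 // subr_ge0 ltW.
by rewrite ler_pM2r // exprn_gt0.
Qed.
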